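(* Let $c>0$ be a constant, and for $n>c$ let $p=c/n$ and $q=1-p$. Let $U_n(0)=n$ and $U_n(k+1)=U_n(k)-b_n(k+1)$ for integers $k\ge 0$, where, conditionally on $U_n(0),\dots,U_n(k)$, $b_n(k+1)\sim\mathrm{Bin}(U_n(k),p)$. Define $$T_n(k)=\frac{U_n(k)}{\sqrt n\,q^{k}}-\sqrt n,\qquad k\ge 0 .$$ Then, as $n\to\infty$, the process $T_n(k)$, $0\le k\le n$, converges in distribution to a stretched-out Brownian motion with variance $e^{ck/n}-1$ at time $k$; that is, the càdlàg processes $\alpha\mapsto T_n(\lfloor \alpha n\rfloor)$, $0\le\alpha\le 1$, converge in distribution to the process $\alpha\mapsto B(e^{c\alpha}-1)$, $0\le\alpha\le1$, where $B$ is a standard Brownian motion.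
   Context: $\mathrm{Bin}(m,p)$ is the binomial distribution with $m$ trials and success probability $p$. $U_n(k)$ is the number of balls at time $k$ in urn 1 of a two-urn process with $n$ balls, all initially in urn 1, where at each step each ball in urn 1 is independently moved to urn 2 with probability $p$. For a continuous increasing function $H$ with $H(0)=0$, a stretched-out Brownian motion with variance process $H$ is the process $t\mapsto B(H(t))$, where $B$ is a standard Brownian motion. Convergence in distribution of càdlàg processes is convergence in the space of càdlàg functions (Skorokhod topology; since the limit is continuous this is equivalent to convergence with respect to the uniform metric). *)

(* Defs.v *)
From HB Require Import structures.
From mathcomp Require Import all_boot all_order all_algebra.
From mathcomp Require Import all_classical all_reals all_analysis.

Set Implicit Arguments.
Unset Strict Implicit.
Unset Printing Implicit Defensive.

Import Order.TTheory GRing.Theory Num.Theory.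
Import numFieldNormedType.Exports.

Local Open Scope classical_set_scope.
Local Open Scope ring_scope.

Definition cadlag {R : realType} (f : R -> R) : Prop :=
  (forall t : R, 0 <= t < 1 -> f x @[x --> t^'+] --> f t) /\
  (forall t : R, 0 < t <= 1 -> cvg (f x @[x --> t^'-])).

(* The space D[0,1].  The values of a path outside [0,1] are irrelevant: two
   paths that agree on [0,1] are at Skorokhod distance 0, hence they are not
   distinguished by open sets or by continuous functionals. *)
Record skorokhod (R : realType) := Skorokhod {
  path_of :> R -> R;
  path_cadlag : cadlag path_of }.

(* An increasing bijection of [0,1] is automatically continuous. *)
Definition time_change {R : realType} (l : R -> R) : Prop :=
  l @` `[0, 1]%classic = `[0, 1]%classic /\ {in `[0, 1] &, {homo l : s t / s < t}}.

(* The open ball of radius e around f for the metric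
   d(f, g) = inf_l max (sup_t |l t - t|, sup_t |f t - g (l t)|). *)
Definition skorokhod_ball {R : realType} (f : skorokhod R) (e : R)
    (g : skorokhod R) : Prop :=
  exists l r, [/\ time_change l, r < e &
    forall t : R, t \in `[0, 1] -> `|l t - t| <= r /\ `|f t - g (l t)| <= r].

Section skorokhod_topology.
Context {R : realType}.
Implicit Types (f g h : skorokhod R) (l : R -> R).

Lemma time_change_id : time_change (@idfun R).
Proof. by split; [rewrite image_id|move=> x y _ _]. Qed.

Lemma time_change_in l t : time_change l -> t \in `[0, 1] -> l t \in `[0, 1].
Proof.
move=> [limg _] t01; have : (l @` `[0, 1]%classic) (l t) by exists t.
by rewrite limg.
Qed.

Lemma time_change_comp l l' :
  time_change l -> time_change l' -> time_change (l' \o l).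
Proof.
move=> tl tl'; split.
  by rewrite -image_comp; case: tl => ->; case: tl'.
by move=> s t s01 t01 st /=; apply: tl'.2; rewrite ?time_change_in//; apply: tl.2.
Qed.

Lemma time_change_inv l : time_change l -> exists2 l', time_change l' &
  forall t, t \in `[0, 1] -> l (l' t) = t.
Proof.
move=> tl; have [limg lmon] := tl.
have H (y : R) : exists x : R, y \in `[0, 1] -> x \in `[0, 1] /\ l x = y.
  case: (boolP (y \in `[0, 1])) => y01; last by exists 0.
  have : (l @` `[0, 1]%classic) y by rewrite limg.
  by move=> [x x01 <-]; exists x.
have [l' l'P] := choice H.
have l'K x : x \in `[0, 1] -> l' (l x) = x.
  move=> x01; have [l'01 e] := l'P _ (time_change_in tl x01).
  apply/eqP; rewrite eq_le !leNgt; apply/andP.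
  by split; apply/negP => lt; have := lmon _ _ _ _ lt;
    rewrite e ltxx => H'; exact: notF (H' _ _).
exists l'; last by move=> t /l'P[].
split.
  apply/seteqP; split => [_ [y y01 <-]|x x01]; first by have [] := l'P _ y01.
  by exists (l x); [exact: time_change_in|exact: l'K].
move=> s t s01 t01 st; have [a01 a] := l'P _ s01; have [b01 b] := l'P _ t01.
rewrite ltNge; apply/negP; rewrite le_eqVlt => /orP[/eqP ba|ba].
  by move: st; rewrite -a -b ba ltxx.
by have := lmon _ _ b01 a01 ba; rewrite a b ltNge (ltW st).
Qed.

Lemma skorokhod_ball_center f (e : R) : 0 < e -> skorokhod_ball f e f.
Proof.
move=> e0; exists idfun, 0; split; [exact: time_change_id|exact: e0|].
by move=> t _; rewrite !subrr normr0.
Qed.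

Lemma skorokhod_ball_sym f g (e : R) :
  skorokhod_ball f e g -> skorokhod_ball g e f.
Proof.
move=> [l [r [tl re lr]]]; have [l' tl' ll'] := time_change_inv tl.
exists l', r; split => // t t01.
have [] := lr _ (time_change_in tl' t01).
by rewrite ll'// => a b; split; rewrite distrC.
Qed.

Lemma skorokhod_ball_triangle f g h (e1 e2 : R) :
  skorokhod_ball f e1 g -> skorokhod_ball g e2 h ->
  skorokhod_ball f (e1 + e2) h.
Proof.
move=> [l [r [tl re lr]]] [l' [r' [tl' re' lr']]].
exists (l' \o l), (r + r'); split; [exact: time_change_comp|exact: ltrD|].
move=> t t01; have [a b] := lr _ t01.
have [a' b'] := lr' _ (time_change_in tl t01); split => /=.
  by rewrite [r + r']addrC (le_trans (ler_distD (l t) _ _))// lerD.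
by rewrite (le_trans (ler_distD (g (l t)) _ _))// lerD.
Qed.

Lemma cadlag_cst (a : R) : cadlag (fun _ => a).
Proof. by split=> t _; [exact: cvg_cst|exact: is_cvg_cst]. Qed.

HB.instance Definition _ := gen_eqMixin (skorokhod R).
HB.instance Definition _ := gen_choiceMixin (skorokhod R).
HB.instance Definition _ :=
  isPointed.Build (skorokhod R) (Skorokhod (cadlag_cst 0)).
HB.instance Definition _ := hasNbhs.Build (skorokhod R)
  (nbhs_ (entourage_ (@skorokhod_ball R))).
HB.instance Definition _ := @Nbhs_isPseudoMetric.Build R (skorokhod R)
  (entourage_ (@skorokhod_ball R)) erefl (@skorokhod_ball R)
  skorokhod_ball_center skorokhod_ball_sym skorokhod_ball_triangle erefl.

End skorokhod_topology.

Definition borel_measurable d (T : measurableType d) (S : ptopologicalType)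
    (X : T -> S) : Prop :=
  measurable_fun [set: T] (X : T -> g_sigma_algebraType (@open S)).

(* The random elements X n may live on different probability spaces. *)
Definition cvg_in_distribution (R : realType) (S : ptopologicalType)
    (d : nat -> measure_display) (T : forall n, measurableType (d n))
    (P : forall n, probability (T n) R) (X : forall n, T n -> S)
    (d' : measure_display) (T' : measurableType d') (P' : probability T' R)
    (Y : T' -> S) : Prop :=
  [/\ forall n, borel_measurable (X n), borel_measurable Y &
    forall F : S -> R, continuous F -> (exists M : R, forall s, `|F s| <= M) ->
      'E_(P n)[F \o X n]%E @[n --> \oo] --> 'E_P'[F \o Y]%E].

Definition mutually_independent (R : realType) d (T : measurableType d)
    (P : probability T R) (m : nat) (X : nat -> T -> R) : Prop :=
  forall A : nat -> set R, (forall i, measurable (A i)) ->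
    P (\bigcap_(i < m) (X i @^-1` A i)) = (\prod_(i < m) P (X i @^-1` A i))%E.

(* The time set is [0, +oo[; the values B t for t < 0 play no role.
   [normal_prob] takes the standard deviation as its second parameter. *)
Definition standard_BM (R : realType) d (T : measurableType d)
    (P : probability T R) (B : R -> {mfun T >-> R}) : Prop :=
  [/\ forall w, B 0 w = 0,
    forall (m : nat) (t : nat -> R), 0 <= t 0%N -> (forall i, t i <= t i.+1) ->
      mutually_independent P m (fun i w => B (t i.+1) w - B (t i) w),
    forall s t : R, 0 <= s < t -> forall A : set R, measurable A ->
      P [set w | A (B t w - B s w)] = normal_prob 0 (Num.sqrt (t - s)) A &
    forall w, {within `[0, +oo[, continuous (fun t : R => B t w)}].

Definition variance_function {R : realType} (H : R -> R) : Prop :=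
  [/\ {within `[0, +oo[, continuous H},
    {in `[0, +oo[ &, {homo H : s t / s < t}} & H 0 = 0].

Lemma cadlag_stretched (R : realType) d (T : measurableType d)
    (P : probability T R) (B : R -> {mfun T >-> R}) (H : R -> R) (w : T) :
  standard_BM P B -> variance_function H -> cadlag (fun t => B (H t) w).
Proof.
move=> [_ _ _ /(_ w) cB] [cH mH H0].
have H_ge0 (t : R) : 0 <= t -> 0 <= H t.
  rewrite le_eqVlt => /orP[/eqP<-|t0]; first by rewrite H0.
  by rewrite -H0; apply/ltW/mH => //; rewrite in_itv/= ?lexx ?(ltW t0).
have c (t : R) : 0 <= t ->
    B (H x) w @[x --> within `[0, +oo[%classic (nbhs t)] --> B (H t) w.
  move=> t0.
  have Ht : H @ within `[0, +oo[%classic (nbhs t) --> H t.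
    by move/subspace_continuousP : cH; apply; rewrite /= in_itv/= t0.
  have BHt : B y w @[y --> within `[0, +oo[%classic (nbhs (H t))] --> B (H t) w.
    by move/subspace_continuousP : cB; apply; rewrite /= in_itv/= H_ge0.
  apply: cvg_comp BHt => U HU.
  have : nbhs t [set x | `[0, +oo[%classic x ->
      `[0, +oo[%classic (H x) -> U (H x)] by exact: Ht _ HU.
  apply: filterS => x + x0 => /(_ x0); apply.
  by move: x0; rewrite /= !in_itv/= !andbT; exact: H_ge0.
split => t /andP[t0 t1].
  apply: cvg_trans (c t t0) => U.
  change (nbhs t [set x | `[0, +oo[%classic x -> U (B (H x) w)] ->
    nbhs t [set x | t < x -> U (B (H x) w)]).
  apply: filterS => x + tx; apply; rewrite /= in_itv/= andbT.
  exact: le_trans t0 (ltW tx).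
apply/cvg_ex; exists (B (H t) w).
apply: cvg_trans (c t (ltW t0)) => U.
change (nbhs t [set x | `[0, +oo[%classic x -> U (B (H x) w)] ->
  nbhs t [set x | x < t -> U (B (H x) w)]).
move=> cU; apply: filterS2 cU (lt_nbhsr t0) => x + x0 _; apply.
by rewrite /= in_itv/= andbT ltW.
Qed.

Definition stretched_BM (R : realType) d (T : measurableType d)
    (P : probability T R) (B : R -> {mfun T >-> R}) (hB : standard_BM P B)
    (H : R -> R) (hH : variance_function H) (w : T) : skorokhod R :=
  Skorokhod (cadlag_stretched w hB hH).

Definition exp_variance {R : realType} (c t : R) : R := expR (c * t) - 1.

Lemma exp_variance_function (R : realType) (c : R) :
  0 < c -> variance_function (exp_variance c).
Proof.
move=> c0; split; last by rewrite /exp_variance mulr0 expR0 subrr.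
  apply: continuous_subspaceT => x.
  apply: cvgB; last exact: cvg_cst.
  apply: (continuous_comp (f := fun t => c * t)); last exact: continuous_expR.
  exact: mulrl_continuous.
by move=> s t _ _ st; rewrite /exp_variance ltrD2r ltr_expR ltr_pM2l.
Qed.

(* The third clause says that, conditionally on U 0, ..., U k, the variable
   b k.+1 has distribution Bin (U k, p): these variables being discrete, the
   conditional law is given on each event {U 0 = u 0, ..., U k = u k}.  In
   particular b k.+1 <= U k almost surely, so that the truncated subtraction
   on nat is almost surely a true subtraction. *)
Definition urn_process (R : realType) d (T : measurableType d)
    (P : probability T R) (n : nat) (p : R) (U b : nat -> {mfun T >-> nat}) :
    Prop :=
  [/\ forall w, U 0%N w = n,
    forall k w, U k.+1 w = (U k w - b k.+1 w)%N &
    forall (k : nat) (u : nat -> nat) (A : set nat),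
      let E := [set w | forall i, (i <= k)%N -> U i w = u i] in
      P (E `&` b k.+1 @^-1` A) = (P E * binomial_prob (u k) p A)%E].

Definition rescaled_urn {R : realType} (c : R) (n : nat) (u : nat -> nat)
    (k : nat) : R :=
  let q := 1 - c / n%:R in
  (u k)%:R / (Num.sqrt n%:R * q ^+ k) - Num.sqrt n%:R.

(* [Num.truncn] is the floor function on nonnegative reals. *)
Lemma cadlag_step (R : realType) (f : nat -> R) (n : nat) :
  cadlag (fun t : R => f (Num.truncn (t * n%:R))).
Proof.
have [->|n0] := posnP n.
  under eq_fun do rewrite mulr0; exact: cadlag_cst.
have nR : 0 < n%:R :> R by rewrite ltr0n.
split => t /andP[t0 t1].
  apply: cvg_near_cst; set k := Num.truncn (t * n%:R).
  have /andP[kl ku] : k%:R <= t * n%:R < k.+1%:R.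
    by apply: truncn_itv; rewrite mulr_ge0// ltW.
  near=> x; congr f; apply: truncn_def; apply/andP; split.
    by apply: (le_trans kl); rewrite ler_pM2r//; near: x; exact: nbhs_right_ge.
  rewrite -ltr_pdivlMr//; near: x; apply: nbhs_right_lt.
  by rewrite ltr_pdivlMr.
have [m ml mu] : exists2 m, m%:R < t * n%:R & t * n%:R <= m.+1%:R :> R.
  have tn0 : 0 < t * n%:R by rewrite mulr_gt0.
  have /andP[kl ku] := truncn_itv (ltW tn0).
  move: kl ku; set k := Num.truncn _ => kl ku.
  case: (ltgtP k%:R (t * n%:R)) kl => // kE _; first by exists k => //; exact: ltW.
  case: k ku kE => [|k] ku kE; first by rewrite -kE ltxx in tn0.
  by exists k; rewrite -kE// ltr_nat.
apply/cvg_ex; exists (f m); apply: cvg_near_cst.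
near=> x; congr f; apply: truncn_def; apply/andP; split.
  by rewrite -ler_pdivrMr//; near: x; apply: nbhs_left_ge; rewrite ltr_pdivrMr.
by apply: lt_le_trans mu; rewrite ltr_pM2r//; near: x; exact: nbhs_left_lt.
Unshelve. all: by end_near. Qed.

Definition rescaled_urn_path {R : realType} (c : R) (n : nat)
    (u : nat -> nat) : skorokhod R :=
  Skorokhod (cadlag_step (rescaled_urn c n u) n).

(* Main.v *)
(* Write T_n(k) = U_n(k) / (sqrt n q^k) - sqrt n, a martingale.  Conditionally on
   U_n(k) = u, the law of U_n(k + l) is Bin(u, q^l), so an increment of T_n over
   a block of times is a centered sum of u independent two-point variables.

   Finite-dimensional laws: cut [0, 1] into m blocks of equal length.  Over one
   block, Lindeberg's replacement argument compares the expectation of a bounded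
   Lipschitz function g of the increment with that of g at a Brownian increment,
   after smoothing g by a second difference of its second antiderivative.  The
   Brownian increments then replace the urn increments one block at a time.

   Tightness: Doob's inequality for the fourth moment bounds the probability that
   T_n oscillates by more than e inside one block by O(m^-2), hence inside some
   block by O(1/m).

   Conclusion: a bounded continuous F is the increasing limit of functionals F_k
   that are k-Lipschitz for the uniform distance.  For those, T_n and the limit
   may be replaced by their step approximations on the m blocks, which gives
   liminf E F(T_n) >= E F(Y); apply this to F and to -F.  Skorokhod's topology
   enters only because its balls contain the uniform ones. *)

Require Import Defs.
From mathcomp Require Import all_boot all_order all_algebra.
From mathcomp Require Import all_classical all_reals all_analysis.
From mathcomp Require Import measurable_realfun ring lra.

Set Implicit Arguments.
Unset Strict Implicit.
Unset Printing Implicit Defensive.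

Import Order.TTheory GRing.Theory Num.Theory.
Import numFieldNormedType.Exports.

Local Open Scope classical_set_scope.
Local Open Scope ring_scope.

(** * Binomial thinning and the urn chain *)

(** Independence and conditional laws are given only as product rules on events. Expectations are
    therefore rewritten as finite recursions ([urn_exp] for the urn, [chain_exp] for rounded
    independent variables); no product measure or conditional expectation is built. With q = 1 -
    c/n, the increment over l steps from time k, when u balls remain, has conditional variance (u /
    (n q^k)) (q^-(k+l) - q^-k). The first factor is random but within O(n^-1/2) of 1 in mean; the
    second telescopes over the blocks, with sums tending to e^(ct) - 1, the variance of the limit.
    The constants are uniform in n because q^n >= e^(-2c) as soon as n >= 2c. The fourth moment is
    needed for the oscillations: a second moment would bound each block by O(1/m), and summing over
    m blocks would leave no decay. Lipschitz functionals are needed because a continuous F need not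
    be uniformly continuous; approximating F by them from below takes the place of a compactness
    theorem for laws. *)

Section thinning.
Context {R : realType}.
Implicit Types (r s a x : R) (psi phi : nat -> R) (g : R -> R).

(* [thin r psi u] is the mean of [psi] under Bin(u, r), built up one ball at a
   time. *)
Fixpoint thin r psi (u : nat) : R :=
  if u is u'.+1 then r * thin r (psi \o S) u' + (1 - r) * thin r psi u'
  else psi 0%N.

Lemma eq_thin r psi phi u : (forall v, (v <= u)%N -> psi v = phi v) ->
  thin r psi u = thin r phi u.
Proof.
elim: u psi phi => [|u IH] psi phi H /=; first exact: H.
by congr (_ * _ + _ * _); apply: IH => v vu /=; apply: H => //; exact: leqW.
Qed.

Lemma le_thin r psi phi u : 0 <= r <= 1 ->
  (forall v, (v <= u)%N -> psi v <= phi v) -> thin r psi u <= thin r phi u.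
Proof.
move=> r01; elim: u psi phi => [|u IH] psi phi H /=; first exact: H.
case/andP: r01 => r0 r1.
by rewrite lerD// ler_wpM2l ?subr_ge0//; apply: IH => v vu /=; apply: H => //;
  exact: leqW.
Qed.

Lemma thin_dist r (e : R) psi phi u : 0 <= r <= 1 ->
  (forall v, `|psi v - phi v| <= e) -> `|thin r psi u - thin r phi u| <= e.
Proof.
move=> /andP[r0 r1]; elim: u psi phi => [|u IH] psi phi H /=; first exact: H.
have r1' : 0 <= 1 - r by rewrite subr_ge0.
rewrite (_ : _ - _ = r * (thin r (psi \o S) u - thin r (phi \o S) u) +
  (1 - r) * (thin r psi u - thin r phi u)); last by ring.
rewrite (le_trans (ler_normD _ _))// !normrM (ger0_norm r0) (ger0_norm r1').
have := ler_wpM2l r0 (IH (psi \o S) (phi \o S) (fun v => H v.+1)).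
have := ler_wpM2l r1' (IH psi phi H); lra.
Qed.

Lemma thin_cst r a u : thin r (fun=> a) u = a.
Proof.
elim: u => [//|u IH] /=.
by rewrite [thin r (_ \o _) u](_ : _ = thin r (fun=> a) u) // IH; ring.
Qed.

Lemma thin_lin r a s psi phi u :
  thin r (fun v => a * psi v + s * phi v) u = a * thin r psi u + s * thin r phi u.
Proof.
elim: u psi phi => [//|u IH] psi phi /=.
by rewrite (IH psi phi) -[thin r (_ \o _) u]/(thin r (fun v =>
  a * (psi \o S) v + s * (phi \o S) v) u) IH; ring.
Qed.

Lemma thinZ r a psi u : thin r (fun v => a * psi v) u = a * thin r psi u.
Proof.
rewrite -[RHS]addr0 -[X in _ + X](mul0r (thin r psi u)) -thin_lin.
by apply: eq_thin => v _; rewrite mul0r addr0.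
Qed.

(** Each ball survives both thinnings with probability [r * s], independently of the others. This is
    why [l] steps of the urn amount to one thinning with parameter [q ^+ l]. *)
Lemma thin_thin r s psi u : thin r (thin s psi) u = thin (r * s) psi u.
Proof.
elim: u psi => [//|u IH] psi /=.
rewrite -(IH psi) -(IH (psi \o S)).
rewrite [thin r (thin s psi \o S) u](_ : _ =
  s * thin r (thin s (psi \o S)) u + (1 - s) * thin r (thin s psi) u);
  last by rewrite -thin_lin.
ring.
Qed.

(** The index [k] counts removed balls, as the urn process does, hence [1 - r] and [u - k]. The
    induction is Pascal's rule. *)
Lemma thin_binomial r psi u : thin r psi u =
  \sum_(k < u.+1) binomial_pmf u (1 - r) k * psi (u - k)%N.
Proof.
have pmfE n k : binomial_pmf n (1 - r) k = ((1 - r) ^+ k * r ^+ (n - k)) *+ 'C(n, k).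
  by rewrite /binomial_pmf /unstable.onem subKr.
elim: u psi => [|u IH] psi.
  by rewrite big_ord1 pmfE /= subnn bin0 !expr0 mulr1n !mul1r.
rewrite /= !IH.
rewrite [RHS]big_ord_recl/= pmfE bin0 mulr1n expr0 mul1r subn0.
rewrite [X in _ = _ + X](_ : _ =
  \sum_(k < u.+1) r * (binomial_pmf u (1 - r) k.+1 * psi (u - k)%N)
  + \sum_(k < u.+1) (1 - r) * (binomial_pmf u (1 - r) k * psi (u - k)%N)); last first.
  rewrite -big_split; apply: eq_bigr => k _ /=.
  rewrite !pmfE /bump leq0n add1n binS mulrnDr subSS mulrDl; congr (_ + _).
    have [ku|uk] := ltnP k u; last by rewrite bin_small// !mulr0n !mul0r mulr0.
    by rewrite -{1}(subnSK ku) [r ^+ _.+1]exprS -!mulrnAl; ring.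
  by rewrite [(1 - r) ^+ k.+1]exprS -!mulrnAl; ring.
rewrite addrA -!mulr_sumr; congr (_ + _).
rewrite big_ord_recl/= pmfE bin0 mulr1n expr0 mul1r subn0 mulrDr.
rewrite [r ^+ u.+1]exprS mulrA; congr (_ + r * _).
rewrite [RHS]big_ord_recr/= [X in _ = _ + X](_ : _ = 0) ?addr0; last first.
  by rewrite pmfE bin_small// mulr0n mul0r.
apply: eq_bigr => k _; rewrite /bump leq0n add1n /=; congr (_ * psi _).
by rewrite subnSK.
Qed.

(** A surviving ball contributes [a * (r^-1 - 1)] and a removed one [- a]: [g] is averaged at [x]
    plus a sum of [u] independent centered two-point variables. For a suitable [a] this sum is the
    increment of the rescaled urn over a block. *)
Definition centered_thin r a g u x : R :=
  thin r (fun v => g (x + a * (v%:R / r - u%:R))) u.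

Lemma centered_thin0 r a g x : centered_thin r a g 0 x = g x.
Proof. by rewrite /centered_thin /= mul0r subr0 mulr0 addr0. Qed.

Lemma centered_thinS r a g u x : centered_thin r a g u.+1 x =
  r * centered_thin r a g u (x + a * (r^-1 - 1)) +
  (1 - r) * centered_thin r a g u (x - a).
Proof.
rewrite /centered_thin /=; congr (_ * _ + _ * _); apply: eq_thin => v _ /=.
  by congr g; rewrite -!natr1; ring.
by congr g; rewrite -!natr1; ring.
Qed.

Lemma centered_thin_id r a u x : r != 0 -> centered_thin r a id u x = x.
Proof.
move=> r0; elim: u x => [|u IH] x; first by rewrite centered_thin0.
by rewrite centered_thinS !IH; field.
Qed.

Lemma centered_thin_sqr r a u x : r != 0 ->
  centered_thin r a (fun y => y ^+ 2) u x = x ^+ 2 + u%:R * (a ^+ 2 * ((1 - r) / r)).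
Proof.
move=> r0; elim: u x => [|u IH] x; first by rewrite centered_thin0; ring.
by rewrite centered_thinS !IH -natr1; field.
Qed.

(** The last two terms are the fourth moment of the centered sum S: independence leaves [u] fourth
    moments and 3 u (u - 1) products of two variances. The others come from expanding (x + S)^4. *)
Lemma centered_thin_exp4 r a u x : r != 0 ->
  centered_thin r a (fun y => y ^+ 4) u x =
  x ^+ 4 + 6 * u%:R * (a ^+ 2 * ((1 - r) / r)) * x ^+ 2
  + 4 * u%:R * (a ^+ 3 * (r * (r^-1 - 1) ^+ 3 - (1 - r))) * x
  + u%:R * (a ^+ 4 * (r * (r^-1 - 1) ^+ 4 + (1 - r)))
  + 3 * u%:R * (u%:R - 1) * (a ^+ 2 * ((1 - r) / r)) ^+ 2.
Proof.
move=> r0; elim: u x => [|u IH] x; first by rewrite centered_thin0; ring.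
by rewrite centered_thinS !IH -natr1; field.
Qed.

(** Jensen's inequality: [l] is the tangent of [y ^+ 4] at [x], and its mean is its value at the
    mean [x]. *)
Lemma centered_thin_exp4_ge r a u x : 0 < r <= 1 ->
  x ^+ 4 <= centered_thin r a (fun y => y ^+ 4) u x.
Proof.
move=> /andP[r0 r1]; have rN0 : r != 0 by rewrite gt_eqF.
pose l y := 4 * x ^+ 3 * y + (-3 * x ^+ 4) * 1.
apply: (@le_trans _ _ (centered_thin r a l u x)).
  rewrite /centered_thin /l thin_lin.
  have := centered_thin_id a u x rN0; rewrite /centered_thin => ->.
  by rewrite thin_cst; lra.
apply: le_thin => [|v _]; first by rewrite ltW.
rewrite /l; set y := x + _.
rewrite -subr_ge0 (_ : _ - _ = (y - x) ^+ 2 * ((y + x) ^+ 2 + 2 * x ^+ 2)); last by ring.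
apply: mulr_ge0; first exact: sqr_ge0.
by apply: addr_ge0; [exact: sqr_ge0|apply: mulr_ge0 => //; exact: sqr_ge0].
Qed.

Lemma centered_thin_exp4_le r a u : 0 < r <= 1 ->
  centered_thin r a (fun y => y ^+ 4) u 0 <=
  u%:R * a ^+ 4 * ((1 - r) / r ^+ 3) + 3 * (u%:R * a ^+ 2 * ((1 - r) / r)) ^+ 2.
Proof.
move=> /andP[r0 r1]; have rN0 : r != 0 by rewrite gt_eqF.
rewrite centered_thin_exp4//.
rewrite !expr0n/= !mulr0 !add0r.
have a2 : 0 <= a ^+ 2 by exact: sqr_ge0.
have u0 : 0 <= u%:R :> R by [].
apply: lerD.
  rewrite -mulrA ler_wpM2l// ler_wpM2l//.
    by rewrite (_ : a ^+ 4 = (a ^+ 2) ^+ 2) ?sqr_ge0//; ring.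
  rewrite ler_pdivlMr ?exprn_gt0//.
  (* Times [r ^+ 3], the fourth moment of one term is (1 - r) ((1 - r)^3 + r^3), whose last factor
     equals 1 - 3 r (1 - r) <= 1. *)
  rewrite (_ : _ * _ = (1 - r) * ((1 - r) ^+ 3 + r ^+ 3)); last by field.
  rewrite -[leRHS]mulr1 ler_wpM2l ?subr_ge0//.
  by rewrite (_ : _ + _ = 1 - 3 * (r * (1 - r))); [rewrite lerBlDr lerDl !mulr_ge0 ?subr_ge0// ltW | ring].
rewrite (_ : (u%:R * _ * _) ^+ 2 = u%:R * u%:R * (a ^+ 2 * ((1 - r) / r)) ^+ 2); last by ring.
rewrite [leRHS]mulrA ler_wpM2r ?sqr_ge0// mulrA ler_wpM2l ?mulr_ge0//.
by rewrite gerBl.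
Qed.

End thinning.

Section urn_expectation.
Context {R : realType} (q : R).
Implicit Types (h s : seq nat) (Phi Psi : seq nat -> R).

(* The mean of [Phi] at the history reached from [h] in [l] steps; a history
   lists the contents of urn 1 at times 0, 1, ... with the latest one last. *)
Fixpoint urn_exp (l : nat) h Phi : R :=
  if l is l'.+1 then thin q (fun v => urn_exp l' (rcons h v) Phi) (last 0%N h)
  else Phi h.

Lemma eq_urn_exp l h Phi Psi :
  (forall s, size s = l -> all (fun v => v <= last 0%N h)%N s ->
    Phi (h ++ s) = Psi (h ++ s)) -> urn_exp l h Phi = urn_exp l h Psi.
Proof.
elim: l h => [|l IH] h H /=; first by have := H [::] erefl erefl; rewrite cats0.
apply: eq_thin => v vu; apply: IH => s sl; rewrite last_rcons => sv.
rewrite cat_rcons; apply: H => /=; first by rewrite sl.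
by rewrite vu/=; apply: sub_all sv => w /leq_trans; exact.
Qed.

Hypothesis q01 : 0 <= q <= 1.

Lemma le_urn_exp l h Phi Psi :
  (forall s, size s = l -> all (fun v => v <= last 0%N h)%N s ->
    Phi (h ++ s) <= Psi (h ++ s)) -> urn_exp l h Phi <= urn_exp l h Psi.
Proof.
elim: l h => [|l IH] h H /=; first by have := H [::] erefl erefl; rewrite cats0.
apply: le_thin => // v vu; apply: IH => s sl; rewrite last_rcons => sv.
rewrite cat_rcons; apply: H => /=; first by rewrite sl.
by rewrite vu/=; apply: sub_all sv => w /leq_trans; exact.
Qed.

Lemma urn_exp_cst l h a : urn_exp l h (fun=> a) = a.
Proof.
elim: l h => [//|l IH] h /=; rewrite -[RHS](thin_cst q a (last 0%N h)).
by apply: eq_thin => v _; rewrite IH.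
Qed.

Lemma urn_exp_lin l h a b Phi Psi :
  urn_exp l h (fun k => a * Phi k + b * Psi k) =
  a * urn_exp l h Phi + b * urn_exp l h Psi.
Proof.
elim: l h => [//|l IH] h /=; rewrite -thin_lin.
by apply: eq_thin => v _; rewrite IH.
Qed.

Lemma urn_expB l h Phi Psi : urn_exp l h (fun k => Phi k - Psi k) =
  urn_exp l h Phi - urn_exp l h Psi.
Proof.
rewrite -[urn_exp l h Phi]mul1r -mulN1r -urn_exp_lin.
by apply: eq_urn_exp => s _ _; rewrite mul1r mulN1r.
Qed.

Lemma urn_expZ l h a Phi : urn_exp l h (fun k => a * Phi k) = a * urn_exp l h Phi.
Proof.
rewrite -[RHS]addr0 -(mul0r (urn_exp l h Phi)) -urn_exp_lin.
by apply: eq_urn_exp => s _ _; rewrite mul0r addr0.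
Qed.

Lemma urn_exp_sum l h m (Phi : nat -> seq nat -> R) :
  urn_exp l h (fun k => \sum_(i < m) Phi i k) = \sum_(i < m) urn_exp l h (Phi i).
Proof.
elim: m => [|m IH].
  rewrite big_ord0 -[RHS](urn_exp_cst l h 0).
  by apply: eq_urn_exp => s _ _; rewrite big_ord0.
rewrite big_ord_recr -IH /= -[X in _ = X + _]mul1r -[X in _ = _ + X]mul1r -urn_exp_lin.
by apply: eq_urn_exp => s _ _; rewrite big_ord_recr /= !mul1r.
Qed.

Lemma norm_urn_exp l h Phi : `|urn_exp l h Phi| <= urn_exp l h (fun k => `|Phi k|).
Proof.
rewrite ler_norml -mulN1r -urn_expZ.
apply/andP; split; apply: le_urn_exp => s _ _; last exact: ler_norm.
by rewrite mulN1r lerNl -normrN ler_norm.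
Qed.

Lemma urn_exp_add l1 l2 h Phi :
  urn_exp (l1 + l2) h Phi = urn_exp l1 h (fun h' => urn_exp l2 h' Phi).
Proof.
by elim: l1 h => [//|l IH] h /=; apply: eq_thin => v _; rewrite IH.
Qed.

(** By [thin_thin] the [l] steps collapse into one. The hypothesis concerns only reachable
    continuations, whose entries do not exceed the current content. *)
Lemma urn_exp_last l h Phi psi :
  (forall s, size s = l -> all (fun v => v <= last 0%N h)%N s ->
    Phi (h ++ s) = psi (last 0%N (h ++ s))) ->
  urn_exp l h Phi = thin (q ^+ l) psi (last 0%N h).
Proof.
elim: l h => [|l IH] h H /=.
  have := H [::] erefl erefl; rewrite cats0 => ->; rewrite expr0.
  suff: forall u (f : nat -> R), thin 1 f u = f u by move->.
  elim => [//|u IHu] f /=; rewrite !IHu /=; ring.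
rewrite exprS -thin_thin; apply: eq_thin => v vu; rewrite IH ?last_rcons// => s sl sv.
rewrite cat_rcons; apply: H => /=; first by rewrite sl.
by rewrite vu/=; apply: sub_all sv => w /leq_trans; exact.
Qed.

(* Doob's maximal inequality for the fourth moment: [a * (u_k / q ^ k - b)] is a
   martingale of the chain. *)
Lemma urn_exp_max (l i : nat) h (a e b : R) (Q : pred (seq nat)) :
  0 < q -> 0 <= e -> size h = i.+1 ->
  (forall s, size s = l -> Q (h ++ s) -> exists2 j, (j <= l)%N &
     e <= `|a * ((nth 0%N (h ++ s) (i + j))%:R / q ^+ (i + j) - b)|) ->
  urn_exp l h (fun k => (Q k)%:R) * e ^+ 4 <=
  thin (q ^+ l) (fun v => (a * (v%:R / q ^+ (i + l) - b)) ^+ 4) (last 0%N h).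
Proof.
move=> q0 e0; have [_ q1] := andP q01.
elim: l i h => [|l IH] i h sh H.
  rewrite expr0 addn0 /=.
  have thin1 w (f : nat -> R) : thin 1 f w = f w.
    by elim: w f => [//|w IHw] f /=; rewrite !IHw /=; ring.
  rewrite thin1; case: (boolP (Q h)) => [Qh|_]; last first.
    by rewrite mul0r -[X in _ <= X](ger0_norm) ?exprn_even_ge0// normr_ge0.
  rewrite mul1r; have [] := H [::] erefl; first by rewrite cats0.
  move=> j; rewrite leqn0 => /eqP ->; rewrite cats0 addn0 => eM.
  rewrite -[leRHS]ger0_norm ?exprn_even_ge0// normrX lerXn2r ?nnegrE//.
  by rewrite -nth_last sh.
(* If the bound is already exceeded now, Jensen's inequality carries the fourth power to the final
   time; otherwise one step is taken and the induction applies to the longer history. *)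
have [eM|Me] := leP e `|a * ((last 0%N h)%:R / q ^+ i - b)|.
  apply: (@le_trans _ _ (e ^+ 4)).
    rewrite -[leRHS]mul1r ler_wpM2r ?exprn_ge0//.
    rewrite -[leRHS](urn_exp_cst l.+1 h 1).
    by apply: le_urn_exp => s _ _; case: (Q _).
  apply: (@le_trans _ _ ((a * ((last 0%N h)%:R / q ^+ i - b)) ^+ 4)).
    by rewrite -[leRHS]ger0_norm ?exprn_even_ge0// normrX lerXn2r ?nnegrE.
  set w := last 0%N h.
  have ql0 : 0 < q ^+ l.+1 <= 1 by rewrite exprn_gt0// exprn_ile1// ltW.
  apply: le_trans (centered_thin_exp4_ge (a / q ^+ i) w _ ql0) _.
  rewrite /centered_thin le_eqVlt; apply/orP; left; apply/eqP.
  apply: eq_thin => v _; congr (_ ^+ 4); rewrite exprD; field.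
  by rewrite !expf_neq0 ?gt_eqF.
rewrite [q ^+ l.+1]exprS -thin_thin [urn_exp l.+1 _ _]/=.
rewrite mulrC -thinZ; apply: le_thin => // v _.
rewrite mulrC addnS -addSn -{2}(last_rcons 0%N h v); apply: IH; first by rewrite size_rcons sh.
move=> s sl; rewrite cat_rcons => Qs.
have [|[|j] jl eM] := H (v :: s) _ Qs; first by rewrite /= sl.
- move: eM; rewrite addn0 nth_cat sh ltnSn -[i]/(i.+1.-1) -sh nth_last /= sh /=.
  by rewrite leNgt Me.
- by exists j => //; rewrite addSn -addnS.
Qed.

End urn_expectation.

(** * Expectations of bounded random variables *)

Section bounded_random_variables.
Context d (T : measurableType d) (R : realType) (P : probability T R).
Implicit Types (f g : T -> R).

Definition bdd_measurable f :=
  measurable_fun [set: T] f /\ exists M : R, forall w, `|f w| <= M.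

Lemma integrable_bdd f : bdd_measurable f -> P.-integrable [set: T] (EFin \o f).
Proof.
move=> [mf [M fM]]; apply: measurable_bounded_integrable => //.
  exact: fin_num_fun_lty.
by exists M; split; [exact: num_real|move=> x Mx w _; exact: le_trans (fM w) (ltW Mx)].
Qed.

Lemma bdd_measurable_cst (a : R) : bdd_measurable (fun=> a).
Proof. by split => //; exists `|a|. Qed.

Lemma bdd_measurableD f g : bdd_measurable f -> bdd_measurable g ->
  bdd_measurable (fun w => f w + g w).
Proof.
move=> [mf [M fM]] [mg [N gN]]; split; first exact: measurable_funD.
by exists (M + N) => w; rewrite (le_trans (ler_normD _ _))// lerD.
Qed.

Lemma bdd_measurableM f g : bdd_measurable f -> bdd_measurable g ->
  bdd_measurable (fun w => f w * g w).
Proof.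
move=> [mf [M fM]] [mg [N gN]]; split; first exact: measurable_funM.
by exists (M * N) => w; rewrite normrM ler_pM.
Qed.

Lemma bdd_measurableZ (a : R) f : bdd_measurable f ->
  bdd_measurable (fun w => a * f w).
Proof. exact/bdd_measurableM/bdd_measurable_cst. Qed.

Lemma bdd_measurableB f g : bdd_measurable f -> bdd_measurable g ->
  bdd_measurable (fun w => f w - g w).
Proof.
move=> bf /(bdd_measurableZ (-1)) /(bdd_measurableD bf) [m b]; split.
  by apply: eq_measurable_fun m => w _; rewrite mulN1r.
by case: b => M b; exists M => w; rewrite -mulN1r.
Qed.

Lemma bdd_measurable_norm f : bdd_measurable f ->
  bdd_measurable (fun w => `|f w|).
Proof.
move=> [mf [M fM]]; split; first exact: measurableT_comp.
by exists M => w; rewrite normr_id.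
Qed.

Lemma bdd_measurable_sum (n : nat) (F : nat -> T -> R) :
  (forall i, (i < n)%N -> bdd_measurable (F i)) ->
  bdd_measurable (fun w => \sum_(i < n) F i w).
Proof.
elim: n => [|n IH] H.
  by under eq_fun do rewrite big_ord0; exact: bdd_measurable_cst.
under eq_fun do rewrite big_ord_recr /=.
by apply: bdd_measurableD; [apply: IH => i /leqW; exact: H|exact: H].
Qed.

Lemma Rintegral_cstT (a : R) : \int[P]_w a = a.
Proof. by rewrite Rintegral_cst//; have := @probability_setT _ _ _ P => /= ->; rewrite mulr1. Qed.

Lemma Rintegral_sum (n : nat) (F : nat -> T -> R) :
  (forall i, (i < n)%N -> bdd_measurable (F i)) ->
  \int[P]_w (\sum_(i < n) F i w) = \sum_(i < n) \int[P]_w F i w.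
Proof.
elim: n => [|n IH] H.
  by under eq_Rintegral do rewrite big_ord0; rewrite big_ord0 Rintegral_cstT.
under eq_Rintegral do rewrite big_ord_recr /=.
rewrite big_ord_recr /= RintegralD// ?IH//.
- by move=> i /leqW; exact: H.
- by apply: integrable_bdd; apply: bdd_measurable_sum => i /leqW; exact: H.
- exact/integrable_bdd/H.
Qed.

Lemma le_Rintegral_bdd f g : bdd_measurable f -> bdd_measurable g ->
  (forall w, f w <= g w) -> \int[P]_w f w <= \int[P]_w g w.
Proof. by move=> /integrable_bdd bf /integrable_bdd bg fg; apply: le_Rintegral. Qed.

Lemma RintegralB_bdd f g : bdd_measurable f -> bdd_measurable g ->
  \int[P]_w (f w - g w) = \int[P]_w f w - \int[P]_w g w.
Proof. by move=> /integrable_bdd bf /integrable_bdd bg; exact: RintegralB. Qed.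

Lemma norm_Rintegral_le f (a : R) : bdd_measurable f ->
  (forall w, `|f w| <= a) -> `|\int[P]_w f w| <= a.
Proof.
move=> bf fa; apply: le_trans (le_normr_Rintegral _ (integrable_bdd bf)) _ => //.
rewrite -[leRHS]Rintegral_cstT; apply: le_Rintegral_bdd => //.
  exact: bdd_measurable_norm.
exact: bdd_measurable_cst.
Qed.

Lemma Rintegral_distr_le f g (a : R) : bdd_measurable f -> bdd_measurable g ->
  (forall w, `|f w - g w| <= a) -> `|\int[P]_w f w - \int[P]_w g w| <= a.
Proof.
move=> bf bg fa; rewrite -RintegralB_bdd//; apply: norm_Rintegral_le => //.
exact: bdd_measurableB.
Qed.

Lemma expectation_bdd f : bdd_measurable f -> ('E_P[f] = (\int[P]_w f w)%:E)%E.
Proof.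
move=> bf; rewrite unlock /Rintegral fineK//.
exact/integrable_fin_num/integrable_bdd.
Qed.

Lemma bounded_cvg (F : nat -> T -> R) f (M : R) :
  (forall n, measurable_fun [set: T] (F n)) ->
  (forall n w, `|F n w| <= M) -> (forall w, F ^~ w @ \oo --> f w) ->
  bdd_measurable f /\ \int[P]_w F n w @[n --> \oo] --> \int[P]_w f w.
Proof.
move=> mF FM Ff.
have mf : measurable_fun [set: T] f by apply: measurable_fun_cvg mF _ => w _; exact: Ff.
have bf : bdd_measurable f.
  split=> //; exists M => w.
  have cn : `|F n w| @[n --> \oo] --> `|f w| by apply: cvg_norm; exact: Ff.
  rewrite -(cvg_lim (@Rhausdorff R) cn); apply: limr_le; first by apply/cvg_ex; exists `|f w|.
  by apply: nearW => n.
have bF n : bdd_measurable (F n) by split => //; exists M => w; exact: FM.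
split => //.

have H1 : {ae P, forall x, [set: T] x -> (fun n => (F n x)%:E) @ \oo --> (f x)%:E}.
  apply: aeW => w _; apply: cvg_EFin; first exact: nearW.
  exact: Ff.
have H2 : {ae P, forall x n, [set: T] x -> (`|(F n x)%:E| <= M%:E)%E}.
  by apply: aeW => w n _; rewrite lee_fin.
have [] := @dominated_convergence _ _ _ P _ measurableT
  (fun n => EFin \o F n) (EFin \o f) (fun=> M%:E) _ _ H1 _ H2.
- by move=> n; exact/measurable_EFinP.
- exact/measurable_EFinP.
- exact: (integrable_bdd (bdd_measurable_cst M)).
move=> _ _ H; apply: fine_cvg; rewrite /Rintegral fineK//.
exact/integrable_fin_num/integrable_bdd.
Qed.
End bounded_random_variables.

(** * Finite chains of integer-valued random variables *)

Section finite_chains.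
Context d (T : measurableType d) (R : realType) (P : probability T R).
Implicit Types (V : nat -> T -> nat) (h : seq nat).

(** An arbitrary [Q] is allowed because histories form a countable set; the induction splits the
    event according to the last entry. *)
Lemma measurable_mkseq V k (Q : set (seq nat)) :
  (forall i, measurable_fun [set: T] (V i)) ->
  measurable [set w | Q (mkseq (V^~ w) k)].
Proof.
move=> mV; elim: k Q => [|k IH] Q.
  have [Q0|Q0] := pselect (Q [::]).
    by rewrite [X in measurable X](_ : _ = [set: T]) //; apply/seteqP; split.
  by rewrite [X in measurable X](_ : _ = set0) //; apply/seteqP; split.
rewrite [X in measurable X](_ : _ = \bigcup_v
    ((V k @^-1` [set v]) `&` [set w | Q (rcons (mkseq (V^~ w) k) v)])); last first.
  apply/seteqP; split=> [w|w [v _ [<-]]] /=; rewrite mkseqS//.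
  by move=> Qw; exists (V k w).
apply: bigcupT_measurable => v; apply: measurableI; last exact: (IH (fun s => Q (rcons s v))).
by rewrite -[X in measurable X]setTI; exact: mV.
Qed.

Lemma measurable_fun_mkseq d' (S : measurableType d') V k (Phi : seq nat -> S) :
  (forall i, measurable_fun [set: T] (V i)) ->
  measurable_fun [set: T] (fun w => Phi (mkseq (V^~ w) k)).
Proof. by move=> mV _ A _; rewrite setTI; exact: (@measurable_mkseq V k (Phi @^-1` A)). Qed.

Lemma RintegralE (A : set T) : measurable A -> \int[P]_w \1_A w = fine (P A).
Proof. by move=> mA; rewrite /Rintegral integral_indic// setIT. Qed.

(** [K h v] stands for the conditional probability of the value [v] after the history [h]. The
    dependence on the whole history lets one definition serve both the urn and the roundings of
    independent variables. *)
Fixpoint chain_exp (N : nat) (K : seq nat -> nat -> R) (l : nat) h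
    (Phi : seq nat -> R) : R :=
  if l is l'.+1 then \sum_(v < N) K h v * chain_exp N K l' (rcons h v) Phi
  else Phi h.

(** The cylinder [E h] is split into the cylinders [E (rcons h v)], by induction on the number of
    remaining steps. Stating the kernel as a product rule covers histories of probability 0 as
    well. *)
Lemma Rintegral_chain (N m : nat) (K : seq nat -> nat -> R) V Phi (M : R) :
  (forall i, measurable_fun [set: T] (V i)) ->
  (forall i w, (i < m)%N -> (V i w < N)%N) ->
  (forall h v, (size h < m)%N -> (v < N)%N ->
    P [set w | mkseq (V^~ w) (size h) = h /\ V (size h) w = v] =
    (P [set w | mkseq (V^~ w) (size h) = h] * (K h v)%:E)%E) ->
  (forall h, `|Phi h| <= M) ->
  \int[P]_w Phi (mkseq (V^~ w) m) = chain_exp N K m [::] Phi.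
Proof.
move=> mV VN KP PhiM.
pose E h := [set w | mkseq (V^~ w) (size h) = h].
have mE h : measurable (E h).
  exact: (@measurable_mkseq V (size h) (fun s => s = h)).
have bE h : bdd_measurable (fun w => \1_(E h) w * Phi (mkseq (V^~ w) m)).
  apply: bdd_measurableM; split.
  - exact: measurable_indic.
  - by exists 1 => w; rewrite indicE; case: (_ \in _); rewrite ?normr1 ?normr0.
  - exact: measurable_fun_mkseq.
  - by exists M => w.
suff H l h : (size h + l)%N = m ->
    \int[P]_w (\1_(E h) w * Phi (mkseq (V^~ w) m)) =
    fine (P (E h)) * chain_exp N K l h Phi.
  have := H m [::] erefl; rewrite (_ : E [::] = setT).
    rewrite probability_setT mul1r => <-; apply: eq_Rintegral => w _.
    by rewrite indicT mul1r.
  by apply/seteqP; split.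
elim: l h => [|l IH] h hl.
  rewrite addn0 in hl; rewrite -RintegralE// -RintegralZr//=; last first.
    apply/integrable_bdd; split; first exact: measurable_indic.
    by exists 1 => w; rewrite indicE; case: (_ \in _); rewrite ?normr1 ?normr0.
  apply: eq_Rintegral => w _; rewrite indicE.
  case: (boolP (w \in E h)) => [|_]; last by rewrite !mul0r.
  by rewrite inE /E /= -hl => ->.
transitivity (\int[P]_w (\sum_(v < N) \1_(E (rcons h v)) w * Phi (mkseq (V^~ w) m))).
  have hm : (size h < m)%N by rewrite -hl -addSnnS leq_addr.
  apply: eq_Rintegral => w _; rewrite -mulr_suml; congr (_ * _).
  rewrite (bigD1 (Ordinal (VN _ w hm)))//= big1 ?addr0 => [|v vV].
    rewrite !indicE; congr (nat_of_bool _)%:R; apply/idP/idP; rewrite !inE /E /= size_rcons mkseqS.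
      by move=> ->.
    by move=> /eqP; rewrite eqseq_rcons => /andP[/eqP].
  rewrite indicE; case: (boolP (w \in _)) => //; rewrite inE /E /= size_rcons mkseqS.
  move=> /eqP; rewrite eqseq_rcons => /andP[_ /eqP Vv].
  by move: vV; rewrite -val_eqE /= Vv eqxx.
rewrite (@Rintegral_sum _ _ _ _ _ (fun v w => \1_(E (rcons h v)) w * Phi (mkseq (V^~ w) m)))//=.
rewrite mulr_sumr; apply: eq_bigr => v _.
rewrite IH; last by rewrite size_rcons addSnnS.
rewrite mulrA; congr (_ * _).
have := KP h v; rewrite -hl -addSnnS leq_addr ltn_ord => /(_ erefl erefl).
rewrite (_ : [set w | _ /\ _] = E (rcons h v)); last first.
  apply/seteqP; split => w /=; rewrite /E /= size_rcons mkseqS.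
    by move=> [-> ->].
  by move=> /eqP; rewrite eqseq_rcons => /andP[/eqP-> /eqP->].
by move=> ->; rewrite fineM//; apply: fin_num_measure; exact: mE.
Qed.

End finite_chains.

(** * The law of the urn process as a recursion *)

Section urn_law.
Context d (T : measurableType d) (R : realType) (P : probability T R).
Context (n : nat) (p : R) (U b : nat -> {mfun T >-> nat}).
Hypotheses (p01 : 0 <= p <= 1) (hU : urn_process P n p U b).

(** Time 0 is treated as a transition from the empty history to [n], so that the whole process fits
    [chain_exp]. *)
Let kernel (h : seq nat) (v : nat) : R :=
  if h is [::] then (v == n)%:R else
  if (v <= last 0 h)%N then binomial_pmf (last 0%N h) p (last 0 h - v) else 0.

Let kernelE h v : h != [::] -> kernel h v =
  if (v <= last 0 h)%N then binomial_pmf (last 0%N h) p (last 0 h - v) else 0.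
Proof. by case: h. Qed.

(** For [v = 0] the truncated subtraction also admits every [k > u]; these values carry no mass. *)
Let binomial_prob_sub u v :
  binomial_prob u p [set k | (u - k)%N = v] =
  (if (v <= u)%N then binomial_pmf u p (u - v) else 0)%:E.
Proof.
have /andP[p0 p1] := p01.
rewrite (binomial_probE _ p1); case: leqP => vu.
  have lt : (u - v < u.+1)%N by rewrite ltnS leq_subr.
  rewrite (bigD1 (Ordinal lt))//= big1 ?adde0 => [|k kv].
    by rewrite diracE mem_set ?mule1//=; rewrite subKn.
  rewrite diracE memNset ?mule0//= => ukv.
  by move: kv; rewrite -val_eqE /= -ukv subKn ?eqxx// -ltnS.
rewrite big1// => k _; rewrite diracE memNset ?mule0//= => ukv.
by move: vu; rewrite -ukv ltnNge leq_subr.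
Qed.

Let U_le i w : (U i w <= n)%N.
Proof.
have [U0 US _] := hU; elim: i => [|i IH]; first by rewrite U0.
by rewrite US (leq_trans _ IH)// leq_subr.
Qed.

Let kernelP (h : seq nat) (v : nat) :
  P [set w | mkseq (fun i => U i w) (size h) = h /\ U (size h) w = v] =
  (P [set w | mkseq (fun i => U i w) (size h) = h] * (kernel h v)%:E)%E.
Proof.
have [U0 US Ub] := hU.
case: h => [|u0 s].
  rewrite (_ : [set w | _ /\ _] = [set _ | v = n]); last first.
    by apply/seteqP; split => [w [_ /=]|w /= ->]; rewrite U0.
  rewrite (_ : [set w | mkseq _ _ = _] = setT); last by apply/seteqP; split.
  rewrite probability_setT mul1e /kernel; case: eqVneq => [->|vn].
    by rewrite (_ : [set _ | _] = setT) ?probability_setT//; apply/seteqP; split.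
  rewrite (_ : [set _ | _] = set0) ?measure0//; apply/seteqP; split => // w /= /eqP.
  by rewrite (negbTE vn).
set h := u0 :: s; set k := size s.
have := Ub k (nth 0%N h) [set j | (last 0%N h - j)%N = v].
rewrite [nth _ _ _](_ : nth 0%N h k = last 0%N h); last by rewrite -[k]/((size h).-1) nth_last.
rewrite binomial_prob_sub => HE.
have hE w : (forall i, (i <= k)%N -> U i w = nth 0%N h i) <->
    mkseq (fun i => U i w) (size h) = h.
  split=> [H|<- i ik]; last by rewrite nth_mkseq.
  apply: (@eq_from_nth _ 0%N); rewrite size_mkseq// => i ik.
  by rewrite nth_mkseq// H.
rewrite /kernel [size h]/= -/k.
rewrite [X in P X = _](_ : _ = [set w | forall i, (i <= k)%N -> U i w = nth 0%N h i] `&`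
   b k.+1 @^-1` [set j | (last 0%N h - j)%N = v]); last first.
  apply/seteqP; split => w /= []; rewrite -hE US => H; rewrite H// (_ : nth 0%N h k = last 0%N h)//;
  by rewrite -[k]/((size h).-1) nth_last.
rewrite HE; congr (P _ * _)%E.
by apply/seteqP; split => w /=; rewrite hE.
Qed.

(** The bridge from the probability space to [urn_exp], on which all estimates for the urn are
    made. *)
Lemma Rintegral_urn (k : nat) (Phi : seq nat -> R) (M : R) :
  (forall h, `|Phi h| <= M) ->
  \int[P]_w Phi (mkseq (fun i => U i w) k.+1) = urn_exp (1 - p) k [:: n] Phi.
Proof.
move=> PhiM; have VN i w : (i < k.+1)%N -> (U i w < n.+1)%N by move=> _; rewrite ltnS.
rewrite (Rintegral_chain _ VN (fun h v _ _ => kernelP h v) PhiM)//.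
rewrite [LHS]/=.
rewrite (bigD1 ord_max)//= eqxx mul1r big1 ?addr0 => [|v /negbTE]; last first.
  by rewrite -val_eqE /= => ->; rewrite mul0r.
have : (last 0 [:: n] <= n)%N by [].
have : [:: n] != [::] by [].
elim: k {VN} [:: n] => [//|k IH] h hn hl; rewrite [LHS]/= [RHS]/=.
set u := last 0%N h in hl *.
transitivity (\sum_(v < u.+1) binomial_pmf u p (u - v) * urn_exp (1 - p) k (rcons h v) Phi).
  rewrite (big_ord_widen_cond n.+1 xpredT
    (fun v => binomial_pmf u p (u - v) * urn_exp (1 - p) k (rcons h v) Phi))//.
  rewrite [RHS]big_mkcond; apply: eq_bigr => v _ /=.
  rewrite kernelE// ltnS -/u; case: leqP => vu; last by rewrite mul0r.
  by rewrite IH ?last_rcons ?(leq_trans vu)//; case: (h).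
(* [thin_binomial] sums over the removed balls, the kernel over the remaining ones. *)
rewrite thin_binomial (reindex_inj rev_ord_inj)/=; apply: eq_bigr => v _ /=.
by rewrite subSS subKr subKn// -ltnS.
Qed.

End urn_law.

(** * Functions of independent variables *)

Section rounding.
Context {R : realType}.
Implicit Types (x : R) (k : nat).

(** Rounding down to the grid of mesh 1/(k+1) in [-k, k]. It is clipped at both ends, below because
    [Num.truncn] is 0 on negative numbers, so that the codes range over a finite set. *)
Definition grid_code k x : nat :=
  minn (Num.truncn ((x + k%:R) * k.+1%:R)) (k.+1 * (2 * k)).
Definition grid_point k (v : nat) : R := v%:R / k.+1%:R - k%:R.

Lemma measurable_grid_code k : measurable_fun [set: R] (grid_code k).
Proof.
have m : measurable_fun [set: R] (fun x : R => (grid_code k x)%:R : R).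
  apply: nondecreasing_measurable => // x y xy.
  rewrite ler_nat leq_min geq_minr andbT (leq_trans (geq_minl _ _))// le_truncn//.
  by rewrite ler_wpM2r// lerD2r.
move=> _ A _; rewrite setTI.
rewrite [X in measurable X](_ : _ = \bigcup_(v in A)
    ((fun x : R => (grid_code k x)%:R : R) @^-1` [set v%:R])); last first.
  apply/seteqP; split=> [x Ax|x [v Av /= /eqP]]; first by exists (grid_code k x).
  by rewrite eqr_nat => /eqP ->.
apply: bigcup_measurable => v _.
by rewrite -[X in measurable X]setTI; exact: m.
Qed.

Lemma grid_code_lt k x : (grid_code k x < (k.+1 * (2 * k)).+1)%N.
Proof. by rewrite ltnS geq_minr. Qed.

Lemma grid_pointK k x : `|x| <= k%:R ->
  `|grid_point k (grid_code k x) - x| <= k.+1%:R^-1.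
Proof.
rewrite ler_norml => /andP[kx xk].
have k0 : 0 < k.+1%:R :> R by [].
have y0 : 0 <= (x + k%:R) * k.+1%:R by rewrite mulr_ge0// -lerBlDr sub0r.
have /andP[tl tu] := truncn_itv y0.
have tN : (Num.truncn ((x + k%:R) * k.+1%:R) <= k.+1 * (2 * k))%N.
  rewrite -(ler_nat R) (le_trans tl)// mulnC natrM ler_wpM2r//.
  by rewrite mul2n -addnn natrD lerD2r.
rewrite /grid_point /grid_code (minn_idPl tN).
move: tl tu; rewrite -[ltRHS]natr1; set t := (Num.truncn _)%:R => tl tu.
have -> : t / k.+1%:R - k%:R - x = (t - (x + k%:R) * k.+1%:R) / k.+1%:R.
  by field; rewrite gt_eqF.
rewrite normrM normfV [`|k.+1%:R|]ger0_norm// ler_piMl ?invr_ge0//.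
by rewrite ler_norml; apply/andP; split; lra.
Qed.

Lemma grid_point_cvg x : grid_point k (grid_code k x) @[k --> \oo] --> x.
Proof.
apply/cvgrPdist_le => e e0; near=> k.
rewrite distrC (le_trans (grid_pointK _))//.
  near: k; exists (Num.truncn `|x|).+1 => // k /= xk.
  by rewrite (le_trans (ltW (truncnS_gt _)))// ler_nat.
rewrite -[e]invrK lef_pV2 ?posrE ?invr_gt0//.
near: k; exists (Num.truncn e^-1) => // k /= ek.
by rewrite (le_trans (ltW (truncnS_gt _)))// ler_nat.
Unshelve. all: by end_near. Qed.

End rounding.

Section lipschitz_seq.
Context {R : realType}.
Implicit Types (f : seq R -> R) (L : R) (s t : seq R).

(** With the l1 distance, passing from increments to partial sums is 1-Lipschitz for the uniform
    distance, whatever the number of entries. *)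
Definition lipschitz_seq L f := forall s t, size s = size t ->
  `|f s - f t| <= L * \sum_(i < size s) `|s`_i - t`_i|.

Lemma lipschitz_seq_cvg L f m (x : nat -> nat -> R) (y : nat -> R) :
  lipschitz_seq L f -> (forall i, x ^~ i @ \oo --> y i) ->
  f (mkseq (x k) m) @[k --> \oo] --> f (mkseq y m).
Proof.
move=> fL xy.
have c : L * (\sum_(i < m) `|x k i - y i|) @[k --> \oo] --> L * (\sum_(i < m) (0 : R)).
  apply: cvgM; first exact: cvg_cst.
  apply: cvg_big => [|i _]; first exact: add_continuous.
  by apply/norm_cvg0P; rewrite -(subrr (y i)); apply: cvgB => //; exact: cvg_cst.
rewrite big1// mulr0 in c.
apply/cvgrPdist_le => e e0; move/cvgrPdist_le : c => /(_ e e0); apply: filterS => k.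
rewrite sub0r normrN => ce; rewrite distrC (le_trans (fL _ _ _))// ?size_mkseq//.
under eq_bigr do rewrite !nth_mkseq//.
exact: le_trans (ler_norm _) ce.
Qed.

Lemma lipschitz_seq_cat L f s : lipschitz_seq L f -> lipschitz_seq L (fun t => f (s ++ t)).
Proof.
move=> fL t u tu; rewrite (le_trans (fL _ _ _))// ?size_cat ?tu//.
rewrite -tu big_split_ord/= big1 ?add0r => [|i _].
  rewrite le_eqVlt; apply/orP; left; apply/eqP; congr (_ * _); apply: eq_bigr => i _.
  by rewrite !nth_cat ltnNge leq_addr/= addKn.
by rewrite !nth_cat ltn_ord subrr normr0.
Qed.

Lemma lipschitz_seq_sum L (g : R -> R) : 0 <= L ->
  (forall x y, `|g x - g y| <= L * `|x - y|) ->
  lipschitz_seq L (fun s => g (\sum_(i < size s) s`_i)).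
Proof.
move=> L0 gL s t st; rewrite (le_trans (gL _ _))// ler_wpM2l// -st -sumrB.
exact: ler_norm_sum.
Qed.

End lipschitz_seq.

Section independent_sequences.
Context d (T : measurableType d) (R : realType) (P : probability T R).
Context (X : nat -> T -> R) (mX : forall i, measurable_fun [set: T] (X i)).
Implicit Types (f : seq R -> R) (L M : R).

Let V k i w := grid_code k (X i w).

Let mV k i : measurable_fun [set: T] (V k i).
Proof. exact: measurableT_comp (measurable_grid_code k) (mX i). Qed.

Let mapV k m w : map (grid_point k) (mkseq (fun i => V k i w) m) =
  mkseq (fun i => grid_point k (grid_code k (X i w))) m :> seq R.
Proof. by rewrite /mkseq -map_comp. Qed.

Lemma bdd_measurable_lipschitz_seq L M f m : lipschitz_seq L f ->
  (forall s, `|f s| <= M) -> bdd_measurable (fun w => f (mkseq (X^~ w) m)).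
Proof.
move=> fL fM.
have [] := @bounded_cvg _ _ _ P
  (fun k w => f (map (grid_point k) (mkseq (fun i => V k i w) m)))
  (fun w => f (mkseq (X^~ w) m)) M _ _ _.
- move=> k; exact: (@measurable_fun_mkseq _ _ _ R (V k) m (fun s => f (map (grid_point k) s)) (mV k)).
- by move=> k w; exact: fM.
- move=> w; under eq_fun do rewrite mapV.
  apply: (@lipschitz_seq_cvg _ L f m (fun k i => grid_point k (grid_code k (X i w))) (X^~ w) fL) => i.
  exact: grid_point_cvg.
- by [].
Qed.

Definition grid_prob k i v : R := fine (P (V k i @^-1` [set v])).

Lemma mutually_independent_grid k m : mutually_independent P m X ->
  forall h v, (size h < m)%N ->
    P [set w | mkseq (fun i => grid_code k (X i w)) (size h) = h /\
               grid_code k (X (size h) w) = v] =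
    (P [set w | mkseq (fun i => grid_code k (X i w)) (size h) = h] * (grid_prob k (size h) v)%:E)%E.
Proof.
move=> hI h v hm.
(* The first coordinates follow [h], the next one lies in [B], the others are free. Comparing a
   general [B] with [B = setT] yields the product rule without evaluating the common factors. *)
pose A B i := if (i < size h)%N then grid_code k @^-1` [set nth 0%N h i] : set R
  else if i == size h then B else setT.
have mgc (C : set nat) : measurable (grid_code k @^-1` C : set R).
  by rewrite -[X in measurable X]setTI; exact: measurable_grid_code.
have mA B i : measurable B -> measurable (A B i).
  by move=> mB; rewrite /A; do 2 case: ifP => // _.
have HA B : measurable B -> P (\bigcap_(i < m) (X i @^-1` A B i)) =
    (P (X (size h) @^-1` B) * \prod_(i < m | i != Ordinal hm) P (X i @^-1` A setT i))%E.
  move=> mB; rewrite hI; last by move=> i; exact: mA.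
  rewrite (bigD1 (Ordinal hm))//= /A ltnn eqxx; congr (_ * _)%E.
  by apply: eq_bigr => i ih; rewrite -val_eqE /= in ih; rewrite (negbTE ih).
have capA B : \bigcap_(i < m) (X i @^-1` A B i) =
    [set w | mkseq (fun i => V k i w) (size h) = h] `&` (X (size h) @^-1` B).
  apply/seteqP; split => [w H|w [/= H Bw] i /= im].
    split; last by have := H (size h) hm; rewrite /= /A ltnn eqxx.
    apply: (@eq_from_nth _ 0%N); rewrite size_mkseq// => i ih; rewrite nth_mkseq//.
    by have := H i (ltn_trans ih hm); rewrite /= /A ih.
  rewrite /A; case: ltnP => [ih|_].
    by move: (congr1 (fun s => nth 0%N s i) H); rewrite /= nth_mkseq.
  by case: eqP => [->|].
have := HA setT measurableT.
rewrite capA preimage_setT setIT probability_setT mul1e => HT.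
have := HA _ (mgc [set v]); rewrite capA -HT => HB.
apply: (etrans HB); rewrite muleC /grid_prob fineK//; apply: fin_num_measure.
by rewrite -[X in measurable X]setTI; exact: mV.
Qed.

End independent_sequences.

Lemma mutually_independent_behead d (T : measurableType d) (R : realType)
    (P : probability T R) m (X : nat -> T -> R) :
  mutually_independent P m.+1 X -> mutually_independent P m (fun i => X i.+1).
Proof.
move=> hX A mA.
pose A' i := if i is j.+1 then A j else setT.
have mA' i : measurable (A' i) by case: i => [|i]; [exact: measurableT|exact: mA].
have := hX _ mA'; rewrite big_ord_recl /= preimage_setT probability_setT mul1e => <-.
congr (P _); apply/seteqP; split => w H i /= im; last exact: (H i.+1).
by case: i im => [//|i im]; exact: H.
Qed.

Lemma chain_exp_cons (R : realType) N (K : seq nat -> nat -> R) l v h Phi :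
  chain_exp N K l (v :: h) Phi =
  chain_exp N (fun s => K (v :: s)) l h (fun s => Phi (v :: s)).
Proof. by elim: l h => [//|l IH] h /=; apply: eq_bigr => i _; rewrite -IH. Qed.

Section independent_step.
Context d (T : measurableType d) (R : realType) (P : probability T R).
Implicit Types (f : seq R -> R) (L M : R) (X : nat -> T -> R).

Let N k := (k.+1 * (2 * k)).+1.

Let Rintegral_grid k m X (Phi : seq nat -> R) M :
  (forall i, measurable_fun [set: T] (X i)) ->
  mutually_independent P m X -> (forall s, `|Phi s| <= M) ->
  \int[P]_w Phi (mkseq (fun i => grid_code k (X i w)) m) =
  chain_exp (N k) (fun h v => grid_prob P X k (size h) v) m [::] Phi.
Proof.
move=> mX hX PM; apply: (Rintegral_chain _ _ _ PM).
- by move=> i; exact: measurableT_comp (measurable_grid_code k) (mX i).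
- by move=> i w _; exact: grid_code_lt.
- by move=> h v hm _; exact: mutually_independent_grid hX _ _ hm.
Qed.

(* Independence is only a product rule on events: the identity is an exchange of
   finite sums for the roundings of the variables to a grid, and the mesh is
   then sent to 0. *)
Lemma Rintegral_indep_cons m X f L M :
  (forall i, measurable_fun [set: T] (X i)) ->
  mutually_independent P m.+1 X ->
  lipschitz_seq L f -> (forall s, `|f s| <= M) ->
  \int[P]_w f (mkseq (X^~ w) m.+1) =
  \int[P]_w \int[P]_w' f (X 0%N w :: mkseq (fun i => X i.+1 w') m).
Proof.
move=> mX hX fL fM.
pose V k i w := grid_code k (X i w).
have mV k i : measurable_fun [set: T] (V k i).
  exact: measurableT_comp (measurable_grid_code k) (mX i).
have mapV k l (Y : nat -> T -> R) w : map (grid_point k) (mkseq (fun i => grid_code k (Y i w)) l) =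
    mkseq (fun i => grid_point k (grid_code k (Y i w))) l :> seq R.
  by move=> *; rewrite /mkseq -map_comp.
pose Phi k (s : seq nat) := f (map (grid_point k) s).
pose Psi k v := \int[P]_w Phi k (v :: mkseq (fun i => V k i.+1 w) m).
have PM k s : `|Phi k s| <= M by exact: fM.
have PsiM k v : `|Psi k v| <= M.
  apply: norm_Rintegral_le => //; split; last by exists M.
  exact: (@measurable_fun_mkseq _ _ _ R (fun i => V k i.+1) m (fun s => Phi k (v :: s))).
(* The left side is a chain of [m.+1] steps. The right side is a chain of one step followed by the
   mean [Psi], itself a chain of [m] steps; the kernels depend only on the length of the history. *)
have E k : \int[P]_w Phi k (mkseq (fun i => V k i w) m.+1) = \int[P]_w Psi k (V k 0%N w).
  rewrite (Rintegral_grid k mX hX (PM k)) /=.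
  have h1 h v : (size h < 1)%N -> (v < N k)%N ->
      P [set w | mkseq (fun i => V k i w) (size h) = h /\ V k (size h) w = v] =
      (P [set w | mkseq (fun i => V k i w) (size h) = h] *
       (grid_prob P X k (size h) v)%:E)%E.
    move=> h1 _; have hm : (size h < m.+1)%N by exact: leq_trans h1 _.
    exact: (@mutually_independent_grid _ _ _ P X mX k m.+1 hX h v hm).
  have lt i w : (i < 1)%N -> (V k i w < N k)%N by move=> _; exact: grid_code_lt.
  rewrite (Rintegral_chain (Phi := fun s => Psi k (head 0%N s)) (mV k) lt h1 (M := M))//=.
  apply: eq_bigr => v _; congr (_ * _); rewrite chain_exp_cons.
  by rewrite /Psi (Rintegral_grid k (fun i => mX i.+1)
    (mutually_independent_behead hX) (fun s => PM k ((v : nat) :: s))).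
have [_ c1] : bdd_measurable (fun w => f (mkseq (X^~ w) m.+1)) /\
    \int[P]_w Phi k (mkseq (fun i => V k i w) m.+1) @[k --> \oo] -->
    \int[P]_w f (mkseq (X^~ w) m.+1).
  apply: (@bounded_cvg _ _ _ P _ _ M).
  - by move=> k; exact: (@measurable_fun_mkseq _ _ _ R (V k) m.+1 (Phi k)).
  - by move=> k w; exact: fM.
  - move=> w; rewrite /Phi; under eq_fun do rewrite mapV.
    apply: (@lipschitz_seq_cvg _ L f m.+1 (fun k i => grid_point k (grid_code k (X i w))) (X^~ w) fL) => i.
    exact: grid_point_cvg.
have [_ c2] : bdd_measurable (fun w => \int[P]_w' f (X 0%N w :: mkseq (fun i => X i.+1 w') m)) /\
    \int[P]_w Psi k (V k 0%N w) @[k --> \oo] -->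
    \int[P]_w \int[P]_w' f (X 0%N w :: mkseq (fun i => X i.+1 w') m).
  apply: (@bounded_cvg _ _ _ P _ _ M).
  - move=> k; apply: (measurableT_comp (f := Psi k : nat -> R)) => //.
  - by move=> k w; exact: PsiM.
  - move=> w.
    have [] := @bounded_cvg _ _ _ P
      (fun k w' => Phi k (V k 0%N w :: mkseq (fun i => V k i.+1 w') m))
      (fun w' => f (X 0%N w :: mkseq (fun i => X i.+1 w') m)) M _ _ _.
    + move=> k.
      exact: (@measurable_fun_mkseq _ _ _ R (fun i => V k i.+1) m (fun s => Phi k (V k 0%N w :: s))).
    + by move=> k w'; exact: fM.
    + move=> w'; rewrite /Phi /V /=; under eq_fun do rewrite (mapV _ m (fun i => X i.+1)).
      pose z (k i : nat) : R := if i is j.+1 then grid_point k (grid_code k (X j.+1 w')) else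
        grid_point k (grid_code k (X 0%N w)).
      pose y i := if i is j.+1 then X j.+1 w' else X 0%N w.
      have := @lipschitz_seq_cvg _ L f m.+1 z y fL.
      have consE (g : nat -> R) : mkseq g m.+1 = g 0%N :: mkseq (g \o S) m.
        by rewrite /mkseq /= (iotaDl 1 0) -map_comp.
      under eq_fun do rewrite consE; rewrite consE; apply => -[|i].
        exact: (@grid_point_cvg _ (X 0%N w)).
      exact: (@grid_point_cvg _ (X i.+1 w')).
    + by [].
rewrite (funext E) in c1.
exact: (cvg_unique (@Rhausdorff R) c1 c2).
Qed.

End independent_step.

(** * Moments of the normal law *)

Section normal_moments.
Context {R : realType}.
Local Notation mu := (@lebesgue_measure R).

Lemma ge0_integral_normal_prob (m s : R) (f : R -> \bar R) :
  measurable_fun [set: R] f -> (forall x, 0 <= f x)%E ->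
  (\int[normal_prob m s]_x f x = \int[mu]_x (f x * (normal_pdf m s x)%:E))%E.
Proof.
move=> mf f0.
have dom := normal_prob_dominates m s.
rewrite -(Radon_Nikodym_SigmaFinite.change_of_variables dom f0 measurableT mf).
have mg := Radon_Nikodym_SigmaFinite.f_integrable dom.
apply: ae_eq_integral => //.
- by apply: emeasurable_funM => //; exact: measurable_int mg.
- by apply: emeasurable_funM => //; apply/measurable_EFinP; exact: measurable_normal_pdf.
have h : ae_eq mu setT (Radon_Nikodym_SigmaFinite.f (normal_prob m s) mu)
    (fun x => (normal_pdf m s x)%:E).
  apply: integral_ae_eq => //.
    by apply/measurable_EFinP; exact: measurable_normal_pdf.
  by move=> A _ mA; rewrite -Radon_Nikodym_SigmaFinite.f_integral.
by apply: filterS h => x h _; rewrite h.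
Qed.

(** Completing the square turns the integrand into a multiple of the density with mean [t * s ^+ 2].
    The first two moments are then read off this function of [t] near 0. *)
Lemma integral_expR_normal_prob (t s : R) : s != 0 ->
  (\int[normal_prob 0 s]_x (expR (t * x))%:E = (expR (t ^+ 2 * s ^+ 2 / 2))%:E)%E.
Proof.
move=> s0; rewrite ge0_integral_normal_prob//; last first.
  by apply/measurable_EFinP/measurableT_comp => //; exact: measurable_funM.
transitivity (\int[mu]_x ((expR (t ^+ 2 * s ^+ 2 / 2))%:E * (normal_pdf (t * s ^+ 2) s x)%:E))%E.
  apply: eq_integral => x _; rewrite -!EFinM; congr EFin.
  rewrite /normal_pdf (negbTE s0) /normal_fun.
  rewrite !(mulrCA _ (normal_peak s)) -!expRD; congr (_ * expR _).
  by rewrite subr0 -(mulr_natr (s ^+ 2)); field.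
by rewrite integralZl ?integral_normal_pdf ?mule1//; exact: integrable_normal_pdf.
Qed.

Lemma ler_expR_norm (x : R) : expR `|x| <= expR x + expR (- x).
Proof.
by case: (ger0P x) => _; [rewrite lerDl|rewrite lerDr]; exact: expR_ge0.
Qed.

Lemma sinh_approx (y : R) : `|expR y - expR (- y) - 2 * y| <= 2 * y ^+ 2 * expR `|y|.
Proof.
wlog y0 : y / 0 <= y.
  move=> H; case: (leP 0 y) => [/H//|/ltW]; rewrite -oppr_ge0 => /H.
  rewrite opprK normrN sqrrN -[X in `|X|]opprK normrN.
  by rewrite (_ : - (_ - _) = expR y - expR (- y) - 2 * y)//; ring.
rewrite (ger0_norm y0).
have e1 := expR_ge1Dx y; have e2 := expR_ge1Dx (- y).
have ep := expR_gt0 y; have en := expR_gt0 (- y).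
have ee : expR y * expR (- y) = 1 by rewrite -expRD subrr expR0.
have h1 : expR y - 1 <= y * expR y by nra.
have h2 : 1 - expR (- y) <= y by lra.
have h3 : y * expR (- y) <= 1 - expR (- y) by nra.
have h4 : y <= expR y - 1 by lra.
have h5 : 1 - expR (- y) >= y - y ^+ 2 by nra.
rewrite ler_norml; apply/andP; split; nra.
Qed.

(** With S = e^(y/2) - e^(-y/2), the left side is |S^2 - y^2| = |S - y| |S + y|, and [sinh_approx]
    at y/2 controls both factors. *)
Lemma cosh_approx (y : R) :
  `|expR y + expR (- y) - 2 - y ^+ 2| <= 2 * (`|y| ^+ 3 * expR (2 * `|y|)).
Proof.
pose z := y / 2; pose a := `|y|; pose E := expR `|z|; pose S := expR z - expR (- z).
have S2 : expR y + expR (- y) - 2 = S ^+ 2.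
  rewrite (_ : y = z + z); last by rewrite /z; field.
  rewrite opprD !expRD /S.
  have : expR z * expR (- z) = 1 by rewrite -expRD subrr expR0.
  by nra.
have aE : a = `|z| + `|z|.
  by rewrite /a (_ : y = z * 2); [rewrite normrM (ger0_norm (x := 2))//; ring|rewrite /z; field].
have E1 : 1 <= E by rewrite -expR0 ler_expR.
have E2 : expR (2 * a) = E ^+ 4.
  by rewrite aE /E -expRM_natl; congr expR; ring.
have aE2 : a <= E ^+ 2.
  by rewrite /E -expRM_natl mulr2n mulrDl mul1r -aE; have := expR_ge1Dx a; lra.
have a0 : 0 <= a by exact: normr_ge0.
have y2 : y ^+ 2 = a ^+ 2 by rewrite /a real_normK ?num_real.
have D1 : `|S - y| <= a ^+ 2 / 2 * E.
  have := sinh_approx z; rewrite -/E -/S.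
  rewrite (_ : 2 * z = y); last by rewrite /z; field.
  rewrite (_ : 2 * z ^+ 2 = a ^+ 2 / 2)//; last by rewrite -y2 /z; field.
have D2 : `|S + y| <= a ^+ 2 / 2 * E + 2 * a.
  rewrite (_ : S + y = (S - y) + 2 * y); last by ring.
  by rewrite (le_trans (ler_normD _ _))// lerD// normrM ger0_norm.
rewrite S2 subr_sqr normrM -/a E2.
apply: (@le_trans _ _ (a ^+ 2 / 2 * E * (a ^+ 2 / 2 * E + 2 * a))).
  by apply: ler_pM.
rewrite (_ : _ * _ = a ^+ 3 * (a * E ^+ 2 / 4 + E)); last by field.
rewrite [leRHS]mulrCA ler_wpM2l ?exprn_ge0//.
have E0 : 0 <= E by lra.
have h1 : a * E ^+ 2 <= E ^+ 4.
  by rewrite (_ : E ^+ 4 = E ^+ 2 * E ^+ 2); [rewrite ler_wpM2r ?exprn_ge0|ring].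
have h2 : E <= E ^+ 4 by rewrite -[leLHS]expr1 ler_weXn2l.
have h3 : 0 <= E ^+ 4 by rewrite exprn_ge0.
lra.
Qed.

Lemma norm_exp3_le (y : R) : `|y| ^+ 3 <= 6 * expR `|y|.
Proof.
have := expR_ge1Dxn 2 (normr_ge0 y); rewrite (_ : 3`!%:R = 6 :> R)// => h.
have : `|y| ^+ 3 / 6 <= expR `|y| by lra.
by rewrite ler_pdivrMr// mulrC.
Qed.

Lemma norm_exp2_le (y : R) : `|y| ^+ 2 <= 2 * expR `|y|.
Proof.
have := expR_ge1Dxn 1 (normr_ge0 y); rewrite (_ : 2`!%:R = 2 :> R)// => h.
have : `|y| ^+ 2 / 2 <= expR `|y| by lra.
by rewrite ler_pdivrMr// mulrC.
Qed.

Lemma eq_of_small (a b C : R) : (forall t, 0 < t <= 1 -> `|a - b| <= t * C) -> a = b.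
Proof.
move=> H; apply/eqP; rewrite -subr_eq0 -normr_le0; apply/ler_addgt0Pl => e e0.
have C0 : 0 <= C by have := H 1; rewrite mul1r ltr01 lexx => /(_ erefl); apply: le_trans.
have C1 : 0 < C + 1 by lra.
pose t := Num.min 1 (e / (C + 1)).
have t0 : 0 < t by rewrite /t lt_min ltr01 divr_gt0.
rewrite addr0 (le_trans (H t _))//; first by rewrite t0 ge_min lexx.
apply: (@le_trans _ _ (e / (C + 1) * C)); first by rewrite ler_wpM2r// ge_min lexx orbT.
by rewrite mulrAC ler_pdivrMr// ler_wpM2l ?(ltW e0)// lerDl.
Qed.

Context (s : R) (s0 : 0 < s).
Local Notation nu := (normal_prob 0 s).

Let sN0 : s != 0. Proof. by rewrite gt_eqF. Qed.

(** Domination by e^|kx| <= e^(kx) + e^(-kx), whose two terms have explicit normal integrals. *)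
Lemma integrable_normal_exp (k C : R) (h : R -> R) : 0 <= k ->
  measurable_fun [set: R] h -> (forall x, `|h x| <= C * expR (k * `|x|)) ->
  nu.-integrable [set: R] (EFin \o h) /\
  `|\int[nu]_x h x| <= 2 * C * expR (k ^+ 2 * s ^+ 2 / 2).
Proof.
move=> k0 mh hC.
have C0 : 0 <= C.
  by have := hC 0; rewrite normr0 mulr0 expR0 mulr1; apply: le_trans.
have mexp (t : R) : measurable_fun [set: R] (fun x => (expR (t * x))%:E).
  by apply/measurable_EFinP/measurableT_comp => //; exact: measurable_funM.
have hle : (\int[nu]_x `|(EFin \o h) x| <= (2 * C * expR (k ^+ 2 * s ^+ 2 / 2))%:E)%E.
  apply: (@le_trans _ _ (\int[nu]_x (C%:E * ((expR (k * x))%:E + (expR (- k * x))%:E)))%E).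
    apply: ge0_le_integral => //.
    - by apply: measurableT_comp => //; apply/measurable_EFinP.
    - by apply: measurable_funeM; apply: emeasurable_funD; exact: mexp.
    - move=> x _; rewrite -EFinD -EFinM /= lee_fin (le_trans (hC x))// ler_wpM2l//.
      by have := ler_expR_norm (k * x); rewrite normrM (ger0_norm k0) mulNr.
  rewrite ge0_integralZl//; last 2 first.
  - by apply: emeasurable_funD; exact: mexp.
  - by move=> x _; rewrite -EFinD lee_fin addr_ge0 ?expR_ge0.
  rewrite ge0_integralD//; [|exact: mexp|exact: mexp].
  rewrite !integral_expR_normal_prob// sqrrN -EFinD -EFinM lee_fin.
  by rewrite le_eqVlt; apply/orP; left; apply/eqP; ring.
have ih : nu.-integrable [set: R] (EFin \o h).
  apply/integrableP; split; first exact/measurable_EFinP.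
  exact: le_lt_trans hle (ltry _).
split => //; rewrite -lee_fin; apply: le_trans hle.
rewrite EFin_normr_Rintegral//.
exact: (le_abse_integral _ _ (measurable_int _ ih)).
Qed.

Let expN (k : R) x : `|expR (k * x)| <= 1 * expR (`|k| * `|x|).
Proof. by rewrite ger0_norm ?expR_ge0// mul1r ler_expR -normrM ler_norm. Qed.

Let mexp (k : R) : measurable_fun [set: R] (fun x => expR (k * x)).
Proof. by apply: measurableT_comp => //; exact: measurable_funM. Qed.

Let iexp (k : R) : nu.-integrable [set: R] (EFin \o (fun x => expR (k * x))).
Proof. by have [] := integrable_normal_exp (normr_ge0 k) (mexp k) (expN k). Qed.

Let Rintegral_expR (k : R) : \int[nu]_x expR (k * x) = expR (k ^+ 2 * s ^+ 2 / 2).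
Proof. by rewrite /Rintegral integral_expR_normal_prob. Qed.

Lemma integrable_normal_pow (n : nat) : (n <= 2)%N ->
  nu.-integrable [set: R] (EFin \o (fun x => x ^+ n)).
Proof.
move=> n2; have [] := @integrable_normal_exp 1 2 (fun x => x ^+ n); [by []| | |by []].
  exact: measurable_funX.
move=> x; rewrite mul1r normrX; have := norm_exp2_le x; have := expR_ge1Dx `|x|.
have := normr_ge0 x; case: n n2 => [|[|[|n]]] //= _; rewrite ?expr0 ?expr1; lra.
Qed.

(** The moment generating function is even, so the integral of [h] is -2t times the mean, while [h]
    is O(t^2) times an exponential; divide by t and let t tend to 0. *)
Lemma normal_mean : \int[nu]_x x = 0.
Proof.
apply: (@eq_of_small _ _ (4 * expR (4 * s ^+ 2 / 2))) => t /andP[t0 t1].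
have ix : nu.-integrable [set: R] (EFin \o (fun x => x)).
  exact: (integrable_normal_pow (n := 1)).
pose h x := expR (t * x) - expR (- t * x) - 2 * t * x.
have ih1 : nu.-integrable [set: R] (EFin \o (fun x => expR (t * x) - expR (- t * x))).
  by apply: eq_integrable (integrableB measurableT (iexp t) (iexp (- t))) => //.
have ih2 : nu.-integrable [set: R] (EFin \o (fun x => 2 * t * x)).
  by apply: eq_integrable (integrableZl measurableT (2 * t) ix) => //.
have Eh : \int[nu]_x h x = - (2 * t * \int[nu]_x x).
  rewrite /h RintegralB// RintegralB//.
  by rewrite !Rintegral_expR sqrrN subrr sub0r RintegralZl.
have mh : measurable_fun [set: R] h.
  by apply: measurable_funB; [apply: measurable_funB; exact: mexp|exact: measurable_funM].
have hb x : `|h x| <= 4 * t ^+ 2 * expR (2 * `|x|).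
  rewrite /h mulNr -mulrA (le_trans (sinh_approx _))//.
  rewrite normrM (gtr0_norm t0) exprMn.
  have h1 := norm_exp2_le x; rewrite real_normK ?num_real// in h1.
  have h2 : expR (t * `|x|) <= expR `|x| by rewrite ler_expR ler_piMl.
  have h3 : expR (2 * `|x|) = expR `|x| * expR `|x| by rewrite -expRD; congr expR; ring.
  rewrite h3 (_ : 2 * _ * _ = t ^+ 2 * (2 * x ^+ 2 * expR (t * `|x|))); last by ring.
  rewrite (_ : 4 * _ * _ = t ^+ 2 * (4 * expR `|x| * expR `|x|)); last by ring.
  have x2 := sqr_ge0 x.
  by rewrite ler_wpM2l ?sqr_ge0//; apply: ler_pM => //; rewrite ?expR_ge0//; lra.
have [_] := integrable_normal_exp (ler0n R 2) mh hb.
rewrite Eh normrN normrM normrM (gtr0_norm t0) (ger0_norm (x := 2))// subr0.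
rewrite [2%:R ^+ 2](_ : _ = 4); last by ring.
rewrite (_ : 2 * (4 * _) * _ = (2 * t) * (t * (4 * expR (4 * s ^+ 2 / 2)))); last by rewrite expr2; ring.
by rewrite ler_pM2l// mulr_gt0.
Qed.

(** The symmetric second difference of the moment generating function at 0 is 2 (e^u - 1), that is
    t^2 s^2 up to O(t^4), while [h] is O(t^3) times an exponential. Dividing by t^2 leaves an error
    O(t); the two constants bound these two contributions. *)
Lemma normal_variance : \int[nu]_x x ^+ 2 = s ^+ 2.
Proof.
apply: (@eq_of_small _ _ (24 * expR (9 * s ^+ 2 / 2) + s ^+ 4 * expR (s ^+ 2))) => t /andP[t0 t1].
have ix := integrable_normal_pow (leqnn 2).
pose h x := expR (t * x) + expR (- t * x) - 2 - t ^+ 2 * x ^+ 2.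
have ih1 : nu.-integrable [set: R] (EFin \o (fun x => expR (t * x) + expR (- t * x))).
  by apply: eq_integrable (integrableD measurableT (iexp t) (iexp (- t))) => //.
have i2 : nu.-integrable [set: R] (EFin \o (fun=> 2 : R)).
  exact/integrable_bdd/bdd_measurable_cst.
have ih2 : nu.-integrable [set: R] (EFin \o (fun x => expR (t * x) + expR (- t * x) - 2)).
  by apply: eq_integrable (integrableB measurableT ih1 i2) => //.
have ih3 : nu.-integrable [set: R] (EFin \o (fun x => t ^+ 2 * x ^+ 2)).
  by apply: eq_integrable (integrableZl measurableT (t ^+ 2) ix) => //.
pose u := t ^+ 2 * s ^+ 2 / 2.
have Eh : \int[nu]_x h x = 2 * expR u - 2 - t ^+ 2 * \int[nu]_x x ^+ 2.
  rewrite /h RintegralB// RintegralB// RintegralD//.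
  rewrite !Rintegral_expR sqrrN RintegralZl// Rintegral_cstT -/u; congr (_ - _ - _); ring.
have mh : measurable_fun [set: R] h.
  apply: measurable_funB; last by apply: measurable_funM => //; exact: measurable_funX.
  by apply: measurable_funB => //; apply: measurable_funD; exact: mexp.
have hb x : `|h x| <= 12 * t ^+ 3 * expR (3 * `|x|).
  rewrite /h mulNr -exprMn (le_trans (cosh_approx _))//.
  rewrite normrM (gtr0_norm t0) exprMn.
  have h1 := norm_exp3_le x.
  have h2 : expR (2 * (t * `|x|)) <= expR (2 * `|x|) by rewrite ler_expR ler_pM2l// ler_piMl.
  have h3 : expR (3 * `|x|) = expR `|x| * expR (2 * `|x|) by rewrite -expRD; congr expR; ring.
  rewrite h3 (_ : 2 * _ = t ^+ 3 * (2 * `|x| ^+ 3 * expR (2 * (t * `|x|)))); last by ring.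
  rewrite (_ : 12 * _ * _ = t ^+ 3 * (12 * expR `|x| * expR (2 * `|x|))); last by ring.
  have x3 : 0 <= `|x| ^+ 3 by rewrite exprn_ge0.
  rewrite ler_wpM2l ?exprn_ge0 ?(ltW t0)//.
  by apply: ler_pM => //; rewrite ?expR_ge0//; lra.
have [_] := integrable_normal_exp (ler0n R 3) mh hb.
rewrite Eh [3%:R ^+ 2](_ : _ = 9); last by ring.
set V := \int[nu]_x _.
set e9 := expR (9 * _ / _) => H.
have t20 : 0 < t ^+ 2 by rewrite exprn_gt0.
have u0 : 0 <= u by rewrite /u divr_ge0// mulr_ge0 ?sqr_ge0.
have us : u <= s ^+ 2.
  by have := sqr_ge0 s; have : t ^+ 2 <= 1 by [rewrite exprn_ile1// ltW]; rewrite /u; nra.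
have Eu : expR u <= expR (s ^+ 2) by rewrite ler_expR.
have e1 := expR_ge1Dx u; have e2 := expR_ge1Dx (- u).
have ee : expR u * expR (- u) = 1 by rewrite -expRD subrr expR0.
have ep := expR_gt0 u.
have h1 : expR u - 1 <= u * expR u by nra.
have h2 : expR u - 1 - u <= u ^+ 2 * expR u.
  have : u * (expR u - 1) <= u * (u * expR u) by rewrite ler_wpM2l.
  by nra.
have h3 : u ^+ 2 * expR u <= t ^+ 3 * (s ^+ 4 * expR (s ^+ 2)) / 2.
  apply: (@le_trans _ _ (u ^+ 2 * expR (s ^+ 2))); first by rewrite ler_wpM2l ?sqr_ge0.
  rewrite (_ : u ^+ 2 * _ = t ^+ 4 * (s ^+ 4 * expR (s ^+ 2)) / 4); last by rewrite /u; field.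
  have K0 : 0 <= s ^+ 4 * expR (s ^+ 2) by rewrite mulr_ge0 ?exprn_ge0 ?expR_ge0 ?(ltW s0).
  have : t ^+ 4 * (s ^+ 4 * expR (s ^+ 2)) <= t ^+ 3 * (s ^+ 4 * expR (s ^+ 2)).
    by rewrite ler_wpM2r// [t ^+ 4]exprS ler_piMl// exprn_ge0// ltW.
  have : 0 <= t ^+ 3 * (s ^+ 4 * expR (s ^+ 2)) by rewrite mulr_ge0// exprn_ge0// ltW.
  by move=> ? ?; lra.
rewrite -(ler_pM2l t20) -[t ^+ 2 * `|_|](_ : `|t ^+ 2 * (V - s ^+ 2)| = _); last first.
  by rewrite normrM (gtr0_norm t20).
have -> : t ^+ 2 * (V - s ^+ 2) = t ^+ 2 * V - 2 * u by rewrite /u; field.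
have -> : t ^+ 2 * (t * (24 * e9 + s ^+ 4 * expR (s ^+ 2))) =
  24 * t ^+ 3 * e9 + t ^+ 3 * (s ^+ 4 * expR (s ^+ 2)) by ring.
move: H; rewrite !ler_norml => /andP[H1 H2]; apply/andP; split; lra.
Qed.

(** Dominating |x|^3 by 6 s^3 e^(|x|/s), with the rate adapted to [s], is what produces the factor
    [s ^+ 3]. *)
Lemma normal_third_moment (h : R -> R) (K : R) : 0 <= K -> measurable_fun [set: R] h ->
  (forall x, `|h x| <= K * `|x| ^+ 3) ->
  nu.-integrable [set: R] (EFin \o h) /\
  `|\int[nu]_x h x| <= 12 * expR 2^-1 * K * s ^+ 3.
Proof.
move=> K0 mh hK.
have [||] := @integrable_normal_exp s^-1 (6 * K * s ^+ 3) h _ mh.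
- by rewrite invr_ge0 ltW.
- move=> x; rewrite (le_trans (hK x))//.
  have := norm_exp3_le (s^-1 * x); rewrite normrM (gtr0_norm (x := s^-1)) ?invr_gt0//.
  set E := expR _ => H.
  rewrite (_ : K * _ = K * s ^+ 3 * (s^-1 * `|x|) ^+ 3); last by field.
  rewrite (_ : 6 * _ * _ * _ = K * s ^+ 3 * (6 * E)); last by ring.
  by rewrite ler_wpM2l// mulr_ge0// exprn_ge0// ltW.
move=> ih; rewrite (_ : s^-1 ^+ 2 * _ / 2 = 2^-1); last by field.
move=> H; split => //; apply: le_trans H _.
by rewrite le_eqVlt; apply/orP; left; apply/eqP; ring.
Qed.

End normal_moments.

(** * Central limit theorem on one block *)

Section smoothing.
Context {R : realType}.
Local Notation mu := (@lebesgue_measure R).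
Implicit Types (f g F : R -> R) (L M K x h : R).

Let prim f (a x : R) := \int[mu]_(t in `[- a, x]) f t.

Let integrable_seg f (a b : R) : continuous f -> mu.-integrable `[a, b] (EFin \o f).
Proof.
move=> cf; apply: continuous_compact_integrable; first exact: segment_compact.
exact: continuous_subspaceT.
Qed.

Let prim_indep f (a b x : R) : continuous f -> 0 <= a -> 0 <= b -> - a <= x -> - b <= x ->
  prim f a x - prim f a 0 = prim f b x - prim f b 0.
Proof.
move=> cf a0 b0 ax bx.
have Npa (c : R) : 0 <= c -> - c <= 0 by rewrite oppr_le0.
case: (leP 0 x) => x0.
  by rewrite /prim !Rintegral_itvB ?bnd_simp ?Npa//; exact: integrable_seg.
rewrite -[LHS]opprB -[RHS]opprB; congr (- _).
by rewrite /prim !Rintegral_itvB ?bnd_simp ?(ltW x0)//; exact: integrable_seg.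
Qed.

(** The witness is the oriented integral from 0 to [x], written with a base point to the left of
    both 0 and [x]. Near a given [x] the base point can be frozen, by [prim_indep]. *)
Lemma antiderivative_ex f : continuous f ->
  exists F, forall x, is_derive x 1 F (f x).
Proof.
move=> cf; exists (fun x => prim f `|x| x - prim f `|x| 0) => x.
pose a := `|x| + 1.
have a0 : 0 <= a by rewrite addr_ge0.
have xa : - a < x by rewrite ltrNl (le_lt_trans (ler_norm _))// normrN /a ltrDl.
apply: (@near_eq_is_derive _ _ _ (fun y => prim f a y - prim f a 0)).
  near=> y; apply: prim_indep => //; last by rewrite lerNl -normrN ler_norm.
  by near: y; apply: filterS (lt_nbhsr xa) => y /ltW.
have [|d1 d2] := @continuous_FTC1_closed _ f (- a) x (x + 1) _ (integrable_seg _ _ cf) xa (cf x).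
  by rewrite ltrDl.
have dp : is_derive x 1 (prim f a) (f x).
  by apply: (DeriveDef d1); rewrite -derive1E; exact: d2.
rewrite -[f x]subr0.
exact: is_deriveB dp (is_derive_cst (prim f a 0) x 1).
Unshelve. all: by end_near. Qed.

Lemma is_derive_continuous F (dF : R -> R) :
  (forall x, is_derive x 1 F (dF x)) -> continuous F.
Proof.
by move=> H x; apply: differentiable_continuous; apply/derivable1_diffP; case: (H x).
Qed.

Lemma le_pow_of_derive F (dF : R -> R) (C : R) (n : nat) h :
  (forall x, is_derive x 1 F (dF x)) -> F 0 = 0 ->
  (forall x, `|dF x| <= C * `|x| ^+ n) -> `|F h| <= C * `|h| ^+ n.+1.
Proof.
move=> dFF F0 dFC.
have C0 : 0 <= C.
  by have := dFC 1; rewrite normr1 expr1n mulr1; apply: le_trans.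
have cF : continuous F := is_derive_continuous dFF.
suff [c ch ->] : exists2 c, `|c| <= `|h| & F h = dF c * h.
  rewrite normrM exprSr mulrA ler_wpM2r// (le_trans (dFC c))// ler_wpM2l//.
  by rewrite lerXn2r ?nnegrE.
case: (leP 0 h) => h0.
  have [c] := MVT_segment h0 (fun x _ => dFF x) (continuous_subspaceT cF).
  rewrite in_itv/= F0 !subr0 => /andP[c0 ch] ->; exists c => //.
  by rewrite !ger0_norm// (le_trans c0).
have [c] := MVT_segment (ltW h0) (fun x _ => dFF x) (continuous_subspaceT cF).
rewrite in_itv/= F0 => /andP[hc c0]; rewrite !sub0r mulrN => /oppr_inj ->; exists c => //.
by rewrite !ler0_norm ?lerN2// ltW.
Qed.

(* The coefficients [g1 x] and [g2 x] are arbitrary: no measurability in [x] is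
   needed, since expansions are only integrated in [h] for fixed [x]. *)
Definition cubic_expansion K g := exists g1 g2 : R -> R, forall x h,
  `|g (x + h) - g x - g1 x * h - g2 x * h ^+ 2| <= K * `|h| ^+ 3.

Definition bdd_lipschitz L M g :=
  (forall x y, `|g x - g y| <= L * `|x - y|) /\ forall x, `|g x| <= M.

Lemma bdd_lipschitz_continuous L M g : bdd_lipschitz L M g -> continuous g.
Proof.
move=> [gL _] x; apply/cvgrPdist_le => e e0; near=> y.
rewrite (le_trans (gL _ _))//.
have L1 : 0 < `|L| + 1 by rewrite ltr_wpDl.
apply: (@le_trans _ _ ((`|L| + 1) * `|x - y|)).
  by rewrite ler_wpM2r// (le_trans (ler_norm _))// lerDl.
rewrite -ler_pdivlMl// mulrC; near: y.
by move/cvgrPdist_le : (@cvg_id _ (nbhs x)); apply; rewrite divr_gt0.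
Unshelve. all: by end_near. Qed.

Lemma is_derive1_shift F (d x y : R) : is_derive (x + y) 1 F d ->
  is_derive y 1 (fun h => F (x + h)) d.
Proof.
move=> dF; have dx : is_derive y 1 (fun h => x + h) (0 + 1).
  exact: is_deriveD (is_derive_cst x y 1) (is_derive_id y 1).
rewrite add0r in dx; rewrite -[d]mulr1.
exact: (@is_derive1_comp _ F (fun h => x + h) y d 1 dF dx).
Qed.

(** [K] is chosen before [g], because the test functions met later change with the history of the
    urn. The 4 in [K] is 1 + 2 + 1, from the three Taylor remainders of [F2] in a second
    difference. *)
Lemma smooth_approx L M (e : R) : 0 <= L -> 0 <= M -> 0 < e -> exists K, 0 <= K /\
  forall g, bdd_lipschitz L M g -> exists g', [/\ cubic_expansion K g',
    exists L' M', bdd_lipschitz L' M' g' & forall x, `|g' x - g x| <= 2 * L * e].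
Proof.
move=> L0 M0 e0; exists (4 * L / e ^+ 2).
split=> [|g gLM]; first by apply: divr_ge0; [exact: mulr_ge0|exact: sqr_ge0].
have [gL gM] := gLM.
have [F1 dF1] := antiderivative_ex (bdd_lipschitz_continuous gLM).
have [F2 dF2] := antiderivative_ex (is_derive_continuous dF1).
have H1 x h : `|F1 (x + h) - F1 x - g x * h| <= L * `|h| ^+ 2.
  apply: (@le_pow_of_derive (fun h => F1 (x + h) - F1 x - g x * h)
    (fun h => g (x + h) - g x)).
  - move=> y; apply: is_deriveB.
      by rewrite -[g (x + y)]subr0; apply: is_deriveB; exact: is_derive1_shift.
    by apply: is_derive_eq; rewrite scaler1.
  - by rewrite addr0 subrr mulr0 subrr.
  - by move=> y; rewrite (le_trans (gL _ _))// [x + y]addrC addrK expr1.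
have H2 x h : `|F2 (x + h) - F2 x - F1 x * h - g x / 2 * h ^+ 2| <= L * `|h| ^+ 3.
  apply: (@le_pow_of_derive (fun h => F2 (x + h) - F2 x - F1 x * h - g x / 2 * h ^+ 2)
    (fun h => F1 (x + h) - F1 x - g x * h)).
  - move=> y; apply: is_deriveB.
      apply: is_deriveB.
        by rewrite -[F1 (x + y)]subr0; apply: is_deriveB; exact: is_derive1_shift.
      by apply: is_derive_eq; rewrite scaler1.
    by apply: is_derive_eq; rewrite /GRing.scale/=; field.
  - by rewrite addr0 subrr !mulr0 expr0n mulr0 !subr0.
  - by move=> y; exact: H1.
(* This is the average of [g] against a triangular kernel of width [e]. *)
pose g' x := (F2 (x + e) - 2 * F2 x + F2 (x - e)) / e ^+ 2.
have e20 : 0 < e ^+ 2 by rewrite exprn_gt0.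
have g'g x : `|g' x - g x| <= 2 * L * e.
  have A := H2 x e; have B := H2 x (- e).
  rewrite sqrrN normrN (gtr0_norm e0) in B; rewrite (gtr0_norm e0) in A.
  rewrite -(ler_pM2l e20) -(gtr0_norm e20) -normrM (gtr0_norm e20).
  have -> : e ^+ 2 * (g' x - g x) = (F2 (x + e) - F2 x - F1 x * e - g x / 2 * e ^+ 2)
     + (F2 (x - e) - F2 x - F1 x * - e - g x / 2 * e ^+ 2).
    by rewrite /g'; field; rewrite gt_eqF.
  rewrite (le_trans (ler_normD _ _))// (le_trans (lerD A B))//.
  by rewrite le_eqVlt; apply/orP; left; apply/eqP; ring.
exists g'; split => //.
  exists (fun x => (F1 (x + e) - 2 * F1 x + F1 (x - e)) / e ^+ 2),
    (fun x => (g (x + e) - 2 * g x + g (x - e)) / 2 / e ^+ 2) => x h.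
  have A := H2 (x + e) h; have B := H2 x h; have C := H2 (x - e) h.
  rewrite -(ler_pM2l e20) -(gtr0_norm e20) -normrM (gtr0_norm e20).
  set r1 := F2 (x + e + h) - _ - _ - _ in A; set r2 := F2 (x + h) - _ - _ - _ in B.
  set r3 := F2 (x - e + h) - _ - _ - _ in C.
  have -> : e ^+ 2 * (4 * L / e ^+ 2 * `|h| ^+ 3) = 4 * (L * `|h| ^+ 3).
    by field; rewrite gt_eqF.
  rewrite [X in `|X|](_ : _ = r1 - 2 * r2 + r3); last first.
    by rewrite /g' /r1 /r2 /r3 (addrAC x h e) (addrAC x h (- e)); field; rewrite gt_eqF.
  rewrite (le_trans (ler_normD _ _))// (le_trans (lerD (ler_normB _ _) (lexx _)))//.
  by rewrite normrM (ger0_norm (x := 2))//; lra.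
exists (2 * L), (M + 2 * L * e); split; last first.
  move=> x; rewrite -[g' x](subrK (g x)) addrC (le_trans (ler_normD _ _))// lerD//.
(* The derivative of [g'] is a second difference of [F1] over e^2, the sum of two first-order
   remainders of size at most L each. *)
move=> x y; rewrite -[x in g' x](subrK y) [x - y + y]addrC.
have := @le_pow_of_derive (fun h => g' (y + h) - g' y)
  (fun h => (F1 (y + h + e) - 2 * F1 (y + h) + F1 (y + h - e)) / e ^+ 2) (2 * L) 0 (x - y).
rewrite expr1; apply.
- move=> h; rewrite -[(_ + _) / _]subr0; apply: is_deriveB.
  apply: (@is_derive1_shift g').
  have D1 (c z : R) : is_derive z 1 (fun z => F2 (z + c)) (F1 (z + c)).
    under eq_fun do rewrite addrC; rewrite addrC.
    by apply: is_derive1_shift; exact: dF2.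
  have := is_deriveZ (e ^+ 2)^-1 (is_deriveD (is_deriveB (D1 e (y + h))
    (is_deriveZ 2 (dF2 (y + h)))) (D1 (- e) (y + h))).
  rewrite [X in is_derive _ _ X _](_ : _ = g'); last first.
    by apply/funext => t; rewrite /g' [RHS]mulrC.
  by rewrite [X in is_derive _ _ _ X](_ : _ =
    (F1 (y + h + e) - 2 * F1 (y + h) + F1 (y + h - e)) / e ^+ 2) // mulrC.
- by rewrite addr0 subrr.
move=> h; rewrite expr0 mulr1 normrM normfV (gtr0_norm e20) ler_pdivrMr//.
have A := H1 (y + h) e; have B := H1 (y + h) (- e).
rewrite normrN (gtr0_norm e0) in B; rewrite (gtr0_norm e0) in A.
rewrite [X in `|X|](_ : _ = (F1 (y + h + e) - F1 (y + h) - g (y + h) * e)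
   + (F1 (y + h - e) - F1 (y + h) - g (y + h) * - e)); last by ring.
by rewrite (le_trans (ler_normD _ _))//; lra.
Qed.

End smoothing.

(** * Test functions under thinning and under the normal law *)

Section lindeberg.
Context {R : realType}.
Implicit Types (g : R -> R) (L M K x r a : R).

Lemma bdd_lipschitz_translate L M g x : bdd_lipschitz L M g ->
  bdd_lipschitz L M (fun y => g (x + y)).
Proof.
move=> [gL gM]; split=> // y z; rewrite (le_trans (gL _ _))// opprD addrACA subrr add0r//.
Qed.

Lemma bdd_lipschitz_convex L M g1 g2 r : 0 <= r <= 1 ->
  bdd_lipschitz L M g1 -> bdd_lipschitz L M g2 ->
  bdd_lipschitz L M (fun y => r * g1 y + (1 - r) * g2 y).
Proof.
move=> /andP[r0 r1] [L1 M1] [L2 M2]; have r1' : 0 <= 1 - r by rewrite subr_ge0.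
split=> [y z|y].
  rewrite (_ : _ - _ = r * (g1 y - g1 z) + (1 - r) * (g2 y - g2 z)); last by ring.
  rewrite (le_trans (ler_normD _ _))// !normrM (ger0_norm r0) (ger0_norm r1').
  have := ler_wpM2l r0 (L1 y z); have := ler_wpM2l r1' (L2 y z); lra.
rewrite (le_trans (ler_normD _ _))// !normrM (ger0_norm r0) (ger0_norm r1').
have := ler_wpM2l r0 (M1 y); have := ler_wpM2l r1' (M2 y); lra.
Qed.

Lemma cubic_expansion_translate K g x : cubic_expansion K g ->
  cubic_expansion K (fun y => g (y + x)).
Proof.
move=> [g1 [g2 H]]; exists (fun y => g1 (y + x)), (fun y => g2 (y + x)) => y h.
by rewrite (addrAC y h x); exact: H.
Qed.

Lemma cubic_expansion_convex K g1 g2 r : 0 <= r <= 1 ->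
  cubic_expansion K g1 -> cubic_expansion K g2 ->
  cubic_expansion K (fun y => r * g1 y + (1 - r) * g2 y).
Proof.
move=> /andP[r0 r1] [u1 [v1 H1]] [u2 [v2 H2]]; have r1' : 0 <= 1 - r by rewrite subr_ge0.
exists (fun y => r * u1 y + (1 - r) * u2 y), (fun y => r * v1 y + (1 - r) * v2 y) => y h.
rewrite (_ : _ - _ - _ - _ = r * (g1 (y + h) - g1 y - u1 y * h - v1 y * h ^+ 2)
  + (1 - r) * (g2 (y + h) - g2 y - u2 y * h - v2 y * h ^+ 2)); last by ring.
rewrite (le_trans (ler_normD _ _))// !normrM (ger0_norm r0) (ger0_norm r1').
have := ler_wpM2l r0 (H1 y h); have := ler_wpM2l r1' (H2 y h); lra.
Qed.

Lemma centered_thin_lipschitz L M g r a u : 0 <= r <= 1 ->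
  bdd_lipschitz L M g -> bdd_lipschitz L M (centered_thin r a g u).
Proof.
move=> r01 gL; elim: u => [|u IH].
  by rewrite (_ : centered_thin _ _ _ _ = g)//; apply/funext => x; exact: centered_thin0.
rewrite (_ : centered_thin _ _ _ _ = fun x =>
  r * centered_thin r a g u (a * (r^-1 - 1) + x) +
  (1 - r) * centered_thin r a g u (- a + x)).
  by apply: bdd_lipschitz_convex => //; exact: bdd_lipschitz_translate.
by apply/funext => x; rewrite centered_thinS [x + _]addrC [x - a]addrC.
Qed.

(** Translations and convex combinations preserve the expansion with the same [K], so the balls not
    yet replaced can be absorbed in the test function. *)
Lemma centered_thin_expansion K g r a u : 0 <= r <= 1 ->
  cubic_expansion K g -> cubic_expansion K (centered_thin r a g u).
Proof.
move=> r01 gK; elim: u => [|u IH].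
  by rewrite (_ : centered_thin _ _ _ _ = g)//; apply/funext => x; exact: centered_thin0.
rewrite (_ : centered_thin _ _ _ _ = fun x =>
  r * centered_thin r a g u (x + a * (r^-1 - 1)) +
  (1 - r) * centered_thin r a g u (x - a)).
  by apply: cubic_expansion_convex => //; exact: cubic_expansion_translate.
by apply/funext => x; rewrite centered_thinS.
Qed.

Lemma lipschitz_measurable L M g : bdd_lipschitz L M g -> measurable_fun [set: R] g.
Proof. by move=> gL; apply: continuous_measurable_fun; exact: (bdd_lipschitz_continuous gL). Qed.

Lemma bdd_lipschitz_comp d (T : measurableType d) L M g (X : T -> R) :
  bdd_lipschitz L M g -> measurable_fun [set: T] X ->
  bdd_measurable (fun w => g (X w)).
Proof.
move=> gL mX; split; first exact: measurableT_comp (lipschitz_measurable gL) mX.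
by exists M => w; case: gL.
Qed.

Lemma normal_expansion K L M g x (s : R) : 0 < s -> 0 <= K -> bdd_lipschitz L M g ->
  forall b1 b2, (forall h, `|g (x + h) - g x - b1 * h - b2 * h ^+ 2| <= K * `|h| ^+ 3) ->
  `|\int[normal_prob 0 s]_h g (x + h) - (g x + b2 * s ^+ 2)| <=
    12 * expR 2^-1 * K * s ^+ 3.
Proof.
move=> s0 K0 gL b1 b2 H.
set nu := normal_prob 0 s.
have ix : nu.-integrable [set: R] (EFin \o (fun h => b1 * h)).
  have := integrable_normal_pow s0 (isT : (1 <= 2)%N).
  by move=> /(integrableZl measurableT b1); apply: eq_integrable => //.
have ix2 : nu.-integrable [set: R] (EFin \o (fun h => b2 * h ^+ 2)).
  have := integrable_normal_pow s0 (isT : (2 <= 2)%N).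
  by move=> /(integrableZl measurableT b2); apply: eq_integrable => //.
have bg := bdd_lipschitz_comp (bdd_lipschitz_translate x gL) (@measurable_id _ _ setT).
have ig := integrable_bdd nu bg.
have ic : nu.-integrable [set: R] (EFin \o (fun=> g x)).
  exact/integrable_bdd/bdd_measurable_cst.
have i1 : nu.-integrable [set: R] (EFin \o (fun h => g (x + h) - g x)).
  by apply: eq_integrable (integrableB measurableT ig ic).
have i2 : nu.-integrable [set: R] (EFin \o (fun h => g (x + h) - g x - b1 * h)).
  by apply: eq_integrable (integrableB measurableT i1 ix).
have := @normal_third_moment _ s s0 (fun h => g (x + h) - g x - b1 * h - b2 * h ^+ 2) K K0.
move=> [||_].
- apply: measurable_funB; last by apply: measurable_funM => //; exact: measurable_funX.
  apply: measurable_funB; last exact: measurable_funM.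
  by apply: measurable_funB => //; case: bg.
- exact: H.
rewrite -/nu RintegralB// RintegralB// RintegralB// !RintegralZl//; last 2 first.
- exact: (integrable_normal_pow s0 (isT : (2 <= 2)%N)).
- exact: (integrable_normal_pow s0 (isT : (1 <= 2)%N)).
rewrite normal_variance// normal_mean// mulr0 subr0 Rintegral_cstT.
by rewrite opprD addrA.
Qed.

End lindeberg.

Lemma Rintegral_law d (T : measurableType d) (R : realType) (P : probability T R)
    (nu : probability (measurableTypeR R) R) (X : T -> measurableTypeR R) (g : R -> R) (L M : R) :
  measurable_fun [set: T] X ->
  (forall A : set R, measurable A -> P (X @^-1` A) = nu A) ->
  bdd_lipschitz L M g -> \int[P]_w g (X w) = \int[nu]_x g x.
Proof.
move=> mX lawX gL; rewrite /Rintegral; congr fine.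
have mg : measurable_fun [set: R] (EFin \o g).
  by apply/measurable_EFinP; exact: lipschitz_measurable gL.
have ig : P.-integrable (X @^-1` setT) ((EFin \o g) \o X).
  by rewrite preimage_setT; exact: (integrable_bdd P (bdd_lipschitz_comp gL mX)).
have := integral_pushforward mX mg ig measurableT.
rewrite preimage_setT => <-.
pose X' : {mfun T >-> measurableTypeR R} :=
  MeasurableFun.Pack (MeasurableFun.Class (isMeasurableFun.Build _ _ _ _ _ mX)).
apply: (@eq_measure_integral _ _ _ _ nu (distribution P X')) => A mA _.
exact: lawX.
Qed.

(** * Expectations of functions of a Brownian motion *)

Section brownian_expectation.
Context {R : realType} d (T : measurableType d) (P : probability T R).
Context (B : R -> {mfun T >-> R}) (hB : standard_BM P B).
Implicit Types (g : R -> R) (L M K x r a s : R).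

(** The Brownian motion itself supplies the normal laws: the variance 0 is included, and their
    convolution rule follows from independent increments. *)
Definition bm_exp s g : R := \int[P]_w g (B s w).

Lemma bm_exp0 g : bm_exp 0 g = g 0.
Proof.
have [B0 _ _ _] := hB; rewrite /bm_exp.
by under eq_Rintegral do rewrite B0; rewrite Rintegral_cstT.
Qed.

Lemma measurable_bm_increment a b : measurable_fun [set: T] (fun w => B b w - B a w).
Proof. exact: measurable_funB. Qed.

Lemma Rintegral_bm_increment_normal a b g L M : 0 <= a < b -> bdd_lipschitz L M g ->
  \int[P]_w g (B b w - B a w) = \int[normal_prob 0 (Num.sqrt (b - a))]_x g x.
Proof.
move=> ab gL; have [_ _ HN _] := hB.
have mX := measurable_bm_increment a b.
have := @Rintegral_law _ _ _ P (normal_prob 0 (Num.sqrt (b - a)))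
  (fun w => B b w - B a w) g L M mX.
apply=> // A mA; exact: HN.
Qed.

Lemma bm_exp_normal s g L M : 0 < s -> bdd_lipschitz L M g ->
  bm_exp s g = \int[normal_prob 0 (Num.sqrt s)]_x g x.
Proof.
move=> s0 gL; have [B0 _ _ _] := hB.
rewrite -[s in RHS]subr0 -(@Rintegral_bm_increment_normal 0 s g L M) ?lexx//.
by apply: eq_Rintegral => w _; rewrite B0 subr0.
Qed.

Lemma Rintegral_bm_increment a b g L M : 0 <= a <= b -> bdd_lipschitz L M g ->
  \int[P]_w g (B b w - B a w) = bm_exp (b - a) g.
Proof.
move=> /andP[a0]; rewrite le_eqVlt => /predU1P[<-|ab] gL.
  rewrite subrr bm_exp0 -[RHS](Rintegral_cstT P).
  by apply: eq_Rintegral => w _; rewrite subrr.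
by rewrite (Rintegral_bm_increment_normal _ gL) ?a0// (bm_exp_normal _ gL)// subr_gt0.
Qed.

Lemma bm_exp_semigroup a b g L M : 0 <= L -> 0 <= a -> 0 <= b -> bdd_lipschitz L M g ->
  bm_exp (a + b) g = \int[P]_w bm_exp b (fun y => g (B a w + y)).
Proof.
move=> L0 a0 b0 gL; have [B0 hI _ _] := hB.
(* The times 0, a, a + b, constant afterwards: only the first two increments matter. *)
pose t i : R := if i is i'.+1 then (if i' is 0%N then a else a + b) else 0.
have tS i : t i <= t i.+1.
  by case: i => [|[|i]] //=; rewrite lerDl.
pose X i w := B (t i.+1) w - B (t i) w.
have mX i : measurable_fun [set: T] (X i) by exact: measurable_bm_increment.
have [gl gM] := gL.
have := @Rintegral_indep_cons _ _ _ P 1 X (fun v => g (\sum_(i < size v) v`_i)) L M mX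
  (hI 2%N t (lexx 0) tS) (lipschitz_seq_sum L0 gl) (fun v => gM _).
rewrite /= => H.
transitivity (\int[P]_w g (\sum_(i < 2) [:: X 0%N w; X 1%N w]`_i)).
  by apply: eq_Rintegral => w _; rewrite big_ord_recl big_ord1 /X /= B0 subr0; congr g; rewrite [RHS]addrC subrK.
rewrite H; apply: eq_Rintegral => w _.
under eq_Rintegral do rewrite big_ord_recl big_ord1 /X /= B0 subr0.
have := @Rintegral_bm_increment a (a + b) (fun y => g (B a w + y)) L M.
rewrite addrC addrK a0 lerDr => -> //; exact: bdd_lipschitz_translate.
Qed.

Lemma bm_exp_expansion K L M g x s : 0 <= s -> 0 <= K -> bdd_lipschitz L M g ->
  forall b1 b2, (forall h, `|g (x + h) - g x - b1 * h - b2 * h ^+ 2| <= K * `|h| ^+ 3) ->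
  `|bm_exp s (fun h => g (x + h)) - (g x + b2 * s)| <=
    12 * expR 2^-1 * K * Num.sqrt s ^+ 3.
Proof.
rewrite le_eqVlt => /predU1P[<-|s0] K0 gL b1 b2 H.
  by rewrite bm_exp0 addr0 mulr0 addr0 subrr normr0 sqrtr0 expr0n/= mulr0.
rewrite (bm_exp_normal s0 (bdd_lipschitz_translate x gL)).
have sq0 : 0 < Num.sqrt s by rewrite sqrtr_gt0.
by have := normal_expansion sq0 K0 gL H; rewrite sqr_sqrtr// ltW.
Qed.

(** From |x| <= e + x^2 / e, so that the variance of the increment suffices. *)
Lemma bm_exp_cont_le g L M s t (e : R) : 0 <= L -> 0 <= M -> 0 < e -> 0 <= s <= t ->
  bdd_lipschitz L M g -> `|bm_exp s g - bm_exp t g| <= L * (e + (t - s) / e).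
Proof.
move=> L0 M0 e0 /andP[s0 st] gL.
have [gl gM] := gL.
move: st; rewrite le_eqVlt => /predU1P[<-|st].
  by rewrite subrr normr0 subrr mul0r addr0 mulr_ge0// ltW.
(* Truncating at [2 * M] makes the modulus a bounded Lipschitz function, whose mean can be
   transferred to the normal law. *)
pose m x := Num.min (2 * M) (L * `|x|).
have mL : bdd_lipschitz L (2 * M) m.
  split=> [x y|x]; last first.
    rewrite /m ger0_norm ?ge_min ?lexx//.
    by rewrite le_min !mulr_ge0.
  have := ler_wpM2l L0 (ler_dist_dist x y).
  have : `|(L * `|x|) - (L * `|y|)| = L * `| `|x| - `|y| |.
    by rewrite -mulrBr normrM ger0_norm.
  move=> <- H; apply: le_trans H.
  rewrite /m; move: (L * `|x|) (L * `|y|) => p q.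
  case: (leP (2 * M) p) => h1; case: (leP (2 * M) q) => h2.
  - by rewrite subrr normr0.
  - by rewrite !ger0_norm; lra.
  - by rewrite !ler0_norm; lra.
  - by [].
have bs := bdd_lipschitz_comp gL (@measurable_funPT _ _ _ _ (B s)).
have bt := bdd_lipschitz_comp gL (@measurable_funPT _ _ _ _ (B t)).
have bm := bdd_lipschitz_comp mL (measurable_bm_increment s t).
rewrite /bm_exp -RintegralB_bdd//.
have bst := bdd_measurableB bs bt.
rewrite (le_trans (le_normr_Rintegral _ (integrable_bdd P bst)))//.
apply: (@le_trans _ _ (\int[P]_w m (B t w - B s w))).
  apply: le_Rintegral_bdd => // [|w]; first exact: bdd_measurable_norm.
  rewrite /m le_min; apply/andP; split; last by rewrite (le_trans (gl _ _))// distrC.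
  rewrite (le_trans (ler_normB _ _))//.
  by have := gM (B s w); have := gM (B t w); lra.
rewrite (Rintegral_bm_increment_normal _ mL) ?s0//.
set sg := Num.sqrt (t - s); set nu := normal_prob 0 sg.
have sg0 : 0 < sg by rewrite sqrtr_gt0 subr_gt0.
have sg2 : sg ^+ 2 = t - s by rewrite sqr_sqrtr// subr_ge0 ltW.
have i2 := integrable_normal_pow sg0 (isT : (2 <= 2)%N).
have i2' : nu.-integrable [set: R] (EFin \o (fun x => e^-1 * x ^+ 2)).
  by have := integrableZl measurableT e^-1 i2; apply: eq_integrable => //.
have ic : nu.-integrable [set: R] (EFin \o (fun=> e)).
  exact/integrable_bdd/bdd_measurable_cst.
have i3 : nu.-integrable [set: R] (EFin \o (fun x => e + e^-1 * x ^+ 2)).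
  by have := integrableD measurableT ic i2'; apply: eq_integrable => //.
have i4 : nu.-integrable [set: R] (EFin \o (fun x => L * (e + e^-1 * x ^+ 2))).
  by have := integrableZl measurableT L i3; apply: eq_integrable => //.
have im := integrable_bdd nu (bdd_lipschitz_comp mL (@measurable_id _ _ setT)).
apply: (@le_trans _ _ (\int[nu]_x (L * (e + e^-1 * x ^+ 2)))).
  apply: le_Rintegral => // x _; rewrite /m ge_min; apply/orP; right.
  rewrite ler_wpM2l// -(ler_pM2l e0) mulrDr mulrA divff ?gt_eqF// mul1r.
  have := sqr_ge0 (`|x| - e); have := real_normK (num_real x).
  by have := normr_ge0 x; nra.
rewrite RintegralZl// RintegralD// RintegralZl// Rintegral_cstT normal_variance//.
by rewrite sg2 mulrC [e^-1 * _]mulrC mulrC.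
Qed.

End brownian_expectation.

(** * Lindeberg replacement inside one block *)

Section block_clt.
Context {R : realType} d (T : measurableType d) (P : probability T R).
Context (B : R -> {mfun T >-> R}) (hB : standard_BM P B).
Implicit Types (g : R -> R) (L M K x r a s : R).

Let C0 : R := 2 + 12 * expR 2^-1.
Let C0_ge0 : 0 <= C0.
Proof. by rewrite addr_ge0// mulr_ge0// expR_ge0. Qed.

Let bexp := bm_exp P B.

Lemma bm_exp_lipschitz L M g s : bdd_lipschitz L M g ->
  bdd_lipschitz L M (fun x => bexp s (fun y => g (x + y))).
Proof.
move=> gL; have b x := bdd_lipschitz_comp (bdd_lipschitz_translate x gL)
  (@measurable_funPT _ _ _ _ (B s)).
have [gl gM] := gL.
split=> [x y|x]; last by apply: norm_Rintegral_le => //; exact: b.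
apply: Rintegral_distr_le; [exact: b|exact: b|move=> w].
by rewrite (le_trans (gl _ _))// opprD addrACA subrr addr0.
Qed.

Lemma bm_exp_dist s g h (e : R) : (exists L M, bdd_lipschitz L M g) ->
  (exists L M, bdd_lipschitz L M h) -> (forall x, `|g x - h x| <= e) ->
  `|bexp s g - bexp s h| <= e.
Proof.
move=> [L [M gL]] [L' [M' hL]] gh; apply: Rintegral_distr_le.
- exact: bdd_lipschitz_comp gL (@measurable_funPT _ _ _ _ (B s)).
- exact: bdd_lipschitz_comp hL (@measurable_funPT _ _ _ _ (B s)).
- by move=> w; exact: gh.
Qed.

(** The two-point variable and the Brownian increment have the same mean and variance, so the
    expansions cancel up to order two. Both cubic remainders are O((a / r)^3), as [a / r] dominates
    the two values and the standard deviation. *)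
Lemma centered_thin_step K L M g r a x : 0 < r < 1 -> 0 < a -> 0 <= K ->
  cubic_expansion K g -> bdd_lipschitz L M g ->
  `|r * g (x + a * (r^-1 - 1)) + (1 - r) * g (x - a) -
    bexp (a ^+ 2 * ((1 - r) / r)) (fun y => g (x + y))| <= K * C0 * (a / r) ^+ 3.
Proof.
move=> /andP[r0 r1] a0 K0 [g1 [g2 gK]] gL.
set v := a ^+ 2 * _.
have rN0 : r != 0 by rewrite gt_eqF.
have v0 : 0 <= v by rewrite /v mulr_ge0 ?sqr_ge0// divr_ge0 ?subr_ge0// ltW.
have H1 := bm_exp_expansion hB v0 K0 gL (gK x).
have A := gK x (a * (r^-1 - 1)); have D := gK x (- a).
have ar0 : 0 < a / r by rewrite divr_gt0.
have ir1 : 1 <= r^-1 by rewrite invr_ge1 ?unitfE// ltW.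
have h1 : `|a * (r^-1 - 1)| <= a / r.
  rewrite ger0_norm; first by rewrite ler_pM2l// gerBl.
  by rewrite mulr_ge0 ?subr_ge0// ltW.
have h2 : `|- a| <= a / r by rewrite normrN gtr0_norm// ler_peMr// ltW.
have h3 : Num.sqrt v <= a / r.
  rewrite -[a / r]ger0_norm ?(ltW ar0)// -sqrtr_sqr ler_wsqrtr// /v.
  rewrite exprMn ler_wpM2l ?sqr_ge0// expr2 mulrC ler_wpM2l ?invr_ge0 ?(ltW r0)//.
  by rewrite (le_trans _ ir1)// gerBl ltW.
have {}A : `|g (x + a * (r^-1 - 1)) - g x - g1 x * (a * (r^-1 - 1)) -
    g2 x * (a * (r^-1 - 1)) ^+ 2| <= K * (a / r) ^+ 3.
  by rewrite (le_trans A)// ler_wpM2l// lerXn2r ?nnegrE// ltW.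
have {}D : `|g (x - a) - g x - g1 x * - a - g2 x * (- a) ^+ 2| <= K * (a / r) ^+ 3.
  by rewrite (le_trans D)// ler_wpM2l// lerXn2r ?nnegrE// ltW.
have {}H1 : `|bexp v (fun h => g (x + h)) - (g x + g2 x * v)| <=
    12 * expR 2^-1 * (K * (a / r) ^+ 3).
  rewrite (le_trans H1)// -mulrA ler_wpM2l ?mulr_ge0 ?expR_ge0// ler_wpM2l//.
  by rewrite lerXn2r ?nnegrE ?sqrtr_ge0// ltW.
set b := bexp v _ in H1 *.
set X := _ - _ - _ in A; set Y := _ - _ - _ in D; set Z := b - _ in H1.
rewrite [X in `|X|](_ : _ = r * X + (1 - r) * Y - Z); last first.
  by rewrite /X /Y /Z /v; field.
have r1' : 0 <= 1 - r by rewrite subr_ge0 ltW.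
rewrite (le_trans (ler_normB _ _))// (le_trans (lerD (ler_normD _ _) (lexx _)))//.
rewrite !normrM (gtr0_norm r0) (ger0_norm r1').
have A' := ler_wpM2l (ltW r0) A; have D' := ler_wpM2l r1' D.
rewrite /C0 (_ : K * _ * _ = (2 + 12 * expR 2^-1) * (K * (a / r) ^+ 3)); last by ring.
have q0 : 0 <= K * (a / r) ^+ 3 by rewrite mulr_ge0// exprn_ge0// ltW.
by rewrite mulrDl; lra.
Qed.

(** In the induction, [S1] replaces the ball peeled off, with the remaining ones absorbed in the
    test function; [S2] replaces the remaining ones, conditionally on the Brownian increment. *)
Lemma lindeberg K L M g r a u x : 0 < r < 1 -> 0 < a -> 0 <= K -> 0 <= L ->
  cubic_expansion K g -> bdd_lipschitz L M g ->
  `|centered_thin r a g u x -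
    bexp (u%:R * (a ^+ 2 * ((1 - r) / r))) (fun y => g (x + y))| <=
  u%:R * (K * C0 * (a / r) ^+ 3).
Proof.
move=> r01 a0 K0 L0 gK gL; have /andP[r0 r1] := r01.
have r01' : 0 <= r <= 1 by rewrite !ltW.
set v := a ^+ 2 * _; set e := K * C0 * _.
have v0 : 0 <= v by rewrite /v mulr_ge0 ?sqr_ge0// divr_ge0 ?subr_ge0// ltW.
elim: u x => [|u IH] x.
  by rewrite centered_thin0 !mul0r /bexp (bm_exp0 hB) addr0 subrr normr0.
have tL := centered_thin_lipschitz a u r01' gL.
have tK := centered_thin_expansion a u r01' gK.
have := @centered_thin_step K L M (centered_thin r a g u) r a x r01 a0 K0 tK tL.
rewrite -centered_thinS -/v -/e => S1.
rewrite -[u.+1]add1n natrD mulrDl mul1r [X in _ <= X]mulrDl mul1r.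
rewrite /bexp (bm_exp_semigroup hB L0 v0 _ (bdd_lipschitz_translate x gL)); last first.
  by rewrite mulr_ge0.
have bx := bm_exp_lipschitz (u%:R * v) gL.
have b1 := bdd_lipschitz_comp (bdd_lipschitz_translate x bx) (@measurable_funPT _ _ _ _ (B v)).
have b2 := bdd_lipschitz_comp (bdd_lipschitz_translate x tL) (@measurable_funPT _ _ _ _ (B v)).
have S2 : `|\int[P]_w centered_thin r a g u (x + B v w) -
    \int[P]_w bexp (u%:R * v) (fun y => g (x + B v w + y))| <= u%:R * e.
  by apply: Rintegral_distr_le => // w; exact: IH.
have E : \int[P]_w bm_exp P B (u%:R * v) (fun y => g (x + (B v w + y))) =
    \int[P]_w bexp (u%:R * v) (fun y => g (x + B v w + y)).
  apply: eq_Rintegral => w _; congr (bm_exp P B _ _).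
  by apply/funext => y; rewrite addrA.
rewrite E; apply: le_trans (lerD S1 S2).
exact: (ler_distD (bexp v (fun y => centered_thin r a g u (x + y)))).
Qed.

(** [C] is independent of [g], so one constant serves all histories. Four errors are added:
    smoothing on either side ([A1], [A3]), replacement ([A2]), and the change of variance from [v]
    to [s] ([A4]). *)
Lemma block_clt L M (e : R) : 0 <= L -> 0 <= M -> 0 < e -> exists2 C, 0 <= C &
  forall g r a u x s, bdd_lipschitz L M g -> 0 < r < 1 -> 0 < a -> 0 <= s ->
  `|centered_thin r a g u x - bexp s (fun y => g (x + y))| <=
  e + C * (u%:R * (a / r) ^+ 3 + `|u%:R * (a ^+ 2 * ((1 - r) / r)) - s|).
Proof.
move=> L0 M0 e0; have L1 : 0 < L + 1 by rewrite ltr_wpDl.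
pose dl := e / (8 * (L + 1)); have dl0 : 0 < dl by rewrite divr_gt0// mulr_gt0.
have dlL : 2 * L * dl <= e / 4.
  rewrite /dl mulrA ler_pdivrMr ?mulr_gt0//; nra.
have [K [K0 smooth]] := smooth_approx L0 M0 dl0.
exists (K * C0 + L / (2 * dl)).
  by rewrite addr_ge0// ?mulr_ge0// invr_ge0 mulr_ge0// ltW.
move=> g r a u x s gL r01 a0 s0; have /andP[r0 r1] := r01.
have r01' : 0 <= r <= 1 by rewrite !ltW.
have [g' [gK [L' [M' gL']]] g'g] := smooth g gL.
set v := u%:R * (a ^+ 2 * _).
have v0 : 0 <= v.
  by rewrite /v mulr_ge0// mulr_ge0 ?sqr_ge0// divr_ge0 ?subr_ge0// ltW.
have L'0 : 0 <= L'.
  have [gl _] := gL'; have := gl 1 0; rewrite subr0 normr1 mulr1; exact: le_trans.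
have A1 : `|centered_thin r a g u x - centered_thin r a g' u x| <= e / 4.
  by apply: thin_dist => // w; rewrite distrC (le_trans (g'g _)).
have A2 := lindeberg u x r01 a0 K0 L'0 gK gL'.
have A3 : `|bexp v (fun y => g' (x + y)) - bexp v (fun y => g (x + y))| <= e / 4.
  apply: bm_exp_dist => [||y]; last by rewrite (le_trans (g'g _)).
    by exists L', M'; exact: bdd_lipschitz_translate.
  by exists L, M; exact: bdd_lipschitz_translate.
have A4 : `|bexp v (fun y => g (x + y)) - bexp s (fun y => g (x + y))| <=
    e / 2 + L / (2 * dl) * `|v - s|.
  have gLx := bdd_lipschitz_translate x gL.
  have dl2 : 0 < 2 * dl by rewrite mulr_gt0.
  apply: (@le_trans _ _ (L * (2 * dl + `|v - s| / (2 * dl)))); last first.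
    by rewrite mulrDr mulrA [L * (`|_| / _)]mulrCA [_ * (L / _)]mulrC lerD2r; lra.
  case: (leP v s) => vs.
    rewrite (ler0_norm (x := v - s)) ?subr_le0// opprB.
    by apply: (bm_exp_cont_le hB L0 M0 dl2 _ gLx); rewrite v0 vs.
  rewrite (ger0_norm (x := v - s)) ?subr_ge0 ?(ltW vs)// distrC.
  by apply: (bm_exp_cont_le hB L0 M0 dl2 _ gLx); rewrite s0 ltW.
rewrite -/v in A2.
rewrite (le_trans (ler_distD (bexp v (fun y => g (x + y))) _ _))//.
apply: (le_trans (lerD (le_trans (ler_distD (bexp v (fun y => g' (x + y))) _ _)
  (lerD (le_trans (ler_distD (centered_thin r a g' u x) _ _) (lerD A1 A2)) A3)) A4)).
set z := (a / r) ^+ 3.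
have z0 : 0 <= z by rewrite /z exprn_ge0// divr_ge0// ltW.
have q1 : 0 <= L / (2 * dl) * (u%:R * z).
  by apply: mulr_ge0; [rewrite divr_ge0// mulr_ge0// ltW|exact: mulr_ge0].
have q2 : 0 <= K * C0 * `|v - s| by apply: mulr_ge0 => //; exact: mulr_ge0.
rewrite (_ : u%:R * (K * C0 * z) = K * C0 * (u%:R * z)); last by ring.
lra.
Qed.

End block_clt.

(** * Uniform distance on the space of paths *)

Section uniform_distance.
Context {R : realType}.
Implicit Types (x y g : skorokhod R) (F : skorokhod R -> R).

Definition sup_le x y (r : R) := forall t : R, t \in `[0, 1] -> `|x t - y t| <= r.

Lemma sup_le_refl x : sup_le x x 0.
Proof. by move=> t _; rewrite subrr normr0. Qed.

Lemma sup_le_sym x y r : sup_le x y r -> sup_le y x r.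
Proof. by move=> xy t /xy; rewrite distrC. Qed.

Lemma sup_le_ge0 x y r : sup_le x y r -> 0 <= r.
Proof. by move=> /(_ 0); rewrite in_itv/= lexx ler01 => /(_ erefl); apply: le_trans. Qed.

Lemma sup_le_trans y x z r s : sup_le x y r -> sup_le y z s -> sup_le x z (r + s).
Proof.
by move=> xy yz t t01; rewrite (le_trans (ler_distD (y t) _ _))// lerD ?xy ?yz.
Qed.

Lemma nbhs_sup_le x (A : set (skorokhod R)) : nbhs x A ->
  exists2 e : R, 0 < e & forall y r, sup_le x y r -> r < e -> A y.
Proof.
move=> /nbhs_ballP[e /= e0 eA]; exists e => // y r xy re; apply: eA.
exists idfun, r; split; [exact: time_change_id|exact: re|move=> t t01].
by rewrite subrr normr0 (sup_le_ge0 xy); split => //; exact: xy.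
Qed.

(* The greatest minorant of [F] that is [k]-Lipschitz for the uniform
   distance. *)
Definition lip_env F (k : R) x : R :=
  inf [set v | exists g r, sup_le x g r /\ v = F g + k * r].

Context (F : skorokhod R -> R) (M k : R).
Hypotheses (FM : forall x, `|F x| <= M) (k0 : 0 <= k).

Let lbM x : lbound [set v | exists g r, sup_le x g r /\ v = F g + k * r] (- M).
Proof.
move=> _ [g [r [xg ->]]]; have := FM g; rewrite ler_norml => /andP[Fg _].
by rewrite (le_trans Fg)// lerDl mulr_ge0//; exact: sup_le_ge0 xg.
Qed.

Lemma lip_env_le x g r : sup_le x g r -> lip_env F k x <= F g + k * r.
Proof. by move=> xg; apply: ge_inf; [exists (- M); exact: lbM|exists g, r]. Qed.

Lemma lip_env_ge x (a : R) : (forall g r, sup_le x g r -> a <= F g + k * r) ->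
  a <= lip_env F k x.
Proof.
move=> H; apply: lb_le_inf => [|_ [g [r [xg ->]]]]; last exact: H.
by exists (F x + k * 0), x, 0; split => //; exact: sup_le_refl.
Qed.

Lemma lip_env_leF x : lip_env F k x <= F x.
Proof. by have := lip_env_le (sup_le_refl x); rewrite mulr0 addr0. Qed.

Lemma lip_env_bounded x : `|lip_env F k x| <= M.
Proof.
rewrite ler_norml; apply/andP; split; last first.
  by rewrite (le_trans (lip_env_leF x))// (le_trans (ler_norm _)).
apply: lip_env_ge => g r xg; apply: (@lbM x).
by exists g, r.
Qed.

Lemma lip_env_lipschitz x y r : sup_le x y r ->
  `|lip_env F k x - lip_env F k y| <= k * r.
Proof.
suff H u v : sup_le u v r -> lip_env F k u <= lip_env F k v + k * r.
  move=> xy; rewrite ler_norml; apply/andP; split.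
    by have := H _ _ (sup_le_sym xy); lra.
  by have := H _ _ xy; lra.
move=> uv; rewrite -lerBlDr; apply: lip_env_ge => g s vg.
have := lip_env_le (sup_le_trans uv vg); lra.
Qed.

End uniform_distance.

Section uniform_distance_limits.
Context {R : realType}.
Implicit Types (x y : skorokhod R) (F : skorokhod R -> R).

Lemma lip_env_cvg F (M : R) x : (forall x, `|F x| <= M) -> continuous F ->
  lip_env F k%:R x @[k --> \oo] --> F x.
Proof.
move=> FM cF; apply/cvgrPdist_le => e e0.
have := cF x; move/cvgrPdist_le => /(_ e e0) /nbhs_sup_le[d d0 dF].
near=> k.
rewrite ger0_norm ?subr_ge0 ?(lip_env_leF FM)//.
rewrite lerBlDr -lerBlDl; apply: lip_env_ge => g r xg.
have r0 := sup_le_ge0 xg.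
have [rd|dr] := ltP r d.
  have := dF _ _ xg rd; rewrite ler_norml => /andP[_].
  have : 0 <= k%:R * r by rewrite mulr_ge0.
  lra.
(* Beyond distance [d] the penalty exceeds the total oscillation [2 * M] of [F]. *)
have kM : 2 * M <= k%:R * d.
  rewrite -ler_pdivrMr//; near: k; exists (Num.truncn (2 * M / d)).+1 => // j /= jM.
  by rewrite (le_trans (ltW (truncnS_gt _)))// ler_nat.
have : k%:R * d <= k%:R * r by rewrite ler_wpM2l.
have := FM x; have := FM g; rewrite !ler_norml => /andP[A _] /andP[_ D]; lra.
Unshelve. all: by end_near. Qed.

Lemma open_sup_le (O : set (skorokhod R)) x y : open O -> sup_le x y 0 -> O x -> O y.
Proof.
move=> oO xy Ox; have : nbhs x O by exact: open_nbhs_nbhs.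
by move=> /nbhs_sup_le[e e0 H]; exact: H xy e0.
Qed.

Lemma continuous_sup_le F x y : continuous F -> sup_le x y 0 -> F x = F y.
Proof.
move=> cF xy; apply/eqP; rewrite -subr_eq0 -normr_le0; apply/ler_addgt0Pl => e e0.
rewrite addr0; have := cF x; move/cvgrPdist_le => /(_ e e0) /nbhs_sup_le[d d0 dF].
exact: dF xy d0.
Qed.

Lemma lip_env_indic_open (O : set (skorokhod R)) x : open O ->
  O x <-> 0 < lip_env (\1_O : _ -> R) 1 x.
Proof.
move=> oO.
have M1 (y : skorokhod R) : `|\1_O y : R| <= 1.
  by rewrite indicE; case: (_ \in _); rewrite ?normr1 ?normr0.
split=> [Ox|H].
  have : nbhs x O by exact: open_nbhs_nbhs.
  move=> /nbhs_sup_le[e e0 He].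
  apply: (@lt_le_trans _ _ (Num.min 1 e)); first by rewrite lt_min ltr01.
  (* A path closer than [e] lies in [O] and has indicator 1; any other costs at least [e]. *)
  apply: lip_env_ge => g r xg; rewrite mul1r ge_min; apply/orP.
  have [re|er] := ltP r e.
    left; rewrite indicE mem_set; last exact: He xg re.
    by rewrite lerDl (sup_le_ge0 xg).
  by right; rewrite (le_trans er)// lerDr indicE.
have := lt_le_trans H (lip_env_leF M1 ler01 x).
by rewrite indicE; case: (boolP (x \in O)) => [/set_mem//|]; rewrite ltxx.
Qed.

Lemma borel_measurableP d (T : measurableType d) (X : T -> skorokhod R) :
  (forall O : set (skorokhod R), open O -> measurable (X @^-1` O)) -> borel_measurable X.
Proof.
move=> H; apply: (@measurability _ _ _ (g_sigma_algebraType (@open (skorokhod R)))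
  setT X (@open (skorokhod R))) => // _ [V oV <-].
by rewrite setTI; exact: H.
Qed.

(* An open set [O] is where the uniformly Lipschitz function [lip_env \1_O 1]
   is positive. *)
Lemma borel_measurable_lim d (T : measurableType d) (X : nat -> T -> skorokhod R)
    (Y : T -> skorokhod R) :
  (forall (F : skorokhod R -> R) m, (forall x, `|F x| <= 1) ->
    measurable_fun [set: T] (fun w => lip_env F 1 (X m w))) ->
  (forall w (e : R), 0 < e -> \forall m \near \oo, sup_le (X m w) (Y w) e) ->
  borel_measurable Y.
Proof.
move=> mX XY; apply: borel_measurableP => O oO.
pose D := lip_env (\1_O : _ -> R) 1.
have M1 (y : skorokhod R) : `|\1_O y : R| <= 1.
  by rewrite indicE; case: (_ \in _); rewrite ?normr1 ?normr0.
have mD : measurable_fun [set: T] (D \o Y).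
  apply: (@measurable_fun_cvg _ _ _ _ (fun m w => D (X m w))) => [m|w _]; first exact: mX.
  apply/cvgrPdist_le => e e0; apply: filterS (XY w e e0) => m XYm.
  by rewrite distrC; have := lip_env_lipschitz M1 ler01 XYm; rewrite mul1r.
rewrite (_ : Y @^-1` O = (D \o Y) @^-1` `]0, +oo[).
  by rewrite -[X in measurable X]setTI; exact: mD.
by apply/seteqP; split => w /=; rewrite in_itv/= andbT => H;
  apply/(lip_env_indic_open (Y w) oO).
Qed.

Definition psum (s : seq R) (i : nat) : R := \sum_(j < i) s`_j.

Definition step_path m (f : nat -> R) : skorokhod R := Skorokhod (cadlag_step f m).

Lemma step_path_sup_le m (f g : nat -> R) r :
  (forall i, (i <= m)%N -> `|f i - g i| <= r) -> sup_le (step_path m f) (step_path m g) r.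
Proof.
move=> fg t; rewrite in_itv/= => /andP[t0 t1]; apply: fg.
rewrite -ltnS truncn_lt_nat ?mulr_ge0// (@le_lt_trans _ _ m%:R) ?ltr_nat//.
by rewrite ler_piMl.
Qed.

Lemma lipschitz_seq_step_path (F : skorokhod R -> R) (k M : R) m :
  0 <= k -> (forall x, `|F x| <= M) ->
  lipschitz_seq k (fun s => lip_env F k (step_path m (psum s))).
Proof.
move=> k0 FM s t st; apply: lip_env_lipschitz => //.
apply: step_path_sup_le => i _; rewrite /psum -sumrB (le_trans (ler_norm_sum _ _ _))//.
(* Past the end of the sequences, both read the default value 0. *)
have [ism|sim] := leqP i (size s).
  rewrite (big_ord_widen _ (fun j => `|s`_j - t`_j|) ism) big_mkcond/= ler_sum// => j _.
  by case: ifP.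
rewrite [leRHS](big_ord_widen _ (fun j => `|s`_j - t`_j|) (ltnW sim)).
rewrite [leRHS]big_mkcond/= ler_sum// => j _; case: ltnP => // sj.
by rewrite !nth_default ?subrr ?normr0// -st.
Qed.

End uniform_distance_limits.

(** * Step approximations of the stretched Brownian motion *)

Section stretched_brownian_motion.
Context {R : realType} d (T : measurableType d) (P : probability T R).
Context (B : R -> {mfun T >-> R}) (hB : standard_BM P B).
Context (H : R -> R) (hH : variance_function H).

Let Y := stretched_BM hB hH.

Lemma variance_function_ge0 (t : R) : 0 <= t -> 0 <= H t.
Proof.
have [_ mH H0] := hH; rewrite le_eqVlt => /predU1P[<-|t0]; first by rewrite H0.
by rewrite -H0 ltW// mH// in_itv/= ?lexx// ltW.
Qed.

Lemma variance_function_le (s t : R) : 0 <= s -> s <= t -> H s <= H t.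
Proof.
have [_ mH H0] := hH; move=> s0; rewrite le_eqVlt => /predU1P[<-//|st].
by rewrite ltW// mH// in_itv/= andbT// (le_trans s0)// ltW.
Qed.

Lemma stretched_BM_cont w (t e : R) : 0 <= t -> 0 < e ->
  exists2 dl : R, 0 < dl & forall s, 0 <= s -> `|t - s| < dl -> `|Y w t - Y w s| <= e.
Proof.
move=> t0 e0; have [_ _ _ /(_ w)/subspace_continuousP cB] := hB.
have [/subspace_continuousP cH _ _] := hH.
have Ht0 := variance_function_ge0 t0.
have Ht : `[0, +oo[%classic (H t) by rewrite /= in_itv/= Ht0.
have tt : `[0, +oo[%classic t by rewrite /= in_itv/= t0.
have /cvgrPdist_le/(_ e e0) := cB _ Ht.
move=> /nbhs_ballP[d1 /= d10 H1].
have /cvgrPdist_lt/(_ d1 d10) := cH _ tt.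
move=> /nbhs_ballP[d2 /= d20 H2]; exists d2 => // s s0 ts.
apply: H1; first by apply: H2 => //; rewrite /= in_itv/= s0.
by rewrite /= in_itv/= variance_function_ge0.
Qed.

(** Uniform continuity of the path on [0, 1], obtained by compactness from pointwise continuity. *)
Lemma step_path_stretched_BM_cvg w (e : R) : 0 < e ->
  \forall m \near \oo,
    sup_le (step_path m (fun i => B (H (i%:R / m%:R)) w)) (Y w) e.
Proof.
move=> e0.
have := @segment_compact R 0 1; move/compact_near_coveringP.
move=> /(_ nat \oo (fun m t => t \in `[0, 1] ->
  `|Y w ((Num.truncn (t * m%:R))%:R / m%:R) - Y w t| <= e) _) H1.
have {H1} := H1 _; set Q := (X in (X -> _) -> _).
have Q1 : Q.
  move=> x; rewrite /= in_itv/= => /andP[x0 x1].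
  have e20 : 0 < e / 2 by rewrite divr_gt0.
  have [dl dl0 D] := stretched_BM_cont w x0 e20.
  have dl2 : 0 < dl / 2 by rewrite divr_gt0.
  near=> t m; rewrite in_itv/= => /andP[t0 t1].
  have m0 : 0 < m%:R :> R by rewrite ltr0n; near: m; exists 1%N.
  have tm0 : 0 <= t * m%:R by rewrite mulr_ge0// ltW.
  have xt : `|x - t| < dl / 2.
    by near: t; apply/nbhs_ballP; exists (dl / 2).
  have md : m%:R^-1 < dl / 2.
    rewrite -[dl / 2]invrK ltf_pV2 ?posrE ?invr_gt0//.
    near: m; exists (Num.truncn (dl / 2)^-1).+1 => // j /= dj.
    by rewrite (lt_le_trans (truncnS_gt _))// ler_nat.
  have /andP[tl tu] := truncn_itv tm0.
  set s := _%:R / m%:R.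
  have s0 : 0 <= s by rewrite divr_ge0.
  have st : s <= t by rewrite ler_pdivrMr.
  have ts : t < s + m%:R^-1.
    by rewrite /s -[X in _ + X]mul1r -mulrDl natr1 ltr_pdivlMr.
  have h1 : `|Y w x - Y w t| <= e / 2 by apply: D => //; rewrite (lt_trans xt)//; lra.
  have h2 : `|Y w x - Y w s| <= e / 2.
    apply: D => //; rewrite (le_lt_trans (ler_distD t _ _))//.
    by rewrite [`|t - s|]ger0_norm ?subr_ge0//; lra.
  rewrite (le_trans (ler_distD (Y w x) _ _))// distrC.
  by have := lerD h2 h1; lra.
move=> /(_ Q1); apply: filterS => m H1 t t01.
exact: (H1 t t01 t01).
Unshelve. all: by end_near. Qed.

Definition bm_increment (m i : nat) (w : T) : R :=
  B (H (i.+1%:R / m%:R)) w - B (H (i%:R / m%:R)) w.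

Lemma measurable_bm_incr m i : measurable_fun [set: T] (bm_increment m i).
Proof. exact: measurable_funB. Qed.

Lemma bm_increment_indep m l k : mutually_independent P l (fun i => bm_increment m (k + i)).
Proof.
have [_ hI _ _] := hB.
rewrite (_ : (fun i => _) = fun i w => B (H ((k + i.+1)%:R / m%:R)) w - B (H ((k + i)%:R / m%:R)) w).
  apply: (hI l (fun i => H ((k + i)%:R / m%:R))).
    by apply: variance_function_ge0; rewrite divr_ge0.
  move=> i; apply: variance_function_le; first by rewrite divr_ge0.
  by rewrite ler_wpM2r ?invr_ge0// ler_nat addnS.
by apply/funext => i; apply/funext => w; rewrite /bm_increment addnS.
Qed.

Lemma psum_bm_increment m l i w : (i <= l)%N ->
  psum (mkseq (fun j => bm_increment m j w) l) i = B (H (i%:R / m%:R)) w.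
Proof.
have [B0 _ _ _] := hB; have [_ _ H0] := hH.
elim: i => [|i IH] il; first by rewrite /psum big_ord0 mul0r H0 B0.
rewrite /psum big_ord_recr/= -/(psum _ _) IH ?(ltnW il)//.
by rewrite nth_mkseq// /bm_increment addrC subrK.
Qed.

Lemma step_path_psum m w :
  sup_le (step_path m (psum (mkseq (fun j => bm_increment m j w) m)))
         (step_path m (fun i => B (H (i%:R / m%:R)) w)) 0.
Proof.
by apply: step_path_sup_le => i im; rewrite psum_bm_increment// subrr normr0.
Qed.

Lemma step_path_psum_cvg w (e : R) : 0 < e -> \forall m \near \oo,
  sup_le (step_path m (psum (mkseq (fun j => bm_increment m j w) m))) (Y w) e.
Proof.
move=> e0; apply: filterS (step_path_stretched_BM_cvg w e0) => m h.
by rewrite -[e]add0r; apply: sup_le_trans h; exact: step_path_psum.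
Qed.

Lemma stretched_BM_measurable : borel_measurable Y.
Proof.
apply: (@borel_measurable_lim _ _ _
  (fun m w => step_path m (psum (mkseq (fun j => bm_increment m j w) m)))).
- move=> F m FM.
  have [] := @bdd_measurable_lipschitz_seq _ _ _ P _ (measurable_bm_incr m) 1 1
    (fun s => lip_env F 1 (step_path m (psum s))) m
    (lipschitz_seq_step_path m ler01 FM) (fun s => lip_env_bounded FM ler01 _).
  by [].
- by move=> w e e0; exact: step_path_psum_cvg.
Qed.

End stretched_brownian_motion.

(** * Convergence of the increments over blocks *)

Section urn_blocks.
Context {R : realType} (c : R) (n : nat) (rho : R).
Hypotheses (c0 : 0 < c) (cn : c < n%:R).
Let q : R := 1 - c / n%:R.
Hypotheses (rho0 : 0 < rho) (rho_le : rho <= q ^+ n).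
Let N : R := Num.sqrt n%:R.

Let n0 : 0 < n%:R :> R. Proof. exact: lt_trans cn. Qed.
Let N0 : 0 < N. Proof. by rewrite sqrtr_gt0. Qed.
Let N2 : N ^+ 2 = n%:R. Proof. by rewrite sqr_sqrtr// ltW. Qed.
Let q0 : 0 < q. Proof. by rewrite subr_gt0 ltr_pdivrMr// mul1r. Qed.
Let q1 : q < 1. Proof. by rewrite gtrBl divr_gt0. Qed.
Let q01 : 0 <= q <= 1. Proof. by rewrite !ltW. Qed.
Let qk0 k : 0 < q ^+ k. Proof. by rewrite exprn_gt0. Qed.
Let qk1 k : q ^+ k <= 1. Proof. by rewrite exprn_ile1// ltW. Qed.
Let rho_qk k : (k <= n)%N -> rho <= q ^+ k.
Proof. by move=> kn; rewrite (le_trans rho_le)// ler_wiXn2l// ltW. Qed.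

Definition urn_path (h : seq nat) (k : nat) : R := rescaled_urn c n (nth 0%N h) k.

Lemma urn_pathE h k : urn_path h k = N^-1 * ((nth 0%N h k)%:R / q ^+ k) - N.
Proof.
by rewrite /urn_path /rescaled_urn -/q -/N; field; rewrite !gt_eqF.
Qed.

Lemma urn_exp_deviation k : (k <= n)%N ->
  urn_exp q k [:: n] (fun h => `|(last 0%N h)%:R / (n%:R * q ^+ k) - 1|) <=
  N^-1 * (1 + rho^-1).
Proof.
move=> kn; set psi := fun v : nat => `|v%:R / (n%:R * q ^+ k) - 1 : R|.
rewrite (@urn_exp_last _ q k [:: n] _ psi) //=.
(* The inequality |x| <= N x^2 + 1/N, with N the square root of n, gives order 1/N directly from the
   second moment. *)
apply: (@le_trans _ _ (thin (q ^+ k) (fun v => N * (0 + n%:R^-1 * (v%:R / q ^+ k - n%:R)) ^+ 2 + N^-1 * 1) n)).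
  apply: le_thin => [|v _]; first by rewrite ltW//= qk1.
  rewrite /psi (_ : _ / _ - 1 = 0 + n%:R^-1 * (v%:R / q ^+ k - n%:R)); last first.
    by field; rewrite !gt_eqF.
  set x := 0 + _.
  rewrite -(ler_pM2l N0) mulrDr mulr1 divff ?gt_eqF// mulrA -expr2.
  rewrite -[x ^+ 2]real_normK ?num_real//.
  have := sqr_ge0 (N * `|x| - 1); have := normr_ge0 x.
  have : 0 <= N * `|x| by rewrite mulr_ge0// ltW.
  by rewrite sqrrB1 exprMn; lra.
rewrite thin_lin thin_cst.
have := centered_thin_sqr n%:R^-1 n (0 : R) (lt0r_neq0 (qk0 k)).
rewrite /centered_thin => ->.
rewrite expr0n/= add0r mulr1 [leRHS]mulrDr mulr1 addrC lerD2l.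
rewrite (_ : N * _ = N^-1 * ((1 - q ^+ k) / q ^+ k)); last first.
  by rewrite -N2; field; rewrite !gt_eqF.
rewrite ler_wpM2l ?invr_ge0 ?(ltW N0)//.
rewrite (@le_trans _ _ (q ^+ k)^-1)//.
  by rewrite ler_piMl ?invr_ge0 ?(ltW (qk0 k))// gerBl ltW.
by rewrite lef_pV2 ?posrE// rho_qk.
Qed.

Context d (T : measurableType d) (P : probability T R).
Context (B : R -> {mfun T >-> R}).

(** Conditionally on [h], the increment has variance u / (n q^k) times [sg]. Replacing that random
    factor by 1 costs [dev h / rho], which is averaged over [h] by [urn_exp_deviation]; the term in
    [rho ^+ 3] is the Lindeberg error. *)
Lemma urn_block_clt (L M e C s : R) k l (Phi Psi : seq nat -> R) :
  (forall g r a u x s, bdd_lipschitz L M g -> 0 < r < 1 -> 0 < a -> 0 <= s ->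
    `|centered_thin r a g u x - bm_exp P B s (fun y => g (x + y))| <=
    e + C * (u%:R * (a / r) ^+ 3 + `|u%:R * (a ^+ 2 * ((1 - r) / r)) - s|)) ->
  0 <= C -> 0 <= s -> (0 < l)%N -> (k + l <= n)%N ->
  (forall h, size h = k.+1 -> exists2 g, bdd_lipschitz L M g &
    Phi h = bm_exp P B s g /\ forall t, size t = l ->
    Psi (h ++ t) = g (urn_path (h ++ t) (k + l) - urn_path (h ++ t) k)) ->
  `|urn_exp q (k + l) [:: n] Psi - urn_exp q k [:: n] Phi| <=
  e + C * (N^-1 / rho ^+ 3 + N^-1 * (1 + rho^-1) / rho +
    `|((q ^+ (k + l))^-1 - (q ^+ k)^-1) - s|).
Proof.
move=> clt C0 s0 l0 kln HPhi.
have kn : (k <= n)%N by rewrite (leq_trans _ kln)// leq_addr.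
set sg := (q ^+ (k + l))^-1 - (q ^+ k)^-1.
pose dev (h : seq nat) := `|(last 0%N h)%:R / (n%:R * q ^+ k) - 1|.
pose A := e + C * (N^-1 / rho ^+ 3 + `|sg - s|).
rewrite urn_exp_add -urn_expB (le_trans (norm_urn_exp q01 _ _ _))//.
apply: (@le_trans _ _ (urn_exp q k [:: n] (fun h => C / rho * dev h + A * 1))); last first.
  rewrite urn_exp_lin urn_exp_cst /A.
  have := urn_exp_deviation kn; rewrite -/dev => H.
  have Cr : 0 <= C / rho by rewrite divr_ge0// ltW.
  have := ler_wpM2l Cr H.
  rewrite (_ : C / rho * (N^-1 * _) = C * (N^-1 * (1 + rho^-1) / rho)); last by ring.
  lra.
apply: le_urn_exp => // t tk tall.
set h := [:: n] ++ t; have sh : size h = k.+1 by rewrite /= tk.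
set u := last 0%N h.
have un : (u <= n)%N.
  rewrite /u /h /=; case/lastP: t tk tall {h sh u} => [//|t v] _.
  by rewrite last_rcons all_rcons => /andP[].
have [g gL [-> HPsi]] := HPhi h sh.
have r0 : 0 < q ^+ l by [].
have r1 : q ^+ l < 1 by rewrite exprn_ilt1// -?lt0n// ltW.
pose a := N^-1 / q ^+ k; have a0 : 0 < a by rewrite divr_gt0// invr_gt0.
have nthk t' : nth 0%N (h ++ t') k = u by rewrite nth_cat sh ltnSn /u -nth_last sh.
have -> : urn_exp q l h Psi = centered_thin (q ^+ l) a g u 0.
  rewrite /centered_thin; apply: urn_exp_last => t' st' _; rewrite HPsi//.
  congr g; rewrite add0r !urn_pathE nthk.
  rewrite -[last _ _](nth_last 0%N) size_cat sh st' addSn /=.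
  by rewrite exprD /a; field; rewrite !gt_eqF.
have := clt g (q ^+ l) a u 0 s gL _ a0 s0.
rewrite r0 r1 => /(_ erefl).
rewrite (_ : (fun y => g (0 + y)) = g); last by apply/funext => y; rewrite add0r.
move=> H; apply: (le_trans H).
rewrite (_ : C / rho * dev h + A * 1 =
  e + C * (dev h / rho + (N^-1 / rho ^+ 3 + `|sg - s|))); last by rewrite /A; ring.
rewrite lerD2l ler_wpM2l//.
have arE : a / q ^+ l = N^-1 / q ^+ (k + l).
  by rewrite exprD /a; field; rewrite !gt_eqF.
have ar_le : a / q ^+ l <= N^-1 / rho.
  by rewrite arE ler_wpM2l ?invr_ge0 ?(ltW N0)// lef_pV2 ?posrE// rho_qk.
have ar0 : 0 <= a / q ^+ l by rewrite divr_ge0// ltW.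
have h1 : u%:R * (a / q ^+ l) ^+ 3 <= N^-1 / rho ^+ 3.
  rewrite (_ : N^-1 / _ = n%:R * (N^-1 / rho) ^+ 3); last first.
    by rewrite -N2; field; rewrite !gt_eqF.
  apply: ler_pM => //; rewrite ?exprn_ge0// ?ler_nat// lerXn2r ?nnegrE//.
  by rewrite divr_ge0 ?invr_ge0 ?(ltW N0) ?(ltW rho0).
have sg0 : 0 <= sg.
  by rewrite /sg subr_ge0 lef_pV2 ?posrE// ler_wiXn2l ?leq_addr// ltW.
have sg_le : sg <= rho^-1.
  rewrite /sg (@le_trans _ _ (q ^+ (k + l))^-1)//.
    by rewrite gerBl invr_ge0 ltW.
  by rewrite lef_pV2 ?posrE// rho_qk.
have h2 : `|u%:R * (a ^+ 2 * ((1 - q ^+ l) / q ^+ l)) - s| <= dev h / rho + `|sg - s|.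
  have -> : u%:R * (a ^+ 2 * ((1 - q ^+ l) / q ^+ l)) - s =
      (u%:R / (n%:R * q ^+ k) - 1) * sg + (sg - s).
    by rewrite /a /sg -N2 exprD; field; rewrite !gt_eqF.
  rewrite (le_trans (ler_normD _ _))// lerD2r normrM (ger0_norm sg0).
  by rewrite ler_wpM2l.
lra.
Qed.

(** Doob's inequality restarted at the beginning of the block, with [b] the current normalized
    content. The exponent 7 is 4 for [a ^+ 4] plus 3 for (1 - r) / r^3; the exponent 3 is 2 for
    [a ^+ 2] plus 1 for (1 - r) / r. *)
Lemma urn_block_max k l (e : R) (Q : pred (seq nat)) : 0 < e -> (k + l <= n)%N ->
  (forall h, Q h -> exists2 j, (j <= l)%N & e <= `|urn_path h (k + j) - urn_path h k|) ->
  urn_exp q (k + l) [:: n] (fun h => (Q h)%:R) <=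
  (n%:R^-1 * l%:R * (c / n%:R) / rho ^+ 7 + 3 * (l%:R * (c / n%:R) / rho ^+ 3) ^+ 2) / e ^+ 4.
Proof.
move=> e0 kln HQ; have kn : (k <= n)%N by rewrite (leq_trans _ kln)// leq_addr.
rewrite ler_pdivlMr ?exprn_gt0// urn_exp_add mulrC -urn_expZ.
set A := (X in _ <= X).
rewrite -[A](urn_exp_cst q k [:: n]); apply: le_urn_exp => // t tk tall.
set h := [:: n] ++ t; have sh : size h = k.+1 by rewrite /= tk.
set u := last 0%N h.
have un : (u <= n)%N.
  rewrite /u /h /=; case/lastP: t tk tall {h sh u} => [//|t v] _.
  by rewrite last_rcons all_rcons => /andP[].
have nthk t' : nth 0%N (h ++ t') k = u by rewrite nth_cat sh ltnSn /u -nth_last sh.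
rewrite mulrC.
have := @urn_exp_max _ q q01 l k h N^-1 e (u%:R / q ^+ k) Q q0 (ltW e0) sh.
move=> /(_ _)/le_trans; apply.
  move=> t' st' /HQ[j jl H]; exists j => //.
  by rewrite mulrBr; move: H; rewrite !urn_pathE nthk opprB addrA subrK.
pose a := N^-1 / q ^+ k; have a0 : 0 < a by rewrite divr_gt0// invr_gt0.
have -> : thin (q ^+ l) (fun v => (N^-1 * (v%:R / q ^+ (k + l) - u%:R / q ^+ k)) ^+ 4) u =
    centered_thin (q ^+ l) a (fun y => y ^+ 4) u 0.
  rewrite /centered_thin; apply: eq_thin => v _; rewrite add0r; congr (_ ^+ 4).
  by rewrite exprD /a; field; rewrite !gt_eqF.
have rl : 0 < q ^+ l <= 1 by rewrite qk0 qk1.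
rewrite (le_trans (centered_thin_exp4_le a u rl))// /A.
have ln : (l <= n)%N by rewrite (leq_trans _ kln)// leq_addl.
(* Bernoulli's inequality. *)
have p1 : 1 - q ^+ l <= l%:R * (c / n%:R).
  elim: (l) => [|i IH]; first by rewrite expr0 subrr mul0r.
  rewrite exprS -natr1 mulrDl mul1r.
  have := qk0 i; have := qk1 i; have : 0 <= c / n%:R by rewrite divr_ge0// ltW.
  move: IH; rewrite /q -/q; move: (q ^+ i) (c / n%:R) => x y; nra.
have r1' : 0 <= 1 - q ^+ l by rewrite subr_ge0.
set p := l%:R * (c / n%:R) in p1 *.
have p0 : 0 <= p := le_trans r1' p1.
have irho k' : (k' <= n)%N -> (q ^+ k')^-1 <= rho^-1.
  by move=> k'n; rewrite lef_pV2 ?posrE// rho_qk.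
have a_le : a <= N^-1 / rho by rewrite ler_wpM2l ?invr_ge0 ?(ltW N0)// irho.
have Nr0 : 0 <= N^-1 / rho by rewrite divr_ge0 ?invr_ge0 ?(ltW N0) ?(ltW rho0).
have un' : u%:R <= n%:R :> R by rewrite ler_nat.
apply: lerD.
  rewrite (_ : _ / rho ^+ 7 = n%:R * (N^-1 / rho) ^+ 4 * (p * (rho^-1) ^+ 3)); last first.
    by rewrite /p -N2; field; rewrite !gt_eqF.
  apply: ler_pM.
  - by rewrite mulr_ge0// exprn_ge0// ltW.
  - by rewrite divr_ge0// exprn_ge0// ltW.
  - by apply: ler_pM => //; rewrite ?exprn_ge0 ?(ltW a0)// lerXn2r ?nnegrE// ltW.
  - apply: ler_pM => //; first by rewrite invr_ge0 exprn_ge0// ltW.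
    rewrite -exprVn; apply: lerXn2r; last exact: irho.
      by rewrite nnegrE invr_ge0 ltW.
    by rewrite nnegrE invr_ge0 ltW.
rewrite ler_wpM2l// lerXn2r ?nnegrE//.
- by rewrite mulr_ge0 ?divr_ge0 ?(ltW (qk0 l))// mulr_ge0 ?sqr_ge0.
- by rewrite divr_ge0// exprn_ge0// ltW.
rewrite (_ : p / rho ^+ 3 = n%:R * (N^-1 / rho) ^+ 2 * (p * rho^-1)); last first.
  by rewrite -N2; field; rewrite !gt_eqF.
apply: ler_pM.
- by rewrite mulr_ge0// sqr_ge0.
- by rewrite divr_ge0// ltW.
- by apply: ler_pM => //; rewrite ?sqr_ge0// lerXn2r ?nnegrE// ltW.
- by apply: ler_pM => //; [rewrite invr_ge0 ltW|exact: irho].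
Qed.

End urn_blocks.

(** * Division of the time interval into blocks *)

Section block_times.
Context (n m : nat) (m0 : (0 < m)%N).

Definition block_time (j : nat) : nat := (j * n) %/ m.

Lemma block_time0 : block_time 0 = 0%N.
Proof. by rewrite /block_time mul0n div0n. Qed.

Lemma block_time_last : block_time m = n.
Proof. by rewrite /block_time mulKn. Qed.

Lemma leq_block_time i j : (i <= j)%N -> (block_time i <= block_time j)%N.
Proof. by move=> ij; rewrite leq_div2r// leq_mul2r ij orbT. Qed.

Lemma block_time_le j : (j <= m)%N -> (block_time j <= n)%N.
Proof. by move=> /leq_block_time; rewrite block_time_last. Qed.

(** Blocks are nonempty, so the survival probability over a block is below 1, as [urn_block_clt]
    demands. *)
Lemma ltn_block_time j : (m <= n)%N -> (block_time j < block_time j.+1)%N.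
Proof.
move=> mn; rewrite /block_time mulSn.
rewrite (leq_trans _ (leq_div2r m (leq_add mn (leqnn _))))// divnDl//.
by rewrite divnn m0.
Qed.

Lemma block_length_le j : (block_time j.+1 - block_time j <= n %/ m + 1)%N.
Proof.
rewrite leq_subLR /block_time mulSn divnD// addnA [(j * n %/ m + _)%N]addnC.
by rewrite leq_add2l leq_b1.
Qed.

Lemma block_time_itv (R : realType) j : (0 < n)%N ->
  j%:R / m%:R - n%:R^-1 <= ((block_time j)%:R / n%:R : R) <= j%:R / m%:R.
Proof.
move=> n0; have mR : 0 < m%:R :> R by rewrite ltr0n.
have nR : 0 < n%:R :> R by rewrite ltr0n.
apply/andP; split.
  rewrite lerBlDr -{2}[n%:R^-1]mul1r -mulrDl natr1 ler_pdivlMr// mulrAC ler_pdivrMr//.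
  by rewrite -!natrM ler_nat ltnW// ltn_ceil.
by rewrite ler_pdivrMr// mulrAC ler_pdivlMr// -!natrM ler_nat leq_trunc_div.
Qed.

End block_times.

(** * Powers of 1 - c/n *)

Section geometric_limit.
Context {R : realType} (c : R) (c0 : 0 < c).

(** Both bounds are 1 + x <= e^x, at x = - p and at x = p / (1 - p). *)
Lemma exp_geometric_bounds (p : R) k : 0 < p <= 1 / 2 ->
  expR (k%:R * p) <= ((1 - p) ^+ k)^-1 <= expR (k%:R * p / (1 - p)).
Proof.
move=> /andP[p0 p1]; have q0 : 0 < 1 - p by lra.
apply/andP; split.
  rewrite -[expR _]invrK -expRN lef_pV2 ?posrE ?expR_gt0 ?exprn_gt0//.
  rewrite -mulrN expRM_natl; apply: lerXn2r; rewrite ?nnegrE ?expR_ge0 ?(ltW q0)//.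
  by have := expR_ge1Dx (- p).
rewrite -mulrA expRM_natl -exprVn.
apply: lerXn2r; rewrite ?nnegrE ?invr_ge0 ?expR_ge0 ?(ltW q0)//.
apply: le_trans (expR_ge1Dx _); rewrite le_eqVlt; apply/orP; left; apply/eqP.
by field; rewrite gt_eqF.
Qed.

Lemma block_power_cvg m j : (0 < m)%N ->
  ((1 - c / n%:R) ^+ block_time n m j)^-1 @[n --> \oo] --> expR (c * (j%:R / m%:R)).
Proof.
move=> m0.
have inv0 : (n%:R^-1 : R) @[n --> \oo] --> (0 : R).
  apply/cvgrPdist_le => e e0; near=> n; rewrite sub0r normrN ger0_norm ?invr_ge0//.
  rewrite -[e]invrK lef_pV2 ?posrE ?invr_gt0//.
    near: n; exists (Num.truncn e^-1).+1 => // i /= ei.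
    by rewrite (le_trans (ltW (truncnS_gt _)))// ler_nat.
  by rewrite ltr0n; near: n; exists 1%N.
have bt : ((block_time n m j)%:R / n%:R : R) @[n --> \oo] --> (j%:R / m%:R : R).
  apply: (@squeeze_cvgr _ _ _ _ (fun n => j%:R / m%:R - n%:R^-1 : R) (fun=> j%:R / m%:R : R)).
  - by near=> n; apply: block_time_itv => //; near: n; exists 1%N.
  - by rewrite -[X in _ --> X]subr0; apply: cvgB => //; exact: cvg_cst.
  - exact: cvg_cst.
have p0 : (c / n%:R) @[n --> \oo] --> (0 : R).
  by rewrite -(mulr0 c); apply: cvgM => //; exact: cvg_cst.
have cbt : ((block_time n m j)%:R * (c / n%:R)) @[n --> \oo] --> c * (j%:R / m%:R).
  rewrite (_ : (fun n => _) = (fun n => c * ((block_time n m j)%:R / n%:R))).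
    by apply: cvgM => //; exact: cvg_cst.
  by apply/funext => n; ring.
apply: (@squeeze_cvgr _ _ _ _
  (fun n => expR ((block_time n m j)%:R * (c / n%:R)))
  (fun n => expR ((block_time n m j)%:R * (c / n%:R) / (1 - c / n%:R)))).
- near=> n; apply: exp_geometric_bounds.
  have n0 : 0 < n%:R :> R by rewrite ltr0n; near: n; exists 1%N.
  rewrite divr_gt0//= ler_pdivrMr// mul1r ler_pdivlMl//.
  near: n; exists (Num.truncn (2 * c)).+1 => // i /= ei.
  by rewrite (le_trans (ltW (truncnS_gt _)))// ler_nat.
- exact: (cvg_comp _ _ cbt (@continuous_expR R _)).
- have cbt' : ((block_time n m j)%:R * (c / n%:R) / (1 - c / n%:R)) @[n --> \oo] -->
      c * (j%:R / m%:R).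
    rewrite -[X in _ --> X]divr1; apply: cvgM => //.
    apply: cvgV; first exact: oner_neq0.
    by rewrite -[X in _ --> X]subr0; apply: cvgB => //; exact: cvg_cst.
  exact: (cvg_comp _ _ cbt' (@continuous_expR R _)).
Unshelve. all: by end_near. Qed.

Lemma geometric_lower_bound n : 2 * c <= n%:R ->
  expR (- (2 * c)) <= (1 - c / n%:R) ^+ n.
Proof.
move=> cn; have n0 : 0 < n%:R :> R by rewrite (lt_le_trans _ cn)// mulr_gt0.
have p12 : 0 < c / n%:R <= 1 / 2.
  by rewrite divr_gt0//= ler_pdivrMr// mul1r ler_pdivlMl.
have /andP[p0 p1] := p12.
have /andP[_] := exp_geometric_bounds n p12.
have q0 : 0 < (1 - c / n%:R) ^+ n by rewrite exprn_gt0//; lra.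
move=> H; rewrite -[leRHS]invrK expRN lef_pV2 ?posrE ?invr_gt0 ?expR_gt0//.
(* The factor 2 comes from 1 - c/n >= 1/2. *)
rewrite (le_trans H)// ler_expR ler_pdivrMr; last by lra.
rewrite mulrCA divff ?gt_eqF// mulr1.
by have := ler_wpM2l (ltW c0) p1; lra.
Qed.

End geometric_limit.

(** * Replacing urn increments by Brownian ones, block by block *)

Section finite_dimensional.
Context {R : realType} (c : R) (c0 : 0 < c).
Context d (T : measurableType d) (P : probability T R).
Context (B : R -> {mfun T >-> R}) (hB : standard_BM P B).
Let H := exp_variance c.
Let hH : variance_function H := exp_variance_function c0.
Context (m : nat) (m0 : (0 < m)%N).
Context (f : seq R -> R) (L M : R).
Hypotheses (fL : lipschitz_seq L f) (fM : forall s, `|f s| <= M) (L0 : 0 <= L).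

(* [hybrid j ys] averages [f] over Brownian increments from block [j] on, the
   first [j] increments being [ys]. *)
Definition hybrid (j : nat) (ys : seq R) : R :=
  \int[P]_w f (ys ++ mkseq (fun i => bm_increment B H m (j + i) w) (m - j)).

Let mX k i : measurable_fun [set: T] (bm_increment B H m (k + i)).
Proof. exact: measurable_bm_incr. Qed.

Lemma hybrid_lipschitz j ys : bdd_lipschitz L M (fun y => hybrid j.+1 (rcons ys y)).
Proof.
have b y : bdd_measurable (fun w => f (rcons ys y ++
    mkseq (fun i => bm_increment B H m (j.+1 + i) w) (m - j.+1))).
  exact: (@bdd_measurable_lipschitz_seq _ _ _ P _ (mX j.+1) L M
    (fun s => f (rcons ys y ++ s)) (m - j.+1) (lipschitz_seq_cat _ fL) (fun s => fM _)).
split=> [y z|y]; last by apply: norm_Rintegral_le => // w; exact: fM.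
apply: Rintegral_distr_le; [exact: b|exact: b|move=> w].
rewrite !cat_rcons; set t := mkseq _ _.
have := lipschitz_seq_cat ys fL (erefl : size (y :: t) = size (z :: t)).
by rewrite big_ord_recl big1 ?addr0//= => i _; rewrite subrr normr0.
Qed.

(** Integrating out one Brownian block puts [hybrid] in the form that [urn_block_clt] compares with
    the urn. *)
Lemma hybrid_step j ys : (j < m)%N ->
  hybrid j ys = bm_exp P B (H (j.+1%:R / m%:R) - H (j%:R / m%:R))
    (fun y => hybrid j.+1 (rcons ys y)).
Proof.
move=> jm; rewrite /hybrid -(subnSK jm).
rewrite (@Rintegral_indep_cons _ _ _ P (m - j.+1)
  (fun i => bm_increment B H m (j + i)) (fun s => f (ys ++ s)) L M (mX j)
  (bm_increment_indep hB hH m _ j) (lipschitz_seq_cat _ fL) (fun s => fM _)).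
have HmR : 0 <= H (j%:R / m%:R) <= H (j.+1%:R / m%:R).
  rewrite (variance_function_ge0 hH) ?divr_ge0//=.
  apply: (variance_function_le hH); first by rewrite divr_ge0.
  by rewrite ler_wpM2r ?invr_ge0// ler_nat.
rewrite -(Rintegral_bm_increment hB HmR (hybrid_lipschitz j ys)).
apply: eq_Rintegral => w _; rewrite /hybrid; apply: eq_Rintegral => w' _.
rewrite cat_rcons addn0; congr (f (_ ++ _ :: _)).
by apply: eq_mkseq => i; rewrite addnS addSn.
Qed.

Definition urn_increment n (h : seq nat) (i : nat) : R :=
  urn_path c n h (block_time n m i.+1) - urn_path c n h (block_time n m i).

Lemma urn_block_increment_cvg (e : R) : 0 < e -> \forall n \near \oo,
  `|urn_exp (1 - c / n%:R) n [:: n] (fun h => f (mkseq (urn_increment n h) m)) -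
    \int[P]_w f (mkseq (fun i => bm_increment B H m i w) m)| <= e.
Proof.
move=> e0; have mR : 0 < m%:R :> R by rewrite ltr0n.
have M0 : 0 <= M by exact: le_trans (normr_ge0 _) (fM [::]).
(* Half of [e] is shared among the [m] blocks; the other half absorbs the errors [err n j], which
   vanish as n grows. *)
pose e1 := e / (2 * m%:R); have e10 : 0 < e1 by rewrite divr_gt0// mulr_gt0.
have [C C0 clt] := block_clt hB L0 M0 e10.
pose rho : R := expR (- (2 * c)); have rho0 : 0 < rho by exact: expR_gt0.
pose sg n j : R := ((1 - c / n%:R) ^+ block_time n m j.+1)^-1 -
  ((1 - c / n%:R) ^+ block_time n m j)^-1.
pose s j : R := H (j.+1%:R / m%:R) - H (j%:R / m%:R).
have s0 j : 0 <= s j.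
  rewrite subr_ge0; apply: (variance_function_le hH); first by rewrite divr_ge0.
  by rewrite ler_wpM2r ?invr_ge0// ler_nat.
have sg_cvg j : `|sg n j - s j| @[n --> \oo] --> (0 : R).
  apply/norm_cvg0P; rewrite -(subrr (s j)); apply: cvgB; last exact: cvg_cst.
  have -> : s j = expR (c * (j.+1%:R / m%:R)) - expR (c * (j%:R / m%:R)).
    by rewrite /s /H /exp_variance; ring.
  by apply: cvgB; exact: block_power_cvg.
pose err n j : R := C * ((Num.sqrt n%:R)^-1 / rho ^+ 3 +
  (Num.sqrt n%:R)^-1 * (1 + rho^-1) / rho + `|sg n j - s j|).
have sqrt_cvg : (Num.sqrt n%:R)^-1 @[n --> \oo] --> (0 : R).
  apply/cvgrPdist_le => a a0; near=> n.
  have n0 : 0 < n%:R :> R by rewrite ltr0n; near: n; exists 1%N.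
  rewrite sub0r normrN ger0_norm ?invr_ge0 ?sqrtr_ge0//.
  rewrite -[a]invrK lef_pV2 ?posrE ?invr_gt0 ?sqrtr_gt0//.
  rewrite -[a^-1]ger0_norm ?invr_ge0 ?(ltW a0)// -sqrtr_sqr ler_wsqrtr//.
  near: n; exists (Num.truncn (a^-1 ^+ 2)).+1 => // i /= ei.
  by rewrite (le_trans (ltW (truncnS_gt _)))// ler_nat.
have err_cvg : \sum_(j < m) err n j @[n --> \oo] --> (0 : R).
  suff : \sum_(j < m) err n j @[n --> \oo] --> \sum_(j < m) (0 : R) by rewrite big1.
  apply: cvg_big => [|j _]; first exact: add_continuous.
  rewrite -(mulr0 C); apply: cvgM; first exact: cvg_cst.
  rewrite -[X in _ --> X]addr0; apply: cvgD => //.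
  rewrite -[X in _ --> X]addr0; apply: cvgD.
    rewrite -(mul0r (rho ^+ 3)^-1); apply: cvgM => //; exact: cvg_cst.
  rewrite -(mul0r (rho^-1)); apply: cvgM; last exact: cvg_cst.
  rewrite -(mul0r (1 + rho^-1)); apply: cvgM => //; exact: cvg_cst.
have e20 : 0 < e / 2 by rewrite divr_gt0.
have /cvgrPdist_le/(_ _ e20) sum_small := err_cvg.
near=> n.
have mn : (m <= n)%N by near: n; exists m.
have c2n : 2 * c <= n%:R.
  near: n; exists (Num.truncn (2 * c)).+1 => // i /= ei.
  by rewrite (le_trans (ltW (truncnS_gt _)))// ler_nat.
have cn : c < n%:R by apply: lt_le_trans c2n; rewrite mulr_natl mulr2n ltrDl.
have rho_le : rho <= (1 - c / n%:R) ^+ n by exact: geometric_lower_bound.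
(* Urn increments in the first [j] blocks, Brownian ones afterwards: [D m] is the urn mean, [D 0]
   the Brownian mean, and the difference telescopes. *)
pose D j := urn_exp (1 - c / n%:R) (block_time n m j) [:: n]
  (fun h => hybrid j (mkseq (urn_increment n h) j)).
have step j : (j < m)%N -> `|D j.+1 - D j| <= e1 + err n j.
  move=> jm; rewrite /D.
  have bt := ltn_block_time m0 j mn.
  have btn : (block_time n m j + (block_time n m j.+1 - block_time n m j) <= n)%N.
    by rewrite subnKC ?(ltnW bt)// block_time_le.
  rewrite -{1}(subnKC (ltnW bt)).
  have := @urn_block_clt _ c n rho c0 cn rho0 rho_le _ _ P B L M e1 C (s j)
    (block_time n m j) (block_time n m j.+1 - block_time n m j)
    (fun h => hybrid j (mkseq (urn_increment n h) j))
    (fun h => hybrid j.+1 (mkseq (urn_increment n h) j.+1))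
    clt C0 (s0 j) _ btn.
  rewrite subn_gt0 bt subnKC ?(ltnW bt)//; apply => // h sh.
  exists (fun y => hybrid j.+1 (rcons (mkseq (urn_increment n h) j) y)).
    exact: hybrid_lipschitz.
  split=> [|t st]; first exact: hybrid_step.
  rewrite mkseqS; congr (hybrid _ (rcons _ _)).
  (* Extending the history past the start of block [j] leaves the earlier increments unchanged. *)
  apply: (@eq_from_nth _ 0); rewrite size_mkseq ?size_mkseq// => i ij.
  rewrite !nth_mkseq// /urn_increment /urn_path /rescaled_urn.
  by rewrite !nth_cat sh !ltnS !leq_block_time// ltnW.
have -> : urn_exp (1 - c / n%:R) n [:: n] (fun h => f (mkseq (urn_increment n h) m)) = D m.
  rewrite /D block_time_last//; apply: eq_urn_exp => t _ _.
  by rewrite /hybrid subnn; under eq_Rintegral do rewrite cats0; rewrite Rintegral_cstT.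
have -> : \int[P]_w f (mkseq (fun i => bm_increment B H m i w) m) = D 0%N.
  by rewrite /D block_time0 /= /hybrid subn0.
have tele l : (l <= m)%N -> `|D l - D 0%N| <= \sum_(j < l) (e1 + err n j).
  elim: l => [|l IH] lm; first by rewrite subrr normr0 big_ord0.
  rewrite big_ord_recr/=; apply: le_trans (lerD (IH (ltnW lm)) (step l lm)).
  by rewrite [leRHS]addrC; exact: ler_distD.
rewrite (le_trans (tele m (leqnn m)))// big_split/= sumr_const card_ord -mulr_natr.
have -> : e1 * m%:R = e / 2 by rewrite /e1; field; rewrite gt_eqF.
have : `|0 - \sum_(j < m) err n j| <= e / 2 by near: n.
by rewrite sub0r normrN => /(le_trans (ler_norm _)); lra.
Unshelve. all: by end_near. Qed.

End finite_dimensional.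

(** * Oscillation inside blocks and conclusion *)

Section path_approximation.
Context {R : realType} (c : R) (n m : nat).
Hypotheses (m0 : (0 < m)%N) (mn : (m <= n)%N).

(** The end of the block is scanned too: when [m] does not divide (j+1) n, a time t < (j+1)/m can
    already have the integer part of t n equal to the next block time. *)
Definition exceeds (e : R) (j : nat) (h : seq nat) : bool :=
  has (fun i => e < `|urn_path c n h (block_time n m j + i) -
                      urn_path c n h (block_time n m j)|)
    (iota 0 (block_time n m j.+1 - block_time n m j).+1).

Let n0 : (0 < n)%N. Proof. exact: leq_trans mn. Qed.

Lemma psum_urn_increment h i : nth 0%N h 0 = n -> (i <= m)%N ->
  psum (mkseq (urn_increment c m n h) m) i = urn_path c n h (block_time n m i).
Proof.
move=> h0; elim: i => [|i IH] im.
  rewrite /psum big_ord0 block_time0 /urn_path /rescaled_urn h0 expr0 mulr1.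
  have nR : 0 < n%:R :> R by rewrite ltr0n.
  rewrite -{1}[n%:R]sqr_sqrtr ?(ltW nR)// expr2 mulfK ?subrr//.
  by rewrite gt_eqF// sqrtr_gt0.
rewrite /psum big_ord_recr/= -/(psum _ _) IH ?(ltnW im)//.
by rewrite nth_mkseq// /urn_increment addrC subrK.
Qed.

Lemma urn_path_sup_le (e : R) h : nth 0%N h 0 = n -> 0 <= e ->
  (forall j, (j < m)%N -> ~~ exceeds e j h) ->
  sup_le (step_path n (urn_path c n h))
    (step_path m (psum (mkseq (urn_increment c m n h) m))) e.
Proof.
move=> h0 e0 He t; rewrite in_itv/= => /andP[t0 t1].
have nR : 0 < n%:R :> R by rewrite ltr0n.
have mR : 0 < m%:R :> R by rewrite ltr0n.
have tn0 : 0 <= t * n%:R by rewrite mulr_ge0.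
have tm0 : 0 <= t * m%:R by rewrite mulr_ge0.
have /andP[kl ku] := truncn_itv tn0; have /andP[jl ju] := truncn_itv tm0.
rewrite /=; set k := Num.truncn (t * n%:R) in kl ku *.
set j := Num.truncn (t * m%:R) in jl ju *.
have kn : (k <= n)%N by rewrite -(ler_nat R) (le_trans kl)// ler_piMl.
have jm : (j <= m)%N by rewrite -(ler_nat R) (le_trans jl)// ler_piMl.
rewrite psum_urn_increment//.
(* The index [m] is reached only at t = 1, where both paths take the value at time [n]. *)
move: jm; rewrite leq_eqVlt => /predU1P[jm|jm].
  have t1' : t = 1.
    apply/eqP; rewrite eq_le t1/= -(ler_pM2r mR) mul1r.
    by move: jl; rewrite jm.
  have kE : k = n by rewrite /k t1' mul1r natrK.
  by rewrite kE jm block_time_last// subrr normr0.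
have bk : (block_time n m j <= k)%N.
  rewrite -ltnS ltn_divLR// -(ltr_nat R) !natrM.
  apply: (@le_lt_trans _ _ (t * m%:R * n%:R)); first by rewrite ler_wpM2r// ltW.
  by rewrite mulrAC ltr_pM2r.
have kb : (k <= block_time n m j.+1)%N.
  rewrite leq_divRL// -(ler_nat R) !natrM.
  apply: (@le_trans _ _ (t * n%:R * m%:R)); first by rewrite ler_wpM2r// ltW.
  by rewrite mulrAC ler_wpM2r// ltW.
have := He j jm; rewrite /exceeds => /hasPn/(_ (k - block_time n m j)%N).
rewrite mem_iota leq0n add0n ltnS leq_sub2r// => /(_ erefl).
by rewrite subnKC// -leNgt.
Qed.

Context (F : skorokhod R -> R) (k M e : R).
Hypotheses (FM : forall x, `|F x| <= M) (k0 : 0 <= k) (e0 : 0 <= e).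

(** Without an oscillation above [e], the two paths are within [e]; otherwise the sum is at least 1
    and [2 * M] bounds the whole difference. *)
Lemma lip_env_urn_path h : nth 0%N h 0 = n ->
  lip_env F k (step_path m (psum (mkseq (urn_increment c m n h) m))) -
  (k * e + 2 * M * \sum_(j < m) (exceeds e j h)%:R) <=
  F (step_path n (urn_path c n h)).
Proof.
move=> h0; set x := step_path m _; set y := step_path n _.
have M0 : 0 <= M by exact: le_trans (normr_ge0 _) (FM x).
have ke0 : 0 <= k * e by rewrite mulr_ge0.
have := lip_env_leF FM k0 y; apply: le_trans.
have [/forallP nex|] := boolP [forall j : 'I_m, ~~ exceeds e j h].
  have yx : sup_le y x e.
    by apply: urn_path_sup_le => // j jm; exact: (nex (Ordinal jm)).
  have := lip_env_lipschitz FM k0 yx; rewrite ler_norml => /andP[H _].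
  have : 0 <= 2 * M * \sum_(j < m) (exceeds e j h)%:R.
    by rewrite !mulr_ge0// sumr_ge0.
  lra.
rewrite negb_forall => /existsP[j]; rewrite negbK => ej.
have : 1 <= \sum_(j < m) (exceeds e j h)%:R :> R.
  by rewrite (bigD1 j)//= ej lerDl sumr_ge0.
set S := \sum_(j < m) _ => S1.
have := lip_env_bounded FM k0 x; have := lip_env_bounded FM k0 y.
rewrite !ler_norml => /andP[A _] /andP[_ D].
have : 2 * M * 1 <= 2 * M * S by rewrite ler_wpM2l// mulr_ge0.
lra.
Qed.

Hypotheses (c0 : 0 < c) (c2n : 2 * c <= n%:R) (e_gt0 : 0 < e).
Let rho : R := expR (- (2 * c)).

(** Each block contributes at most [K], of order m^-2. In the constants, 12 c^2 is 3 (2c)^2. *)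
Lemma urn_exp_exceeds_le : urn_exp (1 - c / n%:R) n [:: n]
    (fun h => \sum_(j < m) (exceeds e j h)%:R) <=
  (2 * c / rho ^+ 7 + 12 * c ^+ 2 / rho ^+ 6) / e ^+ 4 / m%:R.
Proof.
have nR : 0 < n%:R :> R by rewrite ltr0n.
have mR : 0 < m%:R :> R by rewrite ltr0n.
have rho0 : 0 < rho by exact: expR_gt0.
have cn : c < n%:R by apply: lt_le_trans c2n; rewrite mulr_natl mulr2n ltrDl.
have rho_le := geometric_lower_bound c0 c2n.
rewrite (urn_exp_sum _ _ _ _ (fun j h => (exceeds e j h)%:R)).
pose K := (2 * c / rho ^+ 7 + 12 * c ^+ 2 / rho ^+ 6) / e ^+ 4 / m%:R ^+ 2.
apply: (@le_trans _ _ (\sum_(j < m) K)); last first.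
  rewrite sumr_const card_ord -mulr_natr /K le_eqVlt; apply/orP; left; apply/eqP.
  by field; rewrite !gt_eqF// exprn_gt0.
apply: ler_sum => j _; set k1 := block_time n m j.
set l := (block_time n m j.+1 - block_time n m j)%N.
have bt := ltn_block_time m0 j mn.
have kln : (k1 + l <= n)%N by rewrite /k1 /l subnKC ?(ltnW bt)// block_time_le.
(* The event depends only on the history up to the end of block [j], so the later steps integrate to
   1. *)
have -> : urn_exp (1 - c / n%:R) n [:: n] (fun h => (exceeds e j h)%:R) =
    urn_exp (1 - c / n%:R) (k1 + l) [:: n] (fun h => (exceeds e j h)%:R).
  transitivity (urn_exp (1 - c / n%:R) (k1 + l + (n - (k1 + l))) [:: n]
      (fun h => (exceeds e j h)%:R : R)); first by rewrite subnKC.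
  rewrite urn_exp_add; apply: eq_urn_exp => s sl _.
  rewrite -[RHS](urn_exp_cst (1 - c / n%:R) (n - (k1 + l)) ([:: n] ++ s)).
  apply: eq_urn_exp => t _ _; congr (nat_of_bool _)%:R.
  rewrite /exceeds -/k1 -/l; apply: eq_in_has => i; rewrite mem_iota add0n ltnS => /= il.
  rewrite /urn_path /rescaled_urn -!cat_cons !nth_cat /= sl !ltnS leq_add2l il.
  by rewrite leq_addr.
have := @urn_block_max _ c n rho c0 cn rho0 rho_le k1 l e (exceeds e j) e_gt0 kln.
move=> /(_ _)/le_trans; apply.
  move=> h /hasP[i]; rewrite mem_iota add0n ltnS => /= il ei.
  by exists i => //; exact: ltW.
(* A block has at most n/m + 1 <= 2n/m steps, since [m <= n]. *)
have lcn : l%:R * (c / n%:R) <= 2 * c / m%:R.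
  have : (l * m <= 2 * n)%N.
    have := block_length_le n m0 j; rewrite -/l => lb.
    rewrite (leq_trans (leq_mul lb (leqnn m)))// mulnDl mul1n mul2n -addnn.
    by rewrite leq_add// leq_trunc_div.
  rewrite -(ler_nat R) !natrM => lm.
  rewrite ler_pdivlMr// mulrA mulrAC ler_pdivrMr// mulrAC.
  have := ler_wpM2l (ltW c0) lm; lra.
have lc0 : 0 <= l%:R * (c / n%:R) by rewrite mulr_ge0// divr_ge0// ltW.
have nm : n%:R^-1 <= m%:R^-1 :> R by rewrite lef_pV2 ?posrE// ler_nat.
rewrite /K [leRHS]mulrAC ler_wpM2r ?invr_ge0 ?exprn_ge0 ?(ltW e_gt0)//.
rewrite [leRHS]mulrDl lerD//.
  rewrite (_ : 2 * c / _ / _ = m%:R^-1 * (2 * c / m%:R) / rho ^+ 7); last first.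
    by field; rewrite !gt_eqF.
  rewrite ler_wpM2r ?invr_ge0 ?exprn_ge0 ?(ltW rho0)// -mulrA.
  by apply: ler_pM; rewrite ?invr_ge0.
rewrite (_ : 12 * c ^+ 2 / _ / _ = 3 * (2 * c / m%:R / rho ^+ 3) ^+ 2); last first.
  by field; rewrite !gt_eqF.
rewrite ler_wpM2l// lerXn2r ?nnegrE//.
- by rewrite divr_ge0// exprn_ge0// ltW.
- by rewrite !divr_ge0 ?exprn_ge0 ?(ltW rho0)// mulr_ge0// ltW.
- by rewrite ler_wpM2r// invr_ge0 exprn_ge0// ltW.
Qed.

End path_approximation.

(** * Lower bound for the limit of the urn means *)

Section convergence.
Context {R : realType} (c : R) (c0 : 0 < c).
Context d (T : measurableType d) (P : probability T R).
Context (B : R -> {mfun T >-> R}) (hB : standard_BM P B).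
Let Y := stretched_BM hB (exp_variance_function c0).

Definition urn_mean (F : skorokhod R -> R) (n : nat) : R :=
  urn_exp (1 - c / n%:R) n [:: n] (fun h => F (step_path n (urn_path c n h))).

Let bm_seq m w := mkseq (fun j => bm_increment B (exp_variance c) m j w) m.

Lemma lip_env_stretched_cvg (F : skorokhod R -> R) (k M : R) :
  0 <= k -> (forall x, `|F x| <= M) ->
  bdd_measurable (fun w => lip_env F k (Y w)) /\
  \int[P]_w lip_env F k (step_path m (psum (bm_seq m w))) @[m --> \oo] -->
  \int[P]_w lip_env F k (Y w).
Proof.
move=> k0 FM; apply: (@bounded_cvg _ _ _ P _ _ M) => [m|m w|w].
- have [] := @bdd_measurable_lipschitz_seq _ _ _ P _
    (measurable_bm_incr B (exp_variance c) m) k M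
    (fun s => lip_env F k (step_path m (psum s))) m
    (lipschitz_seq_step_path m k0 FM) (fun s => lip_env_bounded FM k0 _).
  by [].
- exact: lip_env_bounded.
- apply/cvgrPdist_le => e e0; have k1 : 0 < k + 1 by rewrite ltr_wpDl.
  have ek : 0 < e / (k + 1) by rewrite divr_gt0.
  apply: filterS (step_path_psum_cvg hB (exp_variance_function c0) w ek) => m H.
  rewrite distrC (le_trans (lip_env_lipschitz FM k0 H))//.
  rewrite mulrA ler_pdivrMr// mulrC ler_wpM2l ?(ltW e0)//.
  by rewrite lerDl.
Qed.

Lemma bdd_measurable_stretched (F : skorokhod R -> R) (M : R) :
  continuous F -> (forall x, `|F x| <= M) ->
  bdd_measurable (fun w => F (Y w)) /\
  \int[P]_w lip_env F k%:R (Y w) @[k --> \oo] --> \int[P]_w F (Y w).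
Proof.
move=> cF FM; apply: (@bounded_cvg _ _ _ P _ _ M) => [k|k w|w].
- by have [[]] := lip_env_stretched_cvg (ler0n R k) FM.
- exact: lip_env_bounded.
- exact: lip_env_cvg FM cF.
Qed.

(** The parameters are chosen in the order [k], [eps], [m], [n]. The five errors of size e/5 are:
    Lipschitz minorant against [F], step approximation of the limit, replacement of the increments,
    oscillations up to [eps], and blocks that exceed [eps]. *)
Lemma urn_mean_ge (F : skorokhod R -> R) (M e : R) :
  continuous F -> (forall x, `|F x| <= M) -> 0 < e ->
  \forall n \near \oo, \int[P]_w F (Y w) - e <= urn_mean F n.
Proof.
move=> cF FM e0; have e5 : 0 < e / 5 by rewrite divr_gt0.
have M0 : 0 <= M by exact: le_trans (normr_ge0 _) (FM (step_path 0 (fun=> 0))).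
have [_ /cvgrPdist_le/(_ _ e5) [k _ /(_ k (leqnn k)) /= Hk]] := bdd_measurable_stretched cF FM.
have k0 : 0 <= k%:R :> R by [].
have k1 : 0 < k%:R + 1 :> R by rewrite ltr_wpDl.
pose eps : R := e / 5 / (k%:R + 1); have eps0 : 0 < eps by rewrite divr_gt0.
pose rho : R := expR (- (2 * c)); have rho0 : 0 < rho by exact: expR_gt0.
pose K : R := 2 * M * ((2 * c / rho ^+ 7 + 12 * c ^+ 2 / rho ^+ 6) / eps ^+ 4).
have K0 : 0 <= K.
  rewrite /K; apply: mulr_ge0; first exact: mulr_ge0.
  apply: divr_ge0; last by rewrite exprn_ge0// ltW.
  by apply: addr_ge0; apply: divr_ge0; rewrite ?exprn_ge0 ?mulr_ge0 ?sqr_ge0// ltW.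
have [_ /cvgrPdist_le/(_ _ e5) [m1 _ Hm]] := lip_env_stretched_cvg k0 FM.
pose m := maxn m1 (Num.truncn (K / (e / 5))).+1.
have m0 : (0 < m)%N by rewrite leq_max orbT.
have mR : 0 < m%:R :> R by rewrite ltr0n.
have {Hm}/= Hm := Hm m (leq_maxl _ _).
have Km : K / m%:R <= e / 5.
  rewrite ler_pdivrMr// mulrC -ler_pdivrMr//.
  by rewrite (le_trans (ltW (truncnS_gt _)))// ler_nat leq_maxr.
have fdd := urn_block_increment_cvg c0 hB m0 (lipschitz_seq_step_path m k0 FM)
  (fun s => lip_env_bounded FM k0 _) k0 e5.
near=> n.
have mn : (m <= n)%N by near: n; exists m.
have n0 : (0 < n)%N by exact: leq_trans mn.
have nR : 0 < n%:R :> R by rewrite ltr0n.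
have c2n : 2 * c <= n%:R.
  near: n; exists (Num.truncn (2 * c)).+1 => // i /= ei.
  by rewrite (le_trans (ltW (truncnS_gt _)))// ler_nat.
have q01 : 0 <= 1 - c / n%:R <= 1.
  rewrite subr_ge0 gerBl ler_pdivrMr// mul1r divr_ge0 ?(ltW c0)// andbT.
  by apply: le_trans c2n; rewrite mulr_natl mulr2n lerDl ltW.
have : `|urn_exp (1 - c / n%:R) n [:: n]
    (fun h => lip_env F k%:R (step_path m (psum (mkseq (urn_increment c m n h) m)))) -
    \int[P]_w lip_env F k%:R (step_path m (psum (bm_seq m w)))| <= e / 5.
  by near: n; exact: fdd.
set A := urn_exp _ _ _ _ => HA.
pose S h : R := \sum_(j < m) (exceeds c n m eps j h)%:R.
have HS := urn_exp_exceeds_le m0 mn c0 c2n eps0.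
have : urn_exp (1 - c / n%:R) n [:: n] (fun h =>
    lip_env F k%:R (step_path m (psum (mkseq (urn_increment c m n h) m))) -
    (k%:R * eps * 1 + 2 * M * S h)) <= urn_mean F n.
  apply: le_urn_exp => // s sn _; rewrite mulr1.
  exact: (@lip_env_urn_path R c n m m0 mn F k%:R M eps FM k0 (ltW eps0) ([:: n] ++ s) erefl).
rewrite urn_expB -/A urn_exp_lin urn_exp_cst mulr1.
have MS : 2 * M * urn_exp (1 - c / n%:R) n [:: n] S <= K / m%:R.
  rewrite /K -[leRHS]mulrA ler_wpM2l//; exact: mulr_ge0.
have keps : k%:R * eps <= e / 5.
  by rewrite /eps mulrCA ler_piMr ?(ltW e5)// ler_pdivrMr// mul1r lerDl.
move: HA Hm Hk; rewrite !ler_norml => /andP[HA1 _] /andP[_ Hm1] /andP[_ Hk1].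
rewrite -/bm_seq in HA1.
lra.
Unshelve. all: by end_near. Qed.

End convergence.

Section urn_paths.
Context {R : realType} (c : R) d (T : measurableType d) (U : nat -> {mfun T >-> nat}).

Lemma rescaled_urn_path_mkseq n w :
  sup_le (rescaled_urn_path c n (fun k => U k w))
    (step_path n (urn_path c n (mkseq (fun k => U k w) n.+1))) 0.
Proof.
apply: (@step_path_sup_le _ n (rescaled_urn c n (fun k => U k w))) => i ilen.
by rewrite /urn_path /rescaled_urn nth_mkseq ?ltnS// subrr normr0.
Qed.

(** Up to distance 0 the path is a function of the finite history, which takes countably many
    values. *)
Lemma borel_measurable_urn_path n :
  borel_measurable (fun w => rescaled_urn_path c n (fun k => U k w)).
Proof.
apply: borel_measurableP => V oV.
rewrite (_ : _ @^-1` V = [set w | V (step_path n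
    (urn_path c n (mkseq (fun k => U k w) n.+1)))]).
  exact: (@measurable_mkseq _ _ (fun k w => U k w) n.+1
    (fun h => V (step_path n (urn_path c n h)))).
apply/seteqP; split => w /=; apply: open_sup_le => //.
  exact: rescaled_urn_path_mkseq.
by apply: sup_le_sym; exact: rescaled_urn_path_mkseq.
Qed.

End urn_paths.

Theorem theorem4p2 (R : realType) (c : R) (c_gt0 : 0 < c)
    (d : nat -> measure_display) (Om : forall n, measurableType (d n))
    (P : forall n, probability (Om n) R)
    (U b : forall n, nat -> {mfun Om n >-> nat})
    (hU : forall n, c < n%:R -> urn_process (P n) n (c / n%:R) (U n) (b n))
    (d' : measure_display) (Om' : measurableType d') (P' : probability Om' R)
    (B : R -> {mfun Om' >-> R}) (hB : standard_BM P' B) :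
  cvg_in_distribution P
    (fun n w => rescaled_urn_path c n (fun k => U n k w))
    P' (stretched_BM hB (exp_variance_function c_gt0)).
Proof.
split=> [n||F cF [M FM]].
- exact: borel_measurable_urn_path.
- exact: stretched_BM_measurable.
set Y := stretched_BM _ _.
have [bY _] := bdd_measurable_stretched c_gt0 hB cF FM.
pose Phi n h := F (step_path n (urn_path c n h)).
(* The rescaled path is built from the whole process and [Phi n] from times up to [n] only; the two
   paths agree on [0, 1], so [F] does not separate them. *)
have FE n w : F (rescaled_urn_path c n (fun k => U n k w)) =
    Phi n (mkseq (fun k => U n k w) n.+1).
  by apply: continuous_sup_le => //; exact: rescaled_urn_path_mkseq.
have bX n : bdd_measurable (fun w => Phi n (mkseq (fun k => U n k w) n.+1)).
  split; last by exists M => w; exact: FM.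
  exact: (@measurable_fun_mkseq _ _ _ R (fun k w => U n k w) n.+1 (Phi n)).
have EE n : 'E_(P n)[F \o (fun w => rescaled_urn_path c n (fun k => U n k w))]%E =
    (\int[P n]_w Phi n (mkseq (fun k => U n k w) n.+1))%:E.
  by rewrite -expectation_bdd//; congr ('E_ _[_])%E; apply/funext => w; exact: FE.
rewrite (funext EE) [X in _ --> X](expectation_bdd P' bY).
apply: cvg_EFin; first exact: nearW.
have cNF : continuous (fun x => - F x) by move=> x; exact: cvgN (cF x).
have FNM x : `|- F x| <= M by rewrite normrN.
apply/cvgrPdist_le => e e0.
have lo := urn_mean_ge c_gt0 hB cF FM e0.
have up := urn_mean_ge c_gt0 hB cNF FNM e0.
near=> n.
have cn : c < n%:R.
  near: n; exists (Num.truncn c).+1 => // i /= ei.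
  by rewrite (lt_le_trans (truncnS_gt _))// ler_nat.
have nR : 0 < n%:R :> R by exact: lt_trans cn.
have p01 : 0 <= c / n%:R <= 1.
  by rewrite divr_ge0 ?(ltW c_gt0)//= ler_pdivrMr// mul1r ltW.
rewrite /= (Rintegral_urn p01 (hU n cn) n (M := M)) => [|h]; last exact: FM.
have h1 : \int[P']_w F (Y w) - e <= urn_mean c F n by near: n.
have : \int[P']_w - F (Y w) - e <= urn_mean c (fun x => - F x) n by near: n.
have -> : urn_mean c (fun x => - F x) n = - urn_mean c F n.
  by rewrite /urn_mean -[RHS]mulN1r -urn_expZ; apply: eq_urn_exp => s _ _; rewrite mulN1r.
have -> : \int[P']_w - F (Y w) = - \int[P']_w F (Y w).
  rewrite -[RHS]mulN1r -RintegralZl//; last exact: integrable_bdd bY.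
  by apply: eq_Rintegral => w _; rewrite mulN1r.
rewrite -/(urn_mean c F n) => h2.
rewrite ler_norml; apply/andP; split; lra.
Unshelve. all: by end_near. Qed.
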